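(* Let $V=\{f\in SK\mid o_f\le1\}$, where $o_f$ is the maximal pole order of $f$. (a) $V$ is a complex vector space, and $V/\mathbb{C}=\operatorname{span}_{\mathbb{C}}\{\widehat{\mathscr{Z}^{\circledast_+n}}\mid n=1,2,\ldots\}$, where $\hat f$ denotes the class of $f$ modulo additive constants. (b) For $n\ge1$ and for $m\in\mathbb{N}_0$, the residue of $\mathscr{Z}^{\circledast_+n}(x)$ at $x=m\tau$ is $$(-\Delta\mathscr{Z})^{n-1}\binom{m-1}{n-1}.$$
   Context: Fix $\tau\in\mathbb{C}$ with $\operatorname{Im}(\tau)>0$ and let $\Lambda=\mathbb{Z}+\tau\mathbb{Z}$. For a meromorphic function $f$ on $\mathbb{C}$ of period $1$ put $\Delta f(x)=f(x+\tau)-f(x)$. $SK$ (special quasi-elliptic functions) is the set of meromorphic functions $f$ on $\mathbb{C}$ of period $1$, with all poles in $\Lambda$, such that $\Delta^kf=0$ for some $k\ge0$. $\mathscr{Z}(x)=\zeta(x)-e_2x$, where $\zeta$ is the Weierstrass zeta function of $\Lambda$ and $e_2=\zeta(x+1)-\zeta(x)$ (a constant). Then $\mathscr{Z}\in SK$ and $\Delta\mathscr{Z}=-2\pi i$ is constant. Convolution: for meromorphic $1$-periodic functions $f,g$ on $\mathbb{C}$ with poles only in $\Lambda$, and for $0<\operatorname{Im}(x)<2\operatorname{Im}(\tau)$, define $(f\circledast_+ g)(x)=\oint_{\operatorname{Im}(z)=\operatorname{Im}(x)/2}f(x-z)g(z)\,dz$, where the integral runs over one real period, i.e. over $z=t+\tfrac{i}{2}\operatorname{Im}(x)$,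 $t\in[0,1]$. This has a unique analytic continuation to a meromorphic function on $\mathbb{C}$ of period $1$, also denoted $f\circledast_+ g$. On $SK$ this product is commutative and associative with values in $SK$. $f^{\circledast_+n}$ denotes the $n$-fold product of $f$ with itself, with $f^{\circledast_+1}=f$. Binomial coefficients are the generalized ones: $\binom{a}{r}=a(a-1)\cdots(a-r+1)/r!$. *)

(* Defs.v *)
From Stdlib Require Import Reals ZArith List ClassicalEpsilon.
From Coquelicot Require Import Coquelicot.

Open Scope C_scope.

(** * Meromorphic functions on the complex plane

    A meromorphic function is represented by a total function [C -> C] whose
    values on a closed discrete set (in particular at its poles) carry no
    information.  Two representatives denote the same meromorphic function when
    they are related by [mer_eq], and every notion below is invariant under
    [mer_eq] (for the convolution, which is defined by a choice, its result is
    determined up to [mer_eq]). *)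

Definition mer_eq (f g : C -> C) : Prop :=
  forall z0 : C, @locally' C_UniformSpace z0 (fun z => f z = g z).

Definition holomorphic_at (h : C -> C) (z0 : C) : Prop :=
  @locally C_UniformSpace z0 (fun z => @ex_derive C_AbsRing C_NormedModule h z).

(** [f] has a pole of order [N] at [z0]; [N = 0] means that [f] is holomorphic
    at [z0] (after removing a removable singularity). *)
Definition pole_order (f : C -> C) (z0 : C) (N : nat) : Prop :=
  exists h : C -> C,
    holomorphic_at h z0 /\
    (N = 0%nat \/ h z0 <> 0) /\
    @locally' C_UniformSpace z0 (fun z => f z = h z / (z - z0) ^ N).

Definition meromorphic (f : C -> C) : Prop :=
  forall z0 : C, exists N : nat, pole_order f z0 N.

Definition max_pole_order (f : C -> C) (o : nat) : Prop :=
  (forall z0 N, pole_order f z0 N -> (N <= o)%nat) /\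
  (exists z0, pole_order f z0 o).

(** The residue is the coefficient of [1 / (z - z0)] in the principal part. *)
Definition is_residue (f : C -> C) (z0 r : C) : Prop :=
  exists (N : nat) (c : nat -> C) (h : C -> C),
    holomorphic_at h z0 /\
    @locally' C_UniformSpace z0
      (fun z => f z = sum_n (fun j => c j / (z - z0) ^ (S j)) N + h z) /\
    c 0%nat = r.

(** The value of a meromorphic function that is constant. *)
Definition const_value (f : C -> C) : C :=
  @iota C_R_CompleteNormedModule (fun c => mer_eq f (fun _ => c)).

(** * Special quasi-elliptic functions *)

Definition Lambda (tau : C) (w : C) : Prop :=
  exists a b : Z, w = RtoC (IZR a) + RtoC (IZR b) * tau.

Definition period1 (f : C -> C) : Prop := mer_eq (fun x => f (x + 1)) f.

Definition Delta (tau : C) (f : C -> C) : C -> C := fun x => f (x + tau) - f x.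

Definition poles_in (A : C -> Prop) (f : C -> C) : Prop :=
  forall z0 N, pole_order f z0 N -> (0 < N)%nat -> A z0.

Definition SK (tau : C) (f : C -> C) : Prop :=
  meromorphic f /\ period1 f /\ poles_in (Lambda tau) f /\
  exists k : nat, mer_eq (Nat.iter k (Delta tau) f) (fun _ => 0).

Definition V (tau : C) (f : C -> C) : Prop :=
  SK tau f /\ exists o : nat, max_pole_order f o /\ (o <= 1)%nat.

(** * The Weierstrass zeta function *)

(** Unconditional convergence of the sum of the [u w], [w] in [A], to [s]. *)
Definition is_sum_over (A : C -> Prop) (u : C -> C) (s : C) : Prop :=
  forall eps : posreal, exists L0 : list C,
    NoDup L0 /\ List.Forall A L0 /\
    forall L : list C, NoDup L -> List.Forall A L -> incl L0 L ->
      (Cmod (fold_right Cplus (RtoC 0) (map u L) - s) < eps)%R.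

Definition sum_over (A : C -> Prop) (u : C -> C) : C :=
  @iota C_R_CompleteNormedModule (is_sum_over A u).

Definition zeta (tau : C) (x : C) : C :=
  1 / x + sum_over (fun w => Lambda tau w /\ w <> 0)
                   (fun w => 1 / (x - w) + 1 / w + x / w ^ 2).

Definition e2 (tau : C) : C :=
  const_value (fun x => zeta tau (x + 1) - zeta tau x).

Definition Zfun (tau : C) (x : C) : C := zeta tau x - e2 tau * x.

Definition DeltaZ (tau : C) : C := const_value (Delta tau (Zfun tau)).

(** * Convolution *)

(** The contour is [z = t + (i/2) Im x] with [t] in [[0,1]], so [dz = dt]. *)
Definition conv_int (f g : C -> C) (x : C) : C :=
  @RInt C_R_CompleteNormedModule
    (fun t : R => let z : C := (t, Im x / 2)%R in f (x - z) * g z) 0 1.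

Definition is_conv (tau : C) (f g h : C -> C) : Prop :=
  meromorphic h /\ period1 h /\
  forall x : C, (0 < Im x < 2 * Im tau)%R -> h x = conv_int f g x.

Definition conv (tau : C) (f g : C -> C) : C -> C :=
  epsilon (inhabits (fun _ : C => RtoC 0)) (is_conv tau f g).

(** The [n]-fold product of [f] with itself for [n >= 1]; the value [f] at
    [n = 0] is a dummy one. *)
Definition conv_pow (tau : C) (f : C -> C) (n : nat) : C -> C :=
  Nat.iter (n - 1) (fun h => conv tau h f) f.

(** * Vector spaces of functions modulo constants *)

Definition is_subspace (W : (C -> C) -> Prop) : Prop :=
  W (fun _ => 0) /\
  (forall f g, W f -> W g -> W (fun x => f x + g x)) /\
  (forall a f, W f -> W (fun x => a * f x)).

(** The class of [f] modulo additive constants, as a set of representatives. *)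
Definition cls (f : C -> C) : (C -> C) -> Prop :=
  fun g => exists c : C, mer_eq g (fun x => f x + c).

Definition cls_add (X Y : (C -> C) -> Prop) : (C -> C) -> Prop :=
  fun u => exists f g, X f /\ Y g /\ cls (fun x => f x + g x) u.

Definition cls_scal (a : C) (X : (C -> C) -> Prop) : (C -> C) -> Prop :=
  fun u => exists f, X f /\ cls (fun x => a * f x) u.

Definition mod_const (W : (C -> C) -> Prop) : ((C -> C) -> Prop) -> Prop :=
  fun X => exists f, W f /\ X = cls f.

(** Finite complex linear combinations of members of [B]. *)
Inductive span (B : ((C -> C) -> Prop) -> Prop) : ((C -> C) -> Prop) -> Prop :=
| span_zero : span B (cls (fun _ => 0))
| span_add : forall a X Y,
    B X -> span B Y -> span B (cls_add (cls_scal a X) Y).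

(** * Generalized binomial coefficients *)

Fixpoint falling (a : R) (r : nat) : R :=
  match r with
  | O => 1%R
  | S r' => (falling a r' * (a - INR r'))%R
  end.

Definition gbinom (a : R) (r : nat) : R := (falling a r / INR (fact r))%R.

(* Main.v *)
Require Import Defs.
From Stdlib Require Import Reals Lra Lia ZArith List FinFun.
From Stdlib Require Import ClassicalEpsilon FunctionalExtensionality PropExtensionality.
From Coquelicot Require Import Coquelicot.

(** The convolution powers of [Z] are replaced by explicit functions.  Write
    [e2pi x] for exp(2 pi i x), and q = [e2pi tau], w = [e2pi x].  In the strip
    0 < Im x < Im tau the function [Z] is the sum of its Fourier series, whose
    coefficients are c_0 = - pi i and c_k = - 2 pi i / (1 - q^k); integrating
    over a period multiplies Fourier coefficients, so the n-th convolution
    power has the coefficients c_k^n and its series converges for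
    0 < Im x < n Im tau.

    The positive frequencies form a power series in w ([qseries]), which
    satisfies P_(n+1)(w) - P_(n+1)(q w) = P_n(w) because 1 - q^k cancels one
    factor of the denominator.  This equation continues it to a meromorphic
    function of x with at most simple poles, all in the lattice ([qcont]).  The
    negative frequencies are the same function at n tau - x.  Together they
    form [Zconv n], and the functional equation becomes
    Delta (Zconv (n+1)) = 2 pi i (Zconv n - constant) ([Zconv_Delta]).  So every
    [Zconv n] lies in [V], and the residues at m tau obey Pascal's rule in m
    and n ([simple_pole_Zconv_at]); at 0 the residue is read off from
    w / (1 - w).

    That [Z] itself is [Zconv 1] follows from Liouville's theorem: zeta has
    constant increments along both periods, because the increments of its sums
    over large squares telescope to boundary terms ([zeta_shift_const]); hence
    zeta - Zconv 1 is an entire function with constant increments, which is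
    affine ([entire_quasi_periodic_affine]).  Its constant term is 0 by oddness
    and its slope is e_2.  That the next convolution is [Zconv (n+1)] is the
    Fourier computation [conv_int_Zconv] together with the identity theorem for
    meromorphic functions ([merom_at_identity]), which makes the continuation
    of the integral unique.

    The span is found by induction on the k with Delta^k f = 0.  By induction
    Delta f is a combination of the [Zconv n] and a constant; by the functional
    equation it has, up to a constant, an antidifference in the span, and
    subtracting that leaves a g with Delta g constant.  Such a g has the same
    residue r at all lattice points, so g - r Z is entire with constant
    increments and of period 1, hence constant ([Vsimple_Delta_const]).

    The complex analysis rests on Cauchy's formula for functions that are
    merely differentiable ([cauchy_formula]).  Its main consequence is that a
    holomorphic function can be divided by z - a after subtracting its value at
    a ([divide]); this gives removable singularities, isolated zeros and
    Liouville's theorem without power series.  A pointwise limit of uniformly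
    bounded holomorphic functions is holomorphic ([limit_holomorphic]), which
    makes the power series in w and the lattice sum of zeta holomorphic. *)

Open Scope C_scope.
Local Notation Delta := Defs.Delta.

(** * Limits of complex functions along a filter *)

Definition tends {T : Type} (F : (T -> Prop) -> Prop) (f : T -> C) (l : C) : Prop :=
  forall eps : R, (0 < eps)%R -> F (fun t => (Cmod (f t - l) < eps)%R).

Lemma Cmod_minus_sym (x y : C) : Cmod (x - y) = Cmod (y - x).
Proof. rewrite <- Cmod_opp. f_equal. ring. Qed.

Lemma Cmod_pos (x : C) : x <> 0 -> (0 < Cmod x)%R.
Proof. apply Cmod_gt_0. Qed.

Lemma Cmod_small_eq0 (x : C) :
  (forall eps : R, (0 < eps)%R -> (Cmod x < eps)%R) -> x = 0.
Proof.
  intros H. destruct (Req_dec (Cmod x) 0) as [E | E].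
  - now apply Cmod_eq_0.
  - pose proof (Cmod_ge_0 x). assert (Hx : (0 < Cmod x)%R) by lra. specialize (H _ Hx). lra.
Qed.

Lemma Cmod_le_triangle (x y z : C) : (Cmod (x - z) <= Cmod (x - y) + Cmod (y - z))%R.
Proof. replace (x - z) with ((x - y) + (y - z)) by ring. apply Cmod_triangle. Qed.

Lemma Cmod_rev_triangle (x y : C) : (Cmod x - Cmod y <= Cmod (x - y))%R.
Proof.
  pose proof (Cmod_triangle (x - y) y) as H.
  replace (x - y + y) with x in H by ring. lra.
Qed.

Section Limits.
Context {T : Type} (F : (T -> Prop) -> Prop) {FF : Filter F}.

Lemma tends_ext_loc (f g : T -> C) l : F (fun t => f t = g t) -> tends F f l -> tends F g l.
Proof.
  intros E H eps He. generalize (filter_and _ _ E (H eps He)).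
  apply filter_imp. intros t [-> Ht]; exact Ht.
Qed.

Lemma tends_ext (f g : T -> C) l : (forall t, f t = g t) -> tends F f l -> tends F g l.
Proof. intros E. apply tends_ext_loc. now apply filter_forall. Qed.

Lemma tends_const (c : C) : tends F (fun _ => c) c.
Proof.
  intros eps He. apply filter_forall. intros _.
  replace (c - c) with (RtoC 0) by ring. now rewrite Cmod_0.
Qed.

Lemma tends_plus (f g : T -> C) l m :
  tends F f l -> tends F g m -> tends F (fun t => f t + g t) (l + m).
Proof.
  intros Hf Hg eps He.
  assert (He2 : (0 < eps / 2)%R) by lra.
  generalize (filter_and _ _ (Hf _ He2) (Hg _ He2)).
  apply filter_imp. intros t [H1 H2].
  replace (f t + g t - (l + m)) with ((f t - l) + (g t - m)) by ring.
  eapply Rle_lt_trans; [apply Cmod_triangle | lra].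
Qed.

Lemma tends_mult (f g : T -> C) l m :
  tends F f l -> tends F g m -> tends F (fun t => f t * g t) (l * m).
Proof.
  intros Hf Hg eps He.
  pose proof (Cmod_ge_0 l) as Hl. pose proof (Cmod_ge_0 m) as Hm.
  set (K := (Cmod l + Cmod m + 1)%R).
  assert (HK : (0 < K)%R) by (unfold K; lra).
  set (d := Rmin 1 (eps / (2 * K))%R).
  assert (Hd : (0 < d)%R).
  { unfold d. apply Rmin_glb_lt; [lra |]. apply Rdiv_lt_0_compat; lra. }
  assert (Hd1 : (d <= 1)%R) by apply Rmin_l.
  assert (Hd2 : (d * K <= eps / 2)%R).
  { apply Rle_trans with (eps / (2 * K) * K)%R.
    - apply Rmult_le_compat_r; [lra | apply Rmin_r].
    - right. field. lra. }
  generalize (filter_and _ _ (Hf d Hd) (Hg d Hd)).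
  apply filter_imp. intros t [H1 H2].
  replace (f t * g t - l * m)
    with ((f t - l) * (g t - m) + ((f t - l) * m + l * (g t - m))) by ring.
  eapply Rle_lt_trans; [apply Cmod_triangle |].
  eapply Rle_lt_trans; [apply Rplus_le_compat_l, Cmod_triangle |].
  rewrite !Cmod_mult.
  pose proof (Cmod_ge_0 (f t - l)). pose proof (Cmod_ge_0 (g t - m)).
  assert (Cmod (f t - l) * Cmod (g t - m) <= d * 1)%R by (apply Rmult_le_compat; lra).
  assert (Cmod (f t - l) * Cmod m <= d * Cmod m)%R by (apply Rmult_le_compat; lra).
  assert (Cmod l * Cmod (g t - m) <= Cmod l * d)%R by (apply Rmult_le_compat; lra).
  apply Rle_lt_trans with (d * K)%R; [unfold K; lra | lra].
Qed.

Lemma tends_scal (c : C) (f : T -> C) l : tends F f l -> tends F (fun t => c * f t) (c * l).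
Proof. apply tends_mult, tends_const. Qed.

Lemma tends_opp (f : T -> C) l : tends F f l -> tends F (fun t => - f t) (- l).
Proof.
  intros H. apply (tends_scal (- (1))) in H.
  replace (- l) with (- (1) * l) by ring.
  revert H. apply tends_ext. intros t; ring.
Qed.

Lemma tends_minus (f g : T -> C) l m :
  tends F f l -> tends F g m -> tends F (fun t => f t - g t) (l - m).
Proof. intros Hf Hg. apply tends_plus; [exact Hf | now apply tends_opp]. Qed.

Lemma tends_away_from_0 (f : T -> C) (l : C) :
  l <> 0 -> tends F f l -> F (fun t => (Cmod l / 2 < Cmod (f t))%R).
Proof.
  intros Hl H. apply Cmod_pos in Hl.
  assert (Hl2 : (0 < Cmod l / 2)%R) by lra.
  generalize (H _ Hl2). apply filter_imp. intros t Ht.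
  pose proof (Cmod_rev_triangle l (f t)). rewrite Cmod_minus_sym in Ht. lra.
Qed.

Lemma tends_inv (f : T -> C) (l : C) : l <> 0 -> tends F f l -> tends F (fun t => / f t) (/ l).
Proof.
  intros Hl H eps He. pose proof Hl as Hl'. apply Cmod_pos in Hl'.
  set (K := Cmod l) in *.
  assert (HK : (0 < eps * (K * K / 2))%R) by (apply Rmult_lt_0_compat; nra).
  generalize (filter_and _ _ (tends_away_from_0 f l Hl H) (H _ HK)).
  apply filter_imp. intros t [H1 H2]. fold K in H1.
  assert (Hft : f t <> 0). { apply Cmod_gt_0. lra. }
  replace (/ f t - / l) with ((l - f t) / (f t * l)) by (field; split; assumption).
  rewrite Cmod_div, Cmod_mult by (apply Cmult_neq_0; assumption).
  fold K. rewrite Cmod_minus_sym.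
  apply Rmult_lt_reg_r with (Cmod (f t) * K)%R; [nra |].
  unfold Rdiv. rewrite Rmult_assoc, Rinv_l, Rmult_1_r by nra.
  eapply Rlt_le_trans; [exact H2 |].
  apply Rmult_le_compat_l; [lra |]. nra.
Qed.

Lemma tends_bound (f : T -> C) l (M : R) {PF : ProperFilter' F} :
  F (fun t => (Cmod (f t) <= M)%R) -> tends F f l -> (Cmod l <= M)%R.
Proof.
  intros HM H. apply Rnot_lt_le. intros Hlt.
  apply (filter_not_empty (F := F)).
  assert (HlM : (0 < Cmod l - M)%R) by lra.
  generalize (filter_and _ _ HM (H _ HlM)).
  apply filter_imp. intros t [H1 H2].
  pose proof (Cmod_rev_triangle l (f t)). rewrite Cmod_minus_sym in H2. lra.
Qed.

Lemma tends_unique (f : T -> C) l m {PF : ProperFilter' F} : tends F f l -> tends F f m -> l = m.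
Proof.
  intros Hl Hm.
  assert (E : l - m = 0).
  { apply Cmod_small_eq0. intros eps He.
    assert (H : (Cmod (l - m) <= eps / 2)%R).
    { apply (tends_bound (fun t => f t - f t) (l - m) (eps / 2)); [| now apply tends_minus].
      apply filter_forall. intros t. replace (f t - f t) with (RtoC 0) by ring.
      rewrite Cmod_0. lra. }
    lra. }
  replace l with ((l - m) + m) by ring. rewrite E. ring.
Qed.

End Limits.

(** * Neighbourhoods, continuity and complex derivatives *)

(** Typed over [C] itself, so that filter instances are found by unification
    on [C]. *)
Definition nbhd (z : C) : (C -> Prop) -> Prop := @locally C_UniformSpace z.
Definition nbhd' (z : C) : (C -> Prop) -> Prop := @locally' C_UniformSpace z.

Global Instance nbhd_filter (z : C) : @Filter C (nbhd z).
Proof. apply locally_filter. Qed.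

Lemma nbhd_Cmod (z : C) (P : C -> Prop) :
  nbhd z P <-> exists d : R, (0 < d)%R /\ forall w, (Cmod (w - z) < d)%R -> P w.
Proof.
  split.
  - intros [d Hd]. exists d. split; [apply cond_pos |]. intros w Hw. apply Hd.
    apply C_NormedModule_mixin_compat1. exact Hw.
  - intros [d [Hd H]].
    assert (Hs : (0 < sqrt 2)%R) by (apply sqrt_lt_R0; lra).
    exists (mkposreal (d / sqrt 2) (Rdiv_lt_0_compat _ _ Hd Hs)).
    intros w Hw. apply H.
    apply C_NormedModule_mixin_compat2 in Hw. simpl in Hw.
    replace (sqrt 2 * (d / sqrt 2))%R with d in Hw by (field; lra). exact Hw.
Qed.

Lemma nbhd'_Cmod (z : C) (P : C -> Prop) :
  nbhd' z P <-> exists d : R, (0 < d)%R /\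
    forall w, (Cmod (w - z) < d)%R -> w <> z -> P w.
Proof. apply nbhd_Cmod. Qed.

Lemma nbhd_here (z : C) (P : C -> Prop) : nbhd z P -> P z.
Proof. apply locally_singleton. Qed.

Lemma nbhd_nbhd' (z : C) (P : C -> Prop) : nbhd z P -> nbhd' z P.
Proof. unfold nbhd', locally', within. apply filter_imp. auto. Qed.

Lemma nbhd_nbhd (z : C) (P : C -> Prop) : nbhd z P -> nbhd z (fun w => nbhd w P).
Proof. apply locally_locally. Qed.

(** A punctured disk is open. *)
Lemma nbhd'_nbhd (z : C) (P : C -> Prop) : nbhd' z P -> nbhd' z (fun w => nbhd w P).
Proof.
  intros H. apply nbhd'_Cmod in H. destruct H as [d [Hd H]].
  apply nbhd'_Cmod. exists d. split; [exact Hd |]. intros w Hw Hne.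
  apply nbhd_Cmod.
  assert (0 < Cmod (w - z))%R.
  { apply Cmod_gt_0. intros E. apply Hne. replace w with (w - z + z) by ring.
    rewrite E. ring. }
  exists (Rmin (Cmod (w - z)) (d - Cmod (w - z)))%R. split.
  - apply Rmin_glb_lt; lra.
  - intros v Hv. pose proof (Rmin_l (Cmod (w - z)) (d - Cmod (w - z)))%R.
    pose proof (Rmin_r (Cmod (w - z)) (d - Cmod (w - z)))%R.
    apply H.
    + pose proof (Cmod_le_triangle v w z). lra.
    + intros ->. rewrite Cmod_minus_sym in Hv. lra.
Qed.

Global Instance nbhd'_proper (z : C) : @ProperFilter' C (nbhd' z).
Proof.
  constructor; [| apply within_filter, locally_filter].
  intros H. apply nbhd'_Cmod in H. destruct H as [d [Hd H]].
  apply (H (z + RtoC (d / 2))).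
  - replace (z + RtoC (d / 2) - z) with (RtoC (d / 2)) by ring.
    rewrite Cmod_R, Rabs_pos_eq; lra.
  - intros E. assert (E' : RtoC (d / 2) = 0).
    { replace (RtoC (d / 2)) with (z + RtoC (d / 2) - z) by ring. rewrite E. ring. }
    apply RtoC_inj in E'. lra.
Qed.

Global Instance nbhd'_filter (z : C) : @Filter C (nbhd' z).
Proof. apply within_filter, locally_filter. Qed.

Lemma nbhd'_shift (z s : C) (P : C -> Prop) :
  nbhd' (z + s) P -> nbhd' z (fun x => P (x + s)).
Proof.
  intros H. apply nbhd'_Cmod in H. destruct H as [d [Hd H]]. apply nbhd'_Cmod.
  exists d. split; [exact Hd |]. intros w Hw Hne. apply H.
  - replace (w + s - (z + s)) with (w - z) by ring. exact Hw.
  - intros E. apply Hne. replace w with (w + s - s) by ring. rewrite E. ring.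
Qed.

Lemma nbhd'_reflect (z s : C) (P : C -> Prop) :
  nbhd' (s - z) P -> nbhd' z (fun x => P (s - x)).
Proof.
  intros H. apply nbhd'_Cmod in H. destruct H as [d [Hd H]]. apply nbhd'_Cmod.
  exists d. split; [exact Hd |]. intros w Hw Hne. apply H.
  - replace (s - w - (s - z)) with (- (w - z)) by ring. now rewrite Cmod_opp.
  - intros E. apply Hne. replace w with (s - (s - w)) by ring. rewrite E. ring.
Qed.

Definition cont_at (f : C -> C) (z : C) : Prop := tends (nbhd z) f (f z).

Lemma tends_nbhd_id (z : C) : tends (nbhd z) (fun w => w) z.
Proof. intros eps He. apply nbhd_Cmod. exists eps. auto. Qed.

Lemma tends_comp {T} (F : (T -> Prop) -> Prop) {FF : Filter F} (f : T -> C) (g : C -> C) l m :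
  tends F f l -> tends (nbhd l) g m -> tends F (fun t => g (f t)) m.
Proof.
  intros Hf Hg eps He. specialize (Hg eps He). apply nbhd_Cmod in Hg.
  destruct Hg as [d [Hd H]]. generalize (Hf d Hd). apply filter_imp.
  intros t Ht. now apply H.
Qed.

(** Caratheodory's form of the derivative: the rules of differentiation
    become rules for continuous functions, without error terms. *)
Definition has_deriv (f : C -> C) (z l : C) : Prop :=
  exists phi : C -> C, (forall w, f w - f z = phi w * (w - z)) /\ cont_at phi z /\ phi z = l.

Definition diff_at (f : C -> C) (z : C) : Prop := exists l, has_deriv f z l.

Lemma tends_eq {T} (F : (T -> Prop) -> Prop) (f : T -> C) (l m : C) :
  tends F f l -> l = m -> tends F f m.
Proof. now intros H <-. Qed.

Ltac tends_tac := repeat first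
  [ eassumption | apply tends_const | apply tends_nbhd_id
  | apply tends_plus | apply tends_minus | apply tends_mult | apply tends_opp
  | match goal with |- Filter _ => typeclasses eauto end ].

Lemma deriv_eps (f : C -> C) (z l : C) :
  (forall eps : R, (0 < eps)%R ->
     nbhd z (fun w => (Cmod (f w - f z - l * (w - z)) <= eps * Cmod (w - z))%R)) <->
  has_deriv f z l.
Proof.
  split.
  - intros H.
    exists (fun w => if Ceq_dec w z then l else (f w - f z) / (w - z)).
    split; [| split].
    + intros w. destruct (Ceq_dec w z) as [-> | Hne]; [ring |].
      field. intros E. apply Hne. replace w with (w - z + z) by ring. rewrite E. ring.
    + intros eps He. assert (He2 : (0 < eps / 2)%R) by lra.
      generalize (H _ He2). apply filter_imp.
      intros w Hw. destruct (Ceq_dec z z) as [_ | ?]; [| congruence].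
      destruct (Ceq_dec w z) as [-> | Hne].
      * replace (l - l) with (RtoC 0) by ring. now rewrite Cmod_0.
      * assert (Hwz : w - z <> 0).
        { intros E. apply Hne. replace w with (w - z + z) by ring. rewrite E. ring. }
        replace ((f w - f z) / (w - z) - l) with ((f w - f z - l * (w - z)) / (w - z))
          by (field; assumption).
        rewrite Cmod_div by assumption. apply Cmod_pos in Hwz.
        apply Rle_lt_trans with (eps / 2)%R; [| lra].
        apply Rmult_le_reg_r with (Cmod (w - z)); [assumption |].
        unfold Rdiv at 1. rewrite Rmult_assoc, Rinv_l, Rmult_1_r by lra. exact Hw.
    + destruct (Ceq_dec z z); congruence.
  - intros [phi [H1 [H2 <-]]] eps He. generalize (H2 eps He). apply filter_imp.
    intros w Hw. rewrite H1.
    replace (phi w * (w - z) - phi z * (w - z)) with ((phi w - phi z) * (w - z)) by ring.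
    rewrite Cmod_mult. apply Rmult_le_compat_r; [apply Cmod_ge_0 | lra].
Qed.

Lemma deriv_is_derive (f : C -> C) (z l : C) :
  has_deriv f z l <-> @is_derive C_AbsRing C_NormedModule f z l.
Proof.
  rewrite <- deriv_eps. unfold is_derive, filterdiff. split.
  - intros H. split; [apply is_linear_scal_l |].
    intros x Hx.
    assert (x = z) as ->.
    { symmetry. apply (is_filter_lim_locally_unique (V := AbsRing_NormedModule C_AbsRing)).
      exact Hx. }
    intros [eps He]. apply locally_C.
    generalize (H eps He). apply filter_imp. intros w Hw.
    rewrite Cmult_comm in Hw. exact Hw.
  - intros [_ H] eps He.
    specialize (H z (fun P HP => HP) (mkposreal eps He)). apply locally_C in H.
    revert H. apply filter_imp. intros w Hw. simpl in Hw. rewrite Cmult_comm. exact Hw.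
Qed.

Lemma hol_diff (h : C -> C) (z : C) : holomorphic_at h z <-> nbhd z (diff_at h).
Proof.
  unfold holomorphic_at, nbhd. split; apply filter_imp; intros w [l Hl]; exists l;
    now apply deriv_is_derive.
Qed.

Lemma deriv_cont f z l : has_deriv f z l -> cont_at f z.
Proof.
  intros [phi [H1 [H2 <-]]]. unfold cont_at.
  apply (tends_ext (nbhd z) (fun w => f z + phi w * (w - z)));
    [intros w; rewrite <- H1; ring |].
  eapply tends_eq; [tends_tac; exact H2 | ring].
Qed.

Lemma diff_cont f z : diff_at f z -> cont_at f z.
Proof. intros [l H]. now apply deriv_cont with l. Qed.

Lemma deriv_const c z : has_deriv (fun _ => c) z 0.
Proof.
  exists (fun _ => 0). split; [intros w; ring | split; [unfold cont_at; tends_tac | reflexivity]].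
Qed.

Lemma deriv_id z : has_deriv (fun w => w) z 1.
Proof.
  exists (fun _ => 1). split; [intros w; ring | split; [unfold cont_at; tends_tac | reflexivity]].
Qed.

Lemma deriv_plus f g z l m : has_deriv f z l -> has_deriv g z m -> has_deriv (fun w => f w + g w) z (l + m).
Proof.
  intros [p [Hp [Cp <-]]] [r [Hr [Cr <-]]]. exists (fun w => p w + r w).
  split; [| split; [unfold cont_at in *; tends_tac | reflexivity]].
  intros w. rewrite Cmult_plus_distr_r, <- Hp, <- Hr. ring.
Qed.

Lemma deriv_mult f g z l m : has_deriv f z l -> has_deriv g z m ->
  has_deriv (fun w => f w * g w) z (l * g z + f z * m).
Proof.
  intros Hf Hg. pose proof (deriv_cont f z l Hf) as Cf.
  destruct Hf as [p [Hp [Cp <-]]]. destruct Hg as [r [Hr [Cr <-]]].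
  exists (fun w => p w * g z + f w * r w).
  split; [| split; [unfold cont_at in *; tends_tac | reflexivity]].
  intros w. transitivity ((f w - f z) * g z + f w * (g w - g z)); [ring |].
  rewrite Hp, Hr. ring.
Qed.

Lemma deriv_comp f g z l m : has_deriv f z l -> has_deriv g (f z) m -> has_deriv (fun w => g (f w)) z (m * l).
Proof.
  intros Hf Hg. pose proof (deriv_cont f z l Hf) as Cf.
  destruct Hf as [p [Hp [Cp <-]]]. destruct Hg as [r [Hr [Cr <-]]].
  exists (fun w => r (f w) * p w). split; [| split; [| reflexivity]].
  - intros w. rewrite Hr, Hp. ring.
  - unfold cont_at in *. tends_tac. apply (tends_comp (nbhd z) f r (f z)); assumption.
Qed.

Lemma deriv_inv (z : C) : z <> 0 -> has_deriv (fun w => / w) z (- / (z * z)).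
Proof.
  intros Hz. apply deriv_eps. intros eps He.
  assert (Hlim : tends (nbhd z) (fun w => / (z * z) * (/ w * (w - z))) 0).
  { eapply tends_eq; [tends_tac |].
    - apply (tends_inv (nbhd z) (fun w => w) z Hz). apply tends_nbhd_id.
    - ring. }
  assert (Hnz : nbhd z (fun w => w <> 0)).
  { generalize (tends_away_from_0 (nbhd z) (fun w => w) z Hz (tends_nbhd_id z)).
    apply filter_imp. intros w Hw. apply Cmod_gt_0. pose proof (Cmod_ge_0 z). lra. }
  generalize (filter_and _ _ (Hlim eps He) Hnz). apply filter_imp.
  intros w [Hw Hw0].
  replace (/ w - / z - - / (z * z) * (w - z))
    with ((/ (z * z) * (/ w * (w - z)) - 0) * (w - z)) by (field; split; assumption).
  rewrite Cmod_mult. apply Rmult_le_compat_r; [apply Cmod_ge_0 | lra].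
Qed.

Lemma diff_const c z : diff_at (fun _ => c) z.
Proof. exists 0. apply deriv_const. Qed.
Lemma diff_id z : diff_at (fun w => w) z.
Proof. exists 1. apply deriv_id. Qed.
Lemma diff_plus f g z : diff_at f z -> diff_at g z -> diff_at (fun w => f w + g w) z.
Proof. intros [l Hl] [m Hm]. eexists. apply deriv_plus; eassumption. Qed.
Lemma diff_mult f g z : diff_at f z -> diff_at g z -> diff_at (fun w => f w * g w) z.
Proof. intros [l Hl] [m Hm]. eexists. apply deriv_mult; eassumption. Qed.
Lemma diff_comp f g z : diff_at f z -> diff_at g (f z) -> diff_at (fun w => g (f w)) z.
Proof. intros [l Hl] [m Hm]. eexists. apply (deriv_comp f g z l m); assumption. Qed.
Lemma diff_ext f g z : (forall w, f w = g w) -> diff_at f z -> diff_at g z.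
Proof.
  intros E [l [p [Hp [Cp H]]]]. exists l, p. split; [| now split].
  intros w. rewrite <- !E. apply Hp.
Qed.
Lemma diff_opp f z : diff_at f z -> diff_at (fun w => - f w) z.
Proof.
  intros H. apply (diff_ext (fun w => - (1) * f w)); [intros w; ring |].
  apply diff_mult; [apply diff_const | exact H].
Qed.
Lemma diff_minus f g z : diff_at f z -> diff_at g z -> diff_at (fun w => f w - g w) z.
Proof. intros Hf Hg. apply diff_plus; [exact Hf | now apply diff_opp]. Qed.
Lemma diff_inv f z : diff_at f z -> f z <> 0 -> diff_at (fun w => / f w) z.
Proof.
  intros Hf Hz. apply (diff_comp f (fun w => / w)); [exact Hf |].
  eexists. now apply deriv_inv.
Qed.
Lemma diff_pow f n z : diff_at f z -> diff_at (fun w => f w ^ n) z.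
Proof.
  intros Hf. induction n as [| n IH]; simpl; [apply diff_const | now apply diff_mult].
Qed.

Lemma deriv_ext_loc f g z l : nbhd z (fun w => f w = g w) -> has_deriv f z l -> has_deriv g z l.
Proof.
  intros E H. apply deriv_eps. intros eps He. apply deriv_eps with (eps := eps) in H; [| exact He].
  pose proof (nbhd_here _ _ E) as Ez. simpl in Ez.
  generalize (filter_and _ _ E H). apply filter_imp. intros w [Hw H']. simpl in Hw.
  now rewrite <- Hw, <- Ez.
Qed.

Lemma diff_ext_loc f g z : nbhd z (fun w => f w = g w) -> diff_at f z -> diff_at g z.
Proof. intros E [l H]. exists l. now apply deriv_ext_loc with f. Qed.

Ltac diff_tac := repeat first
  [ assumption | apply diff_const | apply diff_id | apply diff_plus | apply diff_minus
  | apply diff_mult | apply diff_opp | apply diff_pow ].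

(** * Bisection of rectangles *)

Section Bisection.
Local Open Scope R_scope.
Variable m : R -> R -> R -> R -> R.

(** Chooses a quarter that carries at least a fourth of [m]; the last branch
    needs no test, because under subadditivity not all four quarters can
    fail. *)
Definition quarter (Q : (R * R) * (R * R)) : (R * R) * (R * R) :=
  let '((a, b), (u, v)) := Q in
  let p := ((a + b) / 2) in let w := ((u + v) / 2) in
  if Rle_dec (m a b u v / 4) (m a p u w) then ((a, p), (u, w))
  else if Rle_dec (m a b u v / 4) (m p b u w) then ((p, b), (u, w))
  else if Rle_dec (m a b u v / 4) (m a p w v) then ((a, p), (w, v))
  else ((p, b), (w, v)).

Lemma nested_point (x y : nat -> R) :
  (forall n, x n <= x (S n)) -> (forall n, y (S n) <= y n) -> (forall n, x n <= y n) ->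
  exists s, forall n, x n <= s <= y n.
Proof.
  intros Hx Hy Hxy.
  assert (Xm : forall n k, x n <= x (n + k)%nat).
  { intros n k. induction k as [| k IH]; [rewrite Nat.add_0_r; lra |].
    rewrite Nat.add_succ_r. eapply Rle_trans; [exact IH | apply Hx]. }
  assert (Ym : forall n k, y (n + k)%nat <= y n).
  { intros n k. induction k as [| k IH]; [rewrite Nat.add_0_r; lra |].
    rewrite Nat.add_succ_r. eapply Rle_trans; [apply Hy | exact IH]. }
  assert (XY : forall i j, x i <= y j).
  { intros i j. apply Rle_trans with (x (i + j)%nat); [apply Xm |].
    apply Rle_trans with (y (i + j)%nat); [apply Hxy |].
    rewrite Nat.add_comm. apply Ym. }
  destruct (completeness (fun z => exists n, z = x n)) as [s [Hs1 Hs2]].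
  - exists (y 0%nat). intros z [n ->]. apply XY.
  - exists (x 0%nat). now exists 0%nat.
  - exists s. intros n. split.
    + apply Hs1. now exists n.
    + apply Hs2. intros z [k ->]. apply XY.
Qed.

(** Goursat's argument for an abstract function of rectangles, subadditive
    under quartering and o(size^2) near each point. If it were positive,
    quarters carrying at least a fourth of the value would shrink to a point,
    and there the value 4^(-n) [m a b u v] would violate the local bound. *)
Lemma bisection (a b u v : R) :
  a <= b -> u <= v ->
  (forall a' b' u' v', a <= a' -> a' <= b' -> b' <= b -> u <= u' -> u' <= v' -> v' <= v ->
     m a' b' u' v' <= m a' ((a' + b') / 2) u' ((u' + v') / 2)
                    + m ((a' + b') / 2) b' u' ((u' + v') / 2)
                    + m a' ((a' + b') / 2) ((u' + v') / 2) v'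
                    + m ((a' + b') / 2) b' ((u' + v') / 2) v') ->
  (forall s t eps, a <= s <= b -> u <= t <= v -> 0 < eps ->
     exists d, 0 < d /\ forall a' b' u' v',
       a <= a' -> b' <= b -> u <= u' -> v' <= v -> a' <= s <= b' -> u' <= t <= v' ->
       b' - a' < d -> v' - u' < d ->
       m a' b' u' v' <= eps * (((b' - a') + (v' - u')) * ((b' - a') + (v' - u')))) ->
  m a b u v <= 0.
Proof.
  intros Hab Huv Hsub Hloc. apply Rnot_lt_le. intros HM.
  set (Q := fun n => Nat.iter n quarter ((a, b), (u, v))).
  set (A := fun n => fst (fst (Q n))). set (B := fun n => snd (fst (Q n))).
  set (U := fun n => fst (snd (Q n))). set (V := fun n => snd (snd (Q n))).
  assert (Inv : forall n,
    (a <= A n /\ A n <= B n /\ B n <= b) /\ (u <= U n /\ U n <= V n /\ V n <= v) /\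
    (B n - A n = (b - a) / 2 ^ n /\ V n - U n = (v - u) / 2 ^ n) /\
    m a b u v / 4 ^ n <= m (A n) (B n) (U n) (V n) /\
    (A n <= A (S n) /\ B (S n) <= B n) /\ (U n <= U (S n) /\ V (S n) <= V n)).
  { assert (P1 : forall n,
      (a <= A n /\ A n <= B n /\ B n <= b) /\ (u <= U n /\ U n <= V n /\ V n <= v) /\
      (B n - A n = (b - a) / 2 ^ n /\ V n - U n = (v - u) / 2 ^ n) /\
      m a b u v / 4 ^ n <= m (A n) (B n) (U n) (V n)).
    { induction n as [| n IH].
      - unfold A, B, U, V, Q. simpl. repeat split; lra.
      - destruct IH as [[I1 [I2 I3]] [[J1 [J2 J3]] [[K1 K2] L]]].
        assert (HQ : Q (S n) = quarter (Q n)) by reflexivity.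
        unfold A, B, U, V in *. rewrite HQ.
        destruct (Q n) as [[a' b'] [u' v']]. simpl in I1, I2, I3, J1, J2, J3, K1, K2, L.
        specialize (Hsub a' b' u' v' I1 I2 I3 J1 J2 J3).
        assert (P2 : 0 < 2 ^ n) by (apply pow_lt; lra).
        assert (P4 : 0 < 4 ^ n) by (apply pow_lt; lra).
        assert (E4 : m a b u v / 4 ^ S n = m a b u v / 4 ^ n / 4) by (simpl; field; lra).
        assert (E2 : forall x : R, x / 2 ^ S n = x / 2 ^ n / 2) by (intros; simpl; field; lra).
        rewrite E4, !E2, <- K1, <- K2. unfold quarter.
        repeat destruct Rle_dec; simpl; repeat split; lra. }
    intros n. destruct (P1 n) as [H1 [H2 [H3 H4]]].
    do 4 (split; [assumption |]). clear H3 H4.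
    assert (HQ : Q (S n) = quarter (Q n)) by reflexivity.
    unfold A, B, U, V in *. rewrite HQ.
    destruct (Q n) as [[a' b'] [u' v']]. simpl in H1, H2. unfold quarter.
    repeat destruct Rle_dec; simpl; repeat split; lra. }
  destruct (nested_point A B) as [s Hs]; try (intros n; apply Inv).
  destruct (nested_point U V) as [t Ht]; try (intros n; apply Inv).
  set (L := (b - a) + (v - u)).
  assert (HL : 0 <= L) by (unfold L; lra).
  set (eps := m a b u v / (2 * (L * L + 1))).
  assert (He : 0 < eps) by (apply Rdiv_lt_0_compat; nra).
  destruct (Hloc s t eps) as [d [Hd H]]; [| | exact He |].
  { pose proof (Hs 0%nat). unfold A, B, Q in *. simpl in *. lra. }
  { pose proof (Ht 0%nat). unfold U, V, Q in *. simpl in *. lra. }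
  assert (Hn : exists n, (L + 1) / 2 ^ n < d).
  { destruct (pow_lt_1_zero (1/2) ltac:(rewrite Rabs_pos_eq; lra) (d / (L + 1))
      ltac:(apply Rdiv_lt_0_compat; lra)) as [n Hn].
    exists n. specialize (Hn n (le_n _)).
    assert (P2 : 0 < 2 ^ n) by (apply pow_lt; lra).
    rewrite Rabs_pos_eq in Hn by (apply pow_le; lra).
    replace ((1 / 2) ^ n) with (/ 2 ^ n) in Hn.
    - apply Rmult_lt_compat_l with (r := L + 1) in Hn; [| lra].
      unfold Rdiv in *. replace ((L + 1) * (d * / (L + 1))) with d in Hn by (field; lra).
      exact Hn.
    - unfold Rdiv. rewrite Rmult_1_l, pow_inv. reflexivity. }
  destruct Hn as [n Hn].
  destruct (Inv n) as [[I1 [I2 I3]] [[J1 [J2 J3]] [[K1 K2] [L1 _]]]].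
  assert (P2 : 0 < 2 ^ n) by (apply pow_lt; lra).
  assert (Hdist : (b - a) / 2 ^ n + (v - u) / 2 ^ n <= (L + 1) / 2 ^ n).
  { unfold Rdiv. rewrite <- Rmult_plus_distr_r. apply Rmult_le_compat_r.
    - left. now apply Rinv_0_lt_compat.
    - unfold L. lra. }
  assert (0 <= (b - a) / 2 ^ n) by (apply Rdiv_le_0_compat; lra).
  assert (0 <= (v - u) / 2 ^ n) by (apply Rdiv_le_0_compat; lra).
  specialize (H (A n) (B n) (U n) (V n) I1 I3 J1 J3 (Hs n) (Ht n) ltac:(lra) ltac:(lra)).
  rewrite K1, K2 in H.
  replace ((b - a) / 2 ^ n + (v - u) / 2 ^ n) with (L / 2 ^ n) in H by (unfold L; field; lra).
  assert (P4 : 4 ^ n = 2 ^ n * 2 ^ n) by (rewrite <- Rpow_mult_distr; f_equal; lra).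
  assert (F : m a b u v / 4 ^ n <= eps * (L / 2 ^ n * (L / 2 ^ n))) by lra.
  rewrite P4 in F.
  replace (eps * (L / 2 ^ n * (L / 2 ^ n))) with (eps * (L * L) / (2 ^ n * 2 ^ n)) in F
    by (field; lra).
  apply Rmult_le_compat_r with (r := 2 ^ n * 2 ^ n) in F; [| nra].
  unfold Rdiv in F. rewrite !Rmult_assoc, Rinv_l, !Rmult_1_r in F by nra.
  assert (eps * (L * L) <= m a b u v / 2).
  { unfold eps. apply Rmult_le_reg_r with (2 * (L * L + 1)); [nra |].
    replace (m a b u v / (2 * (L * L + 1)) * (L * L) * (2 * (L * L + 1)))
      with (m a b u v * (L * L)) by (field; nra). nra. }
  lra.
Qed.
End Bisection.

(** * Integrals of complex functions of a real variable *)

Definition nbR (t : R) : (R -> Prop) -> Prop := @locally R_UniformSpace t.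

Global Instance nbR_filter (t : R) : Filter (nbR t).
Proof. apply locally_filter. Qed.

Global Instance nbR_proper (t : R) : ProperFilter' (nbR t).
Proof. apply (Proper_StrongProper _ (locally_filter (T := R_UniformSpace) t)). Qed.

Definition rcont_at (f : R -> C) (t : R) : Prop := tends (nbR t) f (f t).

Definition CInt (f : R -> C) (a b : R) : C := @RInt C_R_CompleteNormedModule f a b.

Definition ex_CInt (f : R -> C) (a b : R) : Prop := @ex_RInt C_R_NormedModule f a b.

Lemma rcont_continuous (f : R -> C) (t : R) :
  rcont_at f t -> @continuous R_UniformSpace C_UniformSpace f t.
Proof.
  intros H P HP. apply nbhd_Cmod in HP. destruct HP as [d [Hd HP]].
  unfold filtermap. generalize (H d Hd). apply filter_imp. intros s Hs. now apply HP.
Qed.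

Lemma ex_CInt_cont (f : R -> C) (a b : R) :
  (a <= b)%R -> (forall t, (a <= t <= b)%R -> rcont_at f t) -> ex_CInt f a b.
Proof.
  intros Hab H. apply (ex_RInt_continuous (V := C_R_CompleteNormedModule)).
  intros t Ht. rewrite Rmin_left, Rmax_right in Ht by lra.
  apply rcont_continuous. now apply H.
Qed.

Lemma CInt_is f a b l : @is_RInt C_R_NormedModule f a b l -> CInt f a b = l.
Proof. apply (is_RInt_unique (V := C_R_CompleteNormedModule)). Qed.

Lemma is_CInt f a b : ex_CInt f a b -> @is_RInt C_R_NormedModule f a b (CInt f a b).
Proof. apply (RInt_correct (V := C_R_CompleteNormedModule)). Qed.

Lemma CInt_ext f g a b : (a <= b)%R -> (forall t, (a < t < b)%R -> f t = g t) ->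
  CInt f a b = CInt g a b.
Proof.
  intros Hab E. apply (RInt_ext (V := C_R_CompleteNormedModule)).
  intros t Ht. rewrite Rmin_left, Rmax_right in Ht by lra. now apply E.
Qed.

Lemma CInt_plus f g a b : ex_CInt f a b -> ex_CInt g a b ->
  CInt (fun t => f t + g t) a b = CInt f a b + CInt g a b.
Proof. apply (RInt_plus (V := C_R_CompleteNormedModule)). Qed.

Lemma ex_CInt_plus f g a b : ex_CInt f a b -> ex_CInt g a b -> ex_CInt (fun t => f t + g t) a b.
Proof. apply (ex_RInt_plus (V := C_R_CompleteNormedModule)). Qed.

Lemma CInt_minus f g a b : ex_CInt f a b -> ex_CInt g a b ->
  CInt (fun t => f t - g t) a b = CInt f a b - CInt g a b.
Proof. apply (RInt_minus (V := C_R_CompleteNormedModule)). Qed.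

Lemma ex_CInt_minus f g a b : ex_CInt f a b -> ex_CInt g a b -> ex_CInt (fun t => f t - g t) a b.
Proof. apply (ex_RInt_minus (V := C_R_CompleteNormedModule)). Qed.

Lemma CInt_Chasles f a b c : ex_CInt f a b -> ex_CInt f b c -> CInt f a b + CInt f b c = CInt f a c.
Proof. apply (RInt_Chasles (V := C_R_CompleteNormedModule)). Qed.

(** The integral is that of a real normed module, so complex scalars are
    treated through real and imaginary parts. *)
Lemma is_CInt_scal (c : C) f a b l : @is_RInt C_R_NormedModule f a b l ->
  @is_RInt C_R_NormedModule (fun t => c * f t) a b (c * l).
Proof.
  intros H.
  pose proof (is_RInt_fct_extend_fst (U := R_NormedModule) (V := R_NormedModule) f a b l H) as H1.
  pose proof (is_RInt_fct_extend_snd (U := R_NormedModule) (V := R_NormedModule) f a b l H) as H2.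
  apply (is_RInt_fct_extend_pair (U := R_NormedModule) (V := R_NormedModule)).
  - simpl.
    apply (is_RInt_minus (V := R_NormedModule)
             (fun t => (fst c * fst (f t))%R) (fun t => (snd c * snd (f t))%R));
      apply (is_RInt_scal (V := R_NormedModule)); assumption.
  - simpl.
    apply (is_RInt_plus (V := R_NormedModule)
             (fun t => (fst c * snd (f t))%R) (fun t => (snd c * fst (f t))%R));
      apply (is_RInt_scal (V := R_NormedModule)); assumption.
Qed.

Lemma CInt_scal (c : C) f a b : ex_CInt f a b -> CInt (fun t => c * f t) a b = c * CInt f a b.
Proof. intros H. apply CInt_is, is_CInt_scal, is_CInt, H. Qed.

Lemma ex_CInt_scal (c : C) f a b : ex_CInt f a b -> ex_CInt (fun t => c * f t) a b.
Proof. intros H. eexists. apply is_CInt_scal, is_CInt, H. Qed.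

Lemma CInt_const (c : C) a b : CInt (fun _ => c) a b = RtoC (b - a) * c.
Proof.
  unfold CInt. rewrite (RInt_const (V := C_R_CompleteNormedModule)).
  destruct c as [x y]. unfold scal; simpl. unfold prod_scal, scal; simpl.
  unfold mult, Cmult, RtoC; simpl. f_equal; ring.
Qed.

Lemma ex_CInt_const (c : C) a b : ex_CInt (fun _ => c) a b.
Proof. apply (ex_RInt_const (V := C_R_NormedModule)). Qed.

Lemma norm_C_R (x : C) : @norm R_AbsRing C_R_NormedModule x = Cmod x.
Proof.
  unfold norm; simpl. unfold prod_norm, norm; simpl. unfold abs, Cmod; simpl.
  f_equal. rewrite !Rmult_1_r, <- !Rabs_mult, !Rabs_pos_eq; nra.
Qed.

Lemma CInt_bound f a b (M : R) : (a <= b)%R -> ex_CInt f a b ->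
  (forall t, (a <= t <= b)%R -> (Cmod (f t) <= M)%R) ->
  (Cmod (CInt f a b) <= (b - a) * M)%R.
Proof.
  intros Hab H HM. rewrite <- norm_C_R.
  apply (norm_RInt_le_const (V := C_R_NormedModule) f a b (CInt f a b) M Hab).
  - intros t Ht. rewrite norm_C_R. now apply HM.
  - now apply is_CInt.
Qed.

Lemma CInt_derive (f g : R -> C) (a b : R) :
  (a <= b)%R -> (forall t, (a <= t <= b)%R -> rcont_at g t) ->
  (forall t, (a <= t <= b)%R -> is_derive (fun t => fst (f t)) t (fst (g t))) ->
  (forall t, (a <= t <= b)%R -> is_derive (fun t => snd (f t)) t (snd (g t))) ->
  CInt g a b = f b - f a.
Proof.
  intros Hab Hg H1 H2. apply CInt_is.
  apply (is_RInt_fct_extend_pair (U := R_NormedModule) (V := R_NormedModule)).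
  - apply (is_RInt_derive (V := R_CompleteNormedModule) (fun t => fst (f t))).
    + intros t Ht. rewrite Rmin_left, Rmax_right in Ht by lra. now apply H1.
    + intros t Ht. rewrite Rmin_left, Rmax_right in Ht by lra.
      apply (continuous_comp (U := R_UniformSpace) (V := C_UniformSpace) (W := R_UniformSpace) g fst).
      * apply rcont_continuous. now apply Hg.
      * apply continuous_fst.
  - apply (is_RInt_derive (V := R_CompleteNormedModule) (fun t => snd (f t))).
    + intros t Ht. rewrite Rmin_left, Rmax_right in Ht by lra. now apply H2.
    + intros t Ht. rewrite Rmin_left, Rmax_right in Ht by lra.
      apply (continuous_comp (U := R_UniformSpace) (V := C_UniformSpace) (W := R_UniformSpace) g snd).
      * apply rcont_continuous. now apply Hg.
      * apply continuous_snd.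
Qed.

Lemma rcont_comp (f : C -> C) (g : R -> C) (t : R) :
  rcont_at g t -> cont_at f (g t) -> rcont_at (fun s => f (g s)) t.
Proof. intros Hg Hf. now apply (tends_comp (nbR t) g f (g t)). Qed.

Lemma rcont_RtoC (t : R) : rcont_at RtoC t.
Proof.
  intros eps He. exists (mkposreal eps He). intros s Hs.
  rewrite <- RtoC_minus, Cmod_R. exact Hs.
Qed.

Lemma rcont_inv (g : R -> C) (t : R) : rcont_at g t -> g t <> 0 -> rcont_at (fun s => / g s) t.
Proof. intros H Hz. now apply (tends_inv (nbR t)). Qed.

Ltac rcont_tac := unfold rcont_at in *; tends_tac.

(** The same form for functions of a real variable, so that the chain rule
    with [has_deriv] is again a product of continuous factors. *)
Definition has_rderiv (f : R -> C) (t : R) (l : C) : Prop :=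
  exists phi : R -> C, (forall s, f s - f t = phi s * RtoC (s - t)) /\ rcont_at phi t /\ phi t = l.

Lemma rderiv_eq f t (l m : C) : has_rderiv f t l -> l = m -> has_rderiv f t m.
Proof. now intros H <-. Qed.

Lemma deriv_eq f z (l m : C) : has_deriv f z l -> l = m -> has_deriv f z m.
Proof. now intros H <-. Qed.

Lemma rderiv_is_derive f t l : has_rderiv f t l ->
  is_derive (fun s => fst (f s)) t (fst l) /\ is_derive (fun s => snd (f s)) t (snd l).
Proof.
  intros [phi [H [Hc <-]]].
  split; apply is_derive_Reals; intros eps He; destruct (Hc eps He) as [d Hd];
    exists d; intros h Hh Hhd.
  - assert (E : (fst (f (t + h)) - fst (f t) = fst (phi (t + h)) * h)%R).
    { pose proof (f_equal fst (H (t + h)%R)) as E. simpl in E.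
      replace (t + h - t)%R with h in E by ring. rewrite Rmult_0_r in E.
      unfold Rminus in E. rewrite Ropp_0, Rplus_0_r in E. exact E. }
    rewrite E.
    replace (fst (phi (t + h)%R) * h / h)%R with (fst (phi (t + h)%R)) by (field; exact Hh).
    eapply Rle_lt_trans; [| apply (Hd (t + h)%R)].
    + eapply Rle_trans; [| apply Rmax_Cmod]. eapply Rle_trans; [| apply Rmax_l].
      right. reflexivity.
    + unfold ball; simpl. unfold AbsRing_ball, abs, minus, plus, opp; simpl.
      replace (t + h + - t)%R with h by ring. exact Hhd.
  - assert (E : (snd (f (t + h)) - snd (f t) = snd (phi (t + h)) * h)%R).
    { pose proof (f_equal snd (H (t + h)%R)) as E. simpl in E.
      replace (t + h - t)%R with h in E by ring. rewrite Rmult_0_r in E.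
      unfold Rminus. lra. }
    rewrite E.
    replace (snd (phi (t + h)%R) * h / h)%R with (snd (phi (t + h)%R)) by (field; exact Hh).
    eapply Rle_lt_trans; [| apply (Hd (t + h)%R)].
    + eapply Rle_trans; [| apply Rmax_Cmod]. eapply Rle_trans; [| apply Rmax_r].
      right. reflexivity.
    + unfold ball; simpl. unfold AbsRing_ball, abs, minus, plus, opp; simpl.
      replace (t + h + - t)%R with h by ring. exact Hhd.
Qed.

Lemma CInt_rderiv (f g : R -> C) (a b : R) :
  (a <= b)%R -> (forall t, (a <= t <= b)%R -> rcont_at g t) ->
  (forall t, (a <= t <= b)%R -> has_rderiv f t (g t)) -> CInt g a b = f b - f a.
Proof.
  intros Hab Hg H. apply CInt_derive; [exact Hab | exact Hg | |];
    intros t Ht; apply (rderiv_is_derive f t (g t)); now apply H.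
Qed.

Lemma rderiv_rcont f t l : has_rderiv f t l -> rcont_at f t.
Proof.
  intros [phi [H [Hc _]]]. unfold rcont_at.
  apply (tends_ext (nbR t) (fun s => f t + phi s * (RtoC s - RtoC t))).
  - intros s. rewrite <- RtoC_minus, <- H. ring.
  - eapply tends_eq; [tends_tac; apply rcont_RtoC | ring].
Qed.

Lemma rderiv_comp (F : C -> C) (g : R -> C) t l m :
  has_rderiv g t m -> has_deriv F (g t) l -> has_rderiv (fun s => F (g s)) t (l * m).
Proof.
  intros Hg HF. pose proof (rderiv_rcont _ _ _ Hg) as Cg.
  destruct Hg as [p [Hp [Cp <-]]]. destruct HF as [r [Hr [Cr <-]]].
  exists (fun s => r (g s) * p s). split; [| split; [| reflexivity]].
  - intros s. rewrite Hr, Hp. ring.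
  - unfold rcont_at. apply tends_mult; [typeclasses eauto | | exact Cp].
    apply (tends_comp (nbR t) g r (g t)); assumption.
Qed.

Lemma rderiv_affine (c d : C) t : has_rderiv (fun s => c * RtoC s + d) t c.
Proof.
  exists (fun _ => c). split; [| split; [unfold rcont_at; tends_tac | reflexivity]].
  intros s. rewrite RtoC_minus. ring.
Qed.

Lemma rderiv_scal (c : C) f t l : has_rderiv f t l -> has_rderiv (fun s => c * f s) t (c * l).
Proof.
  intros [p [Hp [Cp <-]]]. exists (fun s => c * p s).
  split; [| split; [unfold rcont_at in *; tends_tac | reflexivity]].
  intros s. rewrite <- Cmult_assoc, <- Hp. ring.
Qed.

(** * The complex exponential *)

Definition cexp (z : C) : C := (exp (Re z) * cos (Im z), exp (Re z) * sin (Im z))%R.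

Lemma cexp_plus z w : cexp (z + w) = cexp z * cexp w.
Proof.
  destruct z as [a b], w as [c d]. unfold cexp, Cplus, Cmult, Re, Im; simpl.
  rewrite exp_plus, cos_plus, sin_plus. f_equal; ring.
Qed.

Lemma cexp_0 : cexp 0 = 1.
Proof.
  unfold cexp, Re, Im, RtoC; simpl. rewrite exp_0, cos_0, sin_0. f_equal; ring.
Qed.

Lemma Cmod_cexp z : Cmod (cexp z) = exp (Re z).
Proof.
  unfold cexp, Cmod; simpl.
  replace (_ + _)%R with ((exp (Re z)) ^ 2 * (Rsqr (sin (Im z)) + Rsqr (cos (Im z))))%R
    by (unfold Rsqr; ring).
  rewrite sin2_cos2, Rmult_1_r. apply sqrt_pow2. left; apply exp_pos.
Qed.

Lemma cexp_neq_0 z : cexp z <> 0.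
Proof. apply Cmod_gt_0. rewrite Cmod_cexp. apply exp_pos. Qed.

Lemma cexp_opp z : cexp (- z) = / cexp z.
Proof.
  assert (H : cexp z * cexp (- z) = 1).
  { rewrite <- cexp_plus. replace (z + - z) with (RtoC 0) by ring. apply cexp_0. }
  pose proof (cexp_neq_0 z).
  replace (cexp (- z)) with (/ cexp z * (cexp z * cexp (- z))) by (field; assumption).
  rewrite H. ring.
Qed.

Lemma real_lin_approx (f : R -> R) (l : R) : derivable_pt_lim f 0 l ->
  forall eps, (0 < eps)%R -> exists d, (0 < d)%R /\
    forall h, (Rabs h < d)%R -> (Rabs (f h - f 0 - l * h) <= eps * Rabs h)%R.
Proof.
  intros H eps He. destruct (H eps He) as [d Hd]. exists d. split; [apply cond_pos |].
  intros h Hh. destruct (Req_dec h 0) as [-> | Hne].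
  - replace (f 0 - f 0 - l * 0)%R with 0%R by ring. rewrite Rabs_R0. lra.
  - specialize (Hd h Hne Hh). rewrite Rplus_0_l in Hd.
    replace (f h - f 0 - l * h)%R with (((f h - f 0) / h - l) * h)%R by (field; exact Hne).
    rewrite Rabs_mult. apply Rmult_le_compat_r; [apply Rabs_pos | lra].
Qed.

Lemma Cmod_le_Rabs (x y : R) : (Cmod (x, y) <= Rabs x + Rabs y)%R.
Proof.
  replace (x, y) with (RtoC x + Ci * RtoC y)
    by (unfold RtoC, Ci, Cplus, Cmult; simpl; f_equal; ring).
  eapply Rle_trans; [apply Cmod_triangle |].
  rewrite Cmod_mult, Cmod_Ci, !Cmod_R. lra.
Qed.

(** With X = exp x = 1 + x + o(x) and Y = cos y + i sin y = 1 + i y + o(y),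
    the product satisfies X Y - 1 - x - i y = (X - 1 - x) Y + (1 + x)
    (Y - 1 - i y) + i x y. *)
Lemma deriv_cexp_0 : has_deriv cexp 0 1.
Proof.
  apply deriv_eps. intros eps He.
  (* the three terms of the decomposition amount to at most 6 e |z| *)
  set (e := Rmin 1 (eps / 8)).
  assert (He0 : (0 < e)%R) by (unfold e; apply Rmin_glb_lt; lra).
  assert (He1 : (e <= 1)%R) by apply Rmin_l.
  assert (He8 : (e <= eps / 8)%R) by apply Rmin_r.
  destruct (real_lin_approx exp (exp 0) (derivable_pt_lim_exp 0) e He0) as [d1 [Hd1 H1]].
  destruct (real_lin_approx cos (- sin 0) (derivable_pt_lim_cos 0) e He0) as [d2 [Hd2 H2]].
  destruct (real_lin_approx sin (cos 0) (derivable_pt_lim_sin 0) e He0) as [d3 [Hd3 H3]].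
  apply nbhd_Cmod. exists (Rmin (Rmin d1 d2) (Rmin d3 e)). split.
  { repeat apply Rmin_glb_lt; lra. }
  intros [x y]. replace ((x, y) - 0) with (x, y)
    by (unfold Cminus, Cplus, Copp, RtoC; simpl; f_equal; ring).
  intros Hw. rewrite cexp_0, Cmult_1_l.
  pose proof (Rmin_l (Rmin d1 d2) (Rmin d3 e)). pose proof (Rmin_r (Rmin d1 d2) (Rmin d3 e)).
  pose proof (Rmin_l d1 d2). pose proof (Rmin_r d1 d2).
  pose proof (Rmin_l d3 e). pose proof (Rmin_r d3 e).
  pose proof (Rmax_Cmod (x, y)) as HM. simpl in HM.
  pose proof (Rmax_l (Rabs x) (Rabs y)). pose proof (Rmax_r (Rabs x) (Rabs y)).
  specialize (H1 x ltac:(lra)). specialize (H2 y ltac:(lra)). specialize (H3 y ltac:(lra)).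
  rewrite exp_0 in H1. rewrite cos_0, sin_0 in H2. rewrite sin_0, cos_0 in H3.
  unfold cexp, Re, Im; simpl.
  replace (exp x * cos y, exp x * sin y)%R with (RtoC (exp x) * (cos y, sin y))
    by (unfold Cmult, RtoC; simpl; f_equal; ring).
  set (X := exp x) in *. set (P := cos y) in *. set (S := sin y) in *.
  replace (RtoC X * (P, S) - 1 - (x, y))
    with (RtoC (X - 1 - 1 * x) * (P, S) +
          (RtoC (1 + x) * (P - 1 - - 0 * y, S - 0 - 1 * y)%R + Ci * RtoC x * RtoC y))
    by (unfold Cminus, Cplus, Copp, Cmult, RtoC, Ci; simpl; f_equal; ring).
  eapply Rle_trans; [apply Cmod_triangle |].
  eapply Rle_trans; [apply Rplus_le_compat_l, Cmod_triangle |].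
  rewrite !Cmod_mult, Cmod_Ci, !Cmod_R, Rmult_1_l.
  assert (HPS : Cmod (P, S) = 1%R).
  { unfold P, S, Cmod; simpl. replace (_ + _)%R with (Rsqr (sin y) + Rsqr (cos y))%R
      by (unfold Rsqr; ring). rewrite sin2_cos2. apply sqrt_1. }
  rewrite HPS, Rmult_1_r.
  pose proof (Cmod_le_Rabs (P - 1 - - 0 * y) (S - 0 - 1 * y)) as HQ.
  set (Q := Cmod _) in HQ. fold Q.
  assert (HQ' : (Q <= 2 * e * Rabs y)%R) by lra.
  assert (Hx1 : (Rabs (1 + x) <= 2)%R).
  { eapply Rle_trans; [apply Rabs_triang |]. rewrite Rabs_R1. lra. }
  pose proof (Rabs_pos x). pose proof (Rabs_pos y). pose proof (Rabs_pos (1 + x)).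
  assert (HQ0 : (0 <= Q)%R) by apply Cmod_ge_0.
  assert (Rabs (1 + x) * Q <= 2 * (2 * e * Rabs y))%R by (apply Rmult_le_compat; lra).
  assert (Rabs x * Rabs y <= e * Rabs y)%R by (apply Rmult_le_compat; lra).
  set (N := Cmod (x, y)) in *.
  assert (e * Rabs x <= e * N)%R by (apply Rmult_le_compat_l; lra).
  assert (e * Rabs y <= e * N)%R by (apply Rmult_le_compat_l; lra).
  assert (e * N <= eps / 8 * N)%R by (apply Rmult_le_compat_r; lra).
  rewrite Rmult_1_l in H1. rewrite Rmult_1_l.
  assert (0 <= eps * N)%R by (apply Rmult_le_pos; [lra | apply Cmod_ge_0]).
  lra.
Qed.

Lemma deriv_cexp z : has_deriv cexp z (cexp z).
Proof.
  assert (H : has_deriv (fun w => cexp z * cexp (w - z)) z (cexp z)).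
  { eapply deriv_eq.
    - apply deriv_mult; [apply deriv_const |].
      apply (deriv_comp (fun w => w - z) cexp).
      + apply (deriv_plus (fun w => w) (fun _ => - z)); [apply deriv_id | apply deriv_const].
      + replace (z - z) with (RtoC 0) by ring. apply deriv_cexp_0.
    - cbv beta; ring. }
  revert H. apply deriv_ext_loc. apply filter_forall. intros w. rewrite <- cexp_plus.
  f_equal. ring.
Qed.

Definition twopii : C := RtoC (2 * PI) * Ci.

Definition e2pi (z : C) : C := cexp (twopii * z).

Lemma deriv_e2pi z : has_deriv e2pi z (twopii * e2pi z).
Proof.
  eapply deriv_eq.
  - apply (deriv_comp (fun w => twopii * w) cexp); [| apply deriv_cexp].
    apply deriv_mult; [apply deriv_const | apply deriv_id].
  - unfold e2pi. ring.
Qed.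

Lemma diff_e2pi z : diff_at e2pi z.
Proof. eexists. apply deriv_e2pi. Qed.

Lemma twopii_neq_0 : twopii <> 0.
Proof.
  apply Cmod_gt_0. unfold twopii. rewrite Cmod_mult, Cmod_Ci, Cmod_R, Rmult_1_r.
  pose proof PI_RGT_0. rewrite Rabs_pos_eq; lra.
Qed.

Lemma Cmod_twopii : Cmod twopii = (2 * PI)%R.
Proof.
  unfold twopii. rewrite Cmod_mult, Cmod_Ci, Cmod_R, Rmult_1_r.
  pose proof PI_RGT_0. rewrite Rabs_pos_eq; lra.
Qed.

Lemma e2pi_plus z w : e2pi (z + w) = e2pi z * e2pi w.
Proof. unfold e2pi. rewrite <- cexp_plus. f_equal. ring. Qed.
Lemma e2pi_0 : e2pi 0 = 1.
Proof. unfold e2pi. rewrite Cmult_0_r. apply cexp_0. Qed.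
Lemma e2pi_opp z : e2pi (- z) = / e2pi z.
Proof. unfold e2pi. rewrite <- cexp_opp. f_equal. ring. Qed.
Lemma e2pi_neq_0 z : e2pi z <> 0.
Proof. apply cexp_neq_0. Qed.
Lemma e2pi_pow z k : e2pi z ^ k = e2pi (RtoC (INR k) * z).
Proof.
  induction k as [| k IH]; [simpl; rewrite Cmult_0_l, e2pi_0; reflexivity |].
  rewrite S_INR. simpl Cpow. rewrite IH, <- e2pi_plus. f_equal. rewrite RtoC_plus. ring.
Qed.
Lemma Cmod_e2pi z : Cmod (e2pi z) = exp (- (2 * PI * Im z)).
Proof.
  unfold e2pi. rewrite Cmod_cexp. f_equal. destruct z as [x y].
  unfold twopii, Cmult, Ci, RtoC, Re, Im; simpl. ring.
Qed.
Lemma e2pi_1 : e2pi 1 = 1.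
Proof.
  unfold e2pi, twopii, cexp, Cmult, Ci, RtoC, Re, Im; simpl.
  rewrite !Rmult_0_r, !Rmult_0_l, !Rmult_1_r, !Rminus_0_r, !Rplus_0_l.
  rewrite Rplus_0_r. rewrite exp_0, cos_2PI, sin_2PI. f_equal; ring.
Qed.
Lemma e2pi_IZR k : e2pi (RtoC (IZR k)) = 1.
Proof.
  assert (N : forall n, e2pi (RtoC (INR n)) = 1).
  { intros n. induction n as [| n IH]; [apply e2pi_0 |].
    rewrite S_INR, RtoC_plus, e2pi_plus, IH, e2pi_1. ring. }
  destruct k as [| p | p].
  - apply e2pi_0.
  - replace (IZR (Z.pos p)) with (INR (Pos.to_nat p)) by (rewrite INR_IZR_INZ; f_equal; lia).
    apply N.
  - replace (RtoC (IZR (Z.neg p))) with (- RtoC (INR (Pos.to_nat p))).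
    + rewrite e2pi_opp, N. field.
    + rewrite <- RtoC_opp. f_equal. rewrite INR_IZR_INZ, <- opp_IZR. f_equal. lia.
Qed.

Lemma rderiv_e2pi (c d : C) t : has_rderiv (fun s => e2pi (c * RtoC s + d)) t (twopii * e2pi (c * RtoC t + d) * c).
Proof. apply (rderiv_comp e2pi); [apply rderiv_affine | apply deriv_e2pi]. Qed.

Lemma rcont_e2pi (c d : C) t : rcont_at (fun s => e2pi (c * RtoC s + d)) t.
Proof. eapply rderiv_rcont. apply rderiv_e2pi. Qed.

(** A nontrivial character has a periodic primitive. *)
Lemma CInt_e2pi (k : Z) (d : C) : k <> 0%Z -> CInt (fun t => e2pi (RtoC (IZR k) * RtoC t + d)) 0 1 = 0.
Proof.
  intros Hk.
  assert (Hk' : RtoC (IZR k) <> 0).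
  { intros E. apply RtoC_inj in E. apply eq_IZR in E. contradiction. }
  rewrite (CInt_rderiv (fun t => / (twopii * RtoC (IZR k)) * e2pi (RtoC (IZR k) * RtoC t + d))).
  - rewrite !e2pi_plus, Cmult_1_r, Cmult_0_r, e2pi_IZR, e2pi_0. ring.
  - lra.
  - intros t _. apply rcont_e2pi.
  - intros t _. eapply rderiv_eq; [apply rderiv_scal, rderiv_e2pi |].
    field. split; [exact Hk' | apply twopii_neq_0].
Qed.

(** * Cauchy's integral formula *)

Lemma Cmod_e2pi_R (t : R) : Cmod (e2pi (RtoC t)) = 1%R.
Proof. rewrite Cmod_e2pi. unfold Im, RtoC; simpl. rewrite Rmult_0_r, Ropp_0. apply exp_0. Qed.

Lemma rcont_e2pi_R (t : R) : rcont_at (fun s => e2pi (RtoC s)) t.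
Proof. apply (rcont_comp e2pi RtoC); [apply rcont_RtoC | apply diff_cont, diff_e2pi]. Qed.

Lemma rderiv_e2pi_R (t : R) : has_rderiv (fun s => e2pi (RtoC s)) t (twopii * e2pi (RtoC t)).
Proof.
  eapply rderiv_eq.
  - apply (rderiv_comp e2pi RtoC); [| apply deriv_e2pi].
    instantiate (1 := 1). exists (fun _ => 1).
    split; [| split; [unfold rcont_at; tends_tac | reflexivity]].
    intros s. rewrite RtoC_minus. ring.
  - ring.
Qed.

(** The disk is swept by the segments from [z0] to the points of the circle,
    [g s t = z0 + s c(t)], along which dz / (z - z0) becomes ds / s +
    (c'(t) / c(t)) dt. Goursat's argument is carried out in the rectangle of
    the (s, t). As c has period 1, the integral of f dz / (z - z0) over t
    does not depend on s; for s = 1 it is Cauchy's integral, and as s tends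
    to 0 it tends to [f z0] times the winding integral of the circle. *)
Section Cauchy.
Variables (f : C -> C) (a z0 : C) (r : R).
Hypothesis Hr : (0 < r)%R.
Hypothesis Hf : forall z, (Cmod (z - a) <= r)%R -> diff_at f z.
Hypothesis Hz : (Cmod (z0 - a) < r)%R.

Let c (t : R) : C := a + RtoC r * e2pi (RtoC t) - z0.
Let c' (t : R) : C := RtoC r * (twopii * e2pi (RtoC t)).
Let gap : R := (r - Cmod (z0 - a))%R.
Let k (t : R) : C := c' t / c t.

Lemma cauchy_gap : (0 < gap)%R.
Proof. unfold gap. lra. Qed.

Lemma cauchy_c_lower t : (gap <= Cmod (c t))%R.
Proof.
  unfold gap, c.
  pose proof (Cmod_rev_triangle (RtoC r * e2pi (RtoC t)) (z0 - a)) as H.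
  rewrite Cmod_mult, Cmod_R, Cmod_e2pi_R, Rabs_pos_eq in H by lra.
  replace (a + RtoC r * e2pi (RtoC t) - z0) with (RtoC r * e2pi (RtoC t) - (z0 - a)) by ring.
  lra.
Qed.

Lemma cauchy_c_upper t : (Cmod (c t) <= 2 * r)%R.
Proof.
  unfold c.
  replace (a + RtoC r * e2pi (RtoC t) - z0) with (RtoC r * e2pi (RtoC t) + - (z0 - a)) by ring.
  eapply Rle_trans; [apply Cmod_triangle |].
  rewrite Cmod_opp, Cmod_mult, Cmod_R, Cmod_e2pi_R, Rabs_pos_eq by lra. lra.
Qed.

Lemma cauchy_c_neq_0 t : c t <> 0.
Proof. apply Cmod_gt_0. pose proof (cauchy_c_lower t). pose proof cauchy_gap. lra. Qed.

Lemma cauchy_rderiv_c t : has_rderiv c t (c' t).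
Proof.
  unfold c, c'. destruct (rderiv_scal (RtoC r) _ t _ (rderiv_e2pi_R t)) as [p [Hp Hp']].
  exists p. split; [| exact Hp']. intros s. rewrite <- Hp. ring.
Qed.

Lemma cauchy_rcont_c t : rcont_at c t.
Proof. eapply rderiv_rcont, cauchy_rderiv_c. Qed.

Lemma cauchy_rcont_c' t : rcont_at c' t.
Proof. unfold c', rcont_at. pose proof (rcont_e2pi_R t) as H. rcont_tac. Qed.

Lemma cauchy_rcont_k t : rcont_at k t.
Proof.
  unfold k, rcont_at, Cdiv. apply tends_mult; [typeclasses eauto | apply cauchy_rcont_c' |].
  apply (rcont_inv c); [apply cauchy_rcont_c | apply cauchy_c_neq_0].
Qed.

Let K : R := (2 * PI * r / gap)%R.

Lemma cauchy_K_pos : (0 < K)%R.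
Proof.
  unfold K. pose proof PI_RGT_0. pose proof cauchy_gap. apply Rdiv_lt_0_compat; nra.
Qed.

Lemma cauchy_Cmod_c' t : Cmod (c' t) = (2 * PI * r)%R.
Proof.
  unfold c'. rewrite !Cmod_mult, Cmod_e2pi_R, Cmod_R, Cmod_twopii, Rabs_pos_eq by lra. ring.
Qed.

Lemma cauchy_k_bound t : (Cmod (k t) <= K)%R.
Proof.
  unfold k. rewrite Cmod_div by apply cauchy_c_neq_0. rewrite cauchy_Cmod_c'.
  unfold K, Rdiv. pose proof PI_RGT_0. apply Rmult_le_compat_l; [nra |].
  apply Rinv_le_contravar; [apply cauchy_gap | apply cauchy_c_lower].
Qed.

Lemma CInt_c' (u v : R) : (u <= v)%R -> CInt c' u v = c v - c u.
Proof.
  intros Huv. apply CInt_rderiv; [exact Huv | |]; intros t _;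
    [apply cauchy_rcont_c' | apply cauchy_rderiv_c].
Qed.

Lemma cauchy_c_lip (u v : R) : (u <= v)%R -> (Cmod (c v - c u) <= 2 * PI * r * (v - u))%R.
Proof.
  intros Huv. rewrite <- CInt_c' by exact Huv. rewrite Rmult_comm.
  apply CInt_bound; [exact Huv | |].
  - apply ex_CInt_cont; [exact Huv |]. intros; apply cauchy_rcont_c'.
  - intros t _. rewrite cauchy_Cmod_c'. lra.
Qed.

Lemma cauchy_c_lip' (u v : R) : (Cmod (c v - c u) <= 2 * PI * r * Rabs (v - u))%R.
Proof.
  destruct (Rle_dec u v) as [H | H].
  - rewrite Rabs_pos_eq by lra. now apply cauchy_c_lip.
  - rewrite Cmod_minus_sym, Rabs_minus_sym, Rabs_pos_eq by lra. apply cauchy_c_lip. lra.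
Qed.

Let g (s t : R) : C := z0 + RtoC s * c t.

Lemma cauchy_in_disk s t : (0 <= s <= 1)%R -> (Cmod (g s t - a) <= r)%R.
Proof.
  intros Hs. unfold g, c.
  replace (z0 + RtoC s * (a + RtoC r * e2pi (RtoC t) - z0) - a)
    with (RtoC (1 - s) * (z0 - a) + RtoC s * (RtoC r * e2pi (RtoC t)))
    by (rewrite RtoC_minus; ring).
  eapply Rle_trans; [apply Cmod_triangle |].
  rewrite !Cmod_mult, !Cmod_R, Cmod_e2pi_R, !Rabs_pos_eq by lra. nra.
Qed.

Lemma cauchy_rcont_fg_t s t : (0 <= s <= 1)%R -> rcont_at (fun t => f (g s t)) t.
Proof.
  intros Hs. apply (rcont_comp f (g s)).
  - unfold g, rcont_at. pose proof (cauchy_rcont_c t) as Hc. rcont_tac.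
  - apply diff_cont, Hf. now apply cauchy_in_disk.
Qed.

Lemma cauchy_rcont_fg_s s t : (0 <= s <= 1)%R -> rcont_at (fun s => f (g s t)) s.
Proof.
  intros Hs. apply (rcont_comp f (fun s => g s t)).
  - unfold g, rcont_at. pose proof (rcont_RtoC s) as Hc. rcont_tac.
  - apply diff_cont, Hf. now apply cauchy_in_disk.
Qed.

(* The integrals of F dz / (z - z0) along an arc, along a segment, and around a rectangle. *)
Let I (F : R -> R -> C) (s u v : R) : C := CInt (fun t => F s t * k t) u v.
Let J (F : R -> R -> C) (t x y : R) : C := CInt (fun s => F s t * / RtoC s) x y.
Let mu (F : R -> R -> C) (x y u v : R) : C := I F y u v - I F x u v - J F v x y + J F u x y.
Let G (s t : R) : C := f (g s t).

Definition side_cont (F : R -> R -> C) : Prop :=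
  (forall s t, (0 <= s <= 1)%R -> rcont_at (fun t => F s t) t) /\
  (forall s t, (0 <= s <= 1)%R -> rcont_at (fun s => F s t) s).

Lemma ex_CInt_I F s u v : side_cont F -> (0 <= s <= 1)%R -> (u <= v)%R -> ex_CInt (fun t => F s t * k t) u v.
Proof.
  intros [H _] Hs Huv. apply ex_CInt_cont; [exact Huv |]. intros t _. unfold rcont_at.
  apply tends_mult; [typeclasses eauto | now apply H | apply cauchy_rcont_k].
Qed.

Lemma RtoC_neq_0 (s : R) : (0 < s)%R -> RtoC s <> 0.
Proof. intros H E. apply RtoC_inj in E. lra. Qed.

Lemma ex_CInt_J F t x y : side_cont F -> (0 < x <= y)%R -> (y <= 1)%R ->
  ex_CInt (fun s => F s t * / RtoC s) x y.
Proof.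
  intros [_ H] Hx Hy. apply ex_CInt_cont; [lra |]. intros s Hs. unfold rcont_at.
  apply tends_mult; [typeclasses eauto | apply H; lra |].
  apply (rcont_inv RtoC); [apply rcont_RtoC | apply RtoC_neq_0; lra].
Qed.

Lemma side_cont_G : side_cont G.
Proof. split; intros s t Hs; [now apply cauchy_rcont_fg_t | now apply cauchy_rcont_fg_s]. Qed.

Lemma side_cont_affine (A B : C) : side_cont (fun s t => A + B * (RtoC s * c t)).
Proof.
  split; intros s t Hs; unfold rcont_at; pose proof (rcont_RtoC s); pose proof (cauchy_rcont_c t); rcont_tac.
Qed.

Lemma side_cont_minus F1 F2 : side_cont F1 -> side_cont F2 -> side_cont (fun s t => F1 s t - F2 s t).
Proof.
  intros [H1 H2] [H3 H4]. split; intros s t Hs; unfold rcont_at;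
    apply tends_minus; try typeclasses eauto; try (now apply H1); try (now apply H2);
    try (now apply H3); now apply H4.
Qed.

Lemma mu_minus F1 F2 x y u v : side_cont F1 -> side_cont F2 ->
  (0 < x <= y)%R -> (y <= 1)%R -> (u <= v)%R ->
  mu (fun s t => F1 s t - F2 s t) x y u v = mu F1 x y u v - mu F2 x y u v.
Proof.
  intros H1 H2 Hx Hy Hu.
  assert (EI : forall s, (0 <= s <= 1)%R -> I (fun s t => F1 s t - F2 s t) s u v = I F1 s u v - I F2 s u v).
  { intros s Hs. unfold I. rewrite <- CInt_minus by (apply ex_CInt_I; assumption).
    apply CInt_ext; [exact Hu |]. intros t _. ring. }
  assert (EJ : forall t, J (fun s t => F1 s t - F2 s t) t x y = J F1 t x y - J F2 t x y).
  { intros t. unfold J. rewrite <- CInt_minus by (apply ex_CInt_J; assumption).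
    apply CInt_ext; [lra |]. intros s _. ring. }
  unfold mu. rewrite !EI, !EJ by lra. ring.
Qed.

(** The terms with [A] on opposite sides cancel, and those with [B] are
    (y - x) (c v - c u) on both pairs of sides. *)
Lemma mu_affine (A B : C) x y u v : (0 < x <= y)%R -> (y <= 1)%R -> (u <= v)%R ->
  mu (fun s t => A + B * (RtoC s * c t)) x y u v = 0.
Proof.
  intros Hx Hy Hu.
  assert (EI : forall s, I (fun s t => A + B * (RtoC s * c t)) s u v
     = A * CInt k u v + B * RtoC s * (c v - c u)).
  { intros s. unfold I. rewrite <- CInt_c' by exact Hu.
    rewrite <- !CInt_scal.
    - rewrite <- CInt_plus.
      + apply CInt_ext; [exact Hu |]. intros t _. unfold k. field. apply cauchy_c_neq_0.
      + apply ex_CInt_scal, ex_CInt_cont; [exact Hu |]. intros; apply cauchy_rcont_k.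
      + apply ex_CInt_scal, ex_CInt_cont; [exact Hu |]. intros; apply cauchy_rcont_c'.
    - apply ex_CInt_cont; [exact Hu |]. intros; apply cauchy_rcont_c'.
    - apply ex_CInt_cont; [exact Hu |]. intros; apply cauchy_rcont_k. }
  assert (EJ : forall t, J (fun s t => A + B * (RtoC s * c t)) t x y
     = A * CInt (fun s => / RtoC s) x y + B * c t * RtoC (y - x)).
  { intros t. unfold J.
    assert (HX : ex_CInt (fun s => / RtoC s) x y).
    { apply ex_CInt_cont; [lra |]. intros s Hs. apply (rcont_inv RtoC); [apply rcont_RtoC |].
      apply RtoC_neq_0; lra. }
    rewrite <- CInt_scal by exact HX.
    replace (B * c t * RtoC (y - x)) with (RtoC (y - x) * (B * c t)) by ring.
    rewrite <- CInt_const, <- CInt_plus.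
    - apply CInt_ext; [lra |]. intros s Hs. field. apply RtoC_neq_0; lra.
    - now apply ex_CInt_scal.
    - apply ex_CInt_const. }
  unfold mu. rewrite !EI, !EJ, RtoC_minus. ring.
Qed.

Lemma mu_bound F (eta : R) x y u v : side_cont F ->
  (0 < x <= y)%R -> (y <= 1)%R -> (u <= v)%R ->
  (forall s t, (x <= s <= y)%R -> (u <= t <= v)%R -> (Cmod (F s t) <= eta)%R) ->
  (Cmod (mu F x y u v) <= 2 * eta * (K * (v - u) + / x * (y - x)))%R.
Proof.
  intros HF Hx Hy Hu HB.
  assert (He : (0 <= eta)%R) by (eapply Rle_trans; [apply Cmod_ge_0 | apply (HB x u); lra]).
  pose proof cauchy_K_pos as HK.
  assert (BI : forall s, (x <= s <= y)%R -> (Cmod (I F s u v) <= (v - u) * (eta * K))%R).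
  { intros s Hs. apply CInt_bound; [exact Hu | apply ex_CInt_I; [exact HF | lra | exact Hu] |].
    intros t Ht. rewrite Cmod_mult. apply Rmult_le_compat; try apply Cmod_ge_0;
      [now apply HB | apply cauchy_k_bound]. }
  assert (BJ : forall t, (u <= t <= v)%R -> (Cmod (J F t x y) <= (y - x) * (eta * / x))%R).
  { intros t Ht. apply CInt_bound; [lra | apply ex_CInt_J; [exact HF | lra | exact Hy] |].
    intros s Hs. rewrite Cmod_mult. apply Rmult_le_compat; try apply Cmod_ge_0;
      [now apply HB |]. rewrite Cmod_inv by (apply RtoC_neq_0; lra).
    rewrite Cmod_R, Rabs_pos_eq by lra. apply Rinv_le_contravar; lra. }
  unfold mu, Cminus.
  eapply Rle_trans; [apply Cmod_triangle |].
  eapply Rle_trans; [apply Rplus_le_compat_r, Cmod_triangle |].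
  eapply Rle_trans; [apply Rplus_le_compat_r, Rplus_le_compat_r, Cmod_triangle |].
  rewrite !Cmod_opp.
  pose proof (BI x ltac:(lra)). pose proof (BI y ltac:(lra)).
  pose proof (BJ u ltac:(lra)). pose proof (BJ v ltac:(lra)). lra.
Qed.

Lemma mu_additive F x y u v p w : side_cont F ->
  (0 < x <= p)%R -> (p <= y)%R -> (y <= 1)%R -> (u <= w <= v)%R ->
  mu F x y u v = mu F x p u w + mu F p y u w + mu F x p w v + mu F p y w v.
Proof.
  intros HF Hx Hp Hy Hu.
  assert (EI : forall s, (0 <= s <= 1)%R -> I F s u v = I F s u w + I F s w v).
  { intros s Hs. unfold I. symmetry. apply CInt_Chasles; apply ex_CInt_I; (assumption || lra). }
  assert (EJ : forall t, J F t x y = J F t x p + J F t p y).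
  { intros t. unfold J. symmetry. apply CInt_Chasles; apply ex_CInt_J; (assumption || lra). }
  unfold mu. rewrite !EI, !EJ by lra. ring.
Qed.

(** On a small rectangle f is affine up to o(diameter), and [mu] annihilates
    the affine part; so [bisection] applies to the modulus of [mu G]. *)
Lemma goursat x u v : (0 < x <= 1)%R -> (u <= v)%R -> mu G x 1 u v = 0.
Proof.
  intros Hx Hu. apply Cmod_eq_0. apply Rle_antisym; [| apply Cmod_ge_0].
  apply (bisection (fun x y u v => Cmod (mu G x y u v))); [lra | exact Hu | |].
  - intros x' y' u' v' H1 H2 H3 H4 H5 H6.
    rewrite (mu_additive G x' y' u' v' ((x' + y') / 2) ((u' + v') / 2) side_cont_G) by lra.
    eapply Rle_trans; [apply Cmod_triangle |]. apply Rplus_le_compat_r.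
    eapply Rle_trans; [apply Cmod_triangle |]. apply Rplus_le_compat_r.
    apply Cmod_triangle.
  - intros s t eps Hs Ht He.
    destruct (Hf (g s t)) as [B HB]; [apply cauchy_in_disk; lra |].
    pose proof PI_RGT_0 as HPI. pose proof cauchy_K_pos as HK.
    assert (Hix : (0 < / x)%R) by (apply Rinv_0_lt_compat; lra).
    (* L is a Lipschitz constant of [g], and M collects the constants of [mu_bound] *)
    set (L := (2 * r + 2 * PI * r)%R).
    assert (HL : (0 < L)%R) by (unfold L; nra).
    set (M := (2 * L * (K + / x))%R).
    assert (HM : (0 < M)%R) by (unfold M; nra).
    assert (He' : (0 < eps / M)%R) by (apply Rdiv_lt_0_compat; lra).
    pose proof (proj2 (deriv_eps _ _ _) HB (eps / M)%R He') as HN.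
    apply nbhd_Cmod in HN. destruct HN as [d [Hd HN]].
    exists (d / (2 * L))%R. split; [apply Rdiv_lt_0_compat; lra |].
    intros x' y' u' v' H1 H2 H3 H4 H5 H6 H7 H8.
    set (rho := fun s' t' => G s' t' - ((G s t - B * (RtoC s * c t)) + B * (RtoC s' * c t'))).
    assert (E : mu G x' y' u' v' = mu rho x' y' u' v').
    { unfold rho.
      rewrite (mu_minus G (fun s' t' => (G s t - B * (RtoC s * c t)) + B * (RtoC s' * c t'))
                x' y' u' v' side_cont_G) by (lra || apply side_cont_affine).
      rewrite mu_affine by lra. ring. }
    rewrite E.
    set (l := ((y' - x') + (v' - u'))%R).
    assert (Hl : (0 <= l)%R) by (unfold l; lra).
    assert (HLl : (L * l < d)%R).
    { assert (l < d / L)%R.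
      { unfold l. replace (d / L)%R with (d / (2 * L) + d / (2 * L))%R by (field; lra). lra. }
      apply Rmult_lt_compat_l with (r := L) in H; [| exact HL].
      replace (L * (d / L))%R with d in H by (field; lra). exact H. }
    assert (Hg : forall s' t', (x' <= s' <= y')%R -> (u' <= t' <= v')%R ->
                   (Cmod (g s' t' - g s t) <= L * l)%R).
    { intros s' t' Hs' Ht'. unfold g.
      replace (z0 + RtoC s' * c t' - (z0 + RtoC s * c t))
        with (RtoC (s' - s) * c t' + RtoC s * (c t' - c t)) by (rewrite RtoC_minus; ring).
      eapply Rle_trans; [apply Cmod_triangle |]. rewrite !Cmod_mult, !Cmod_R.
      rewrite (Rabs_pos_eq s) by lra.
      pose proof (cauchy_c_upper t'). pose proof (cauchy_c_lip' t t').
      assert (Rabs (s' - s) <= y' - x')%R by (apply Rabs_le; lra).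
      assert (Rabs (t' - t) <= v' - u')%R by (apply Rabs_le; lra).
      pose proof (Rabs_pos (s' - s)). pose proof (Rabs_pos (t' - t)).
      pose proof (Cmod_ge_0 (c t')). pose proof (Cmod_ge_0 (c t' - c t)).
      assert (Rabs (s' - s) * Cmod (c t') <= l * (2 * r))%R
        by (apply Rmult_le_compat; unfold l; lra).
      assert (s * Cmod (c t' - c t) <= 1 * (2 * PI * r * l))%R.
      { apply Rmult_le_compat; try lra. eapply Rle_trans; [eassumption |].
        apply Rmult_le_compat_l; [nra | unfold l; lra]. }
      unfold L. lra. }
    assert (Hrho : forall s' t', (x' <= s' <= y')%R -> (u' <= t' <= v')%R ->
                   (Cmod (rho s' t') <= eps / M * (L * l))%R).
    { intros s' t' Hs' Ht'. specialize (Hg s' t' Hs' Ht').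
      specialize (HN (g s' t') ltac:(lra)).
      replace (rho s' t') with (f (g s' t') - f (g s t) - B * (g s' t' - g s t))
        by (unfold rho, G, g; ring).
      eapply Rle_trans; [exact HN |]. apply Rmult_le_compat_l; lra. }
    eapply Rle_trans.
    + apply (mu_bound rho (eps / M * (L * l))); try lra; [| exact Hrho].
      apply (side_cont_minus G); [apply side_cont_G |].
      apply side_cont_affine.
    + assert (Hx' : (/ x' <= / x)%R) by (apply Rinv_le_contravar; lra).
      assert (K * (v' - u') + / x' * (y' - x') <= (K + / x) * l)%R.
      { unfold l. assert (0 < / x')%R by (apply Rinv_0_lt_compat; lra). 
        assert (/ x' * (y' - x') <= / x * (y' - x'))%R by (apply Rmult_le_compat_r; lra).
        assert (0 <= K * (y' - x'))%R by (apply Rmult_le_pos; lra).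
        assert (0 <= / x * (v' - u'))%R by (apply Rmult_le_pos; lra). lra. }
      apply Rle_trans with (2 * (eps / M * (L * l)) * ((K + / x) * l))%R.
      * apply Rmult_le_compat_l; [| assumption].
        assert (0 <= L * l)%R by (apply Rmult_le_pos; lra).
        assert (0 <= eps / M * (L * l))%R by (apply Rmult_le_pos; lra). lra.
      * right. transitivity (eps / M * (2 * L * (K + / x)) * (l * l))%R; [ring |].
        fold M. unfold l. field. lra.
Qed.

(** The sides t = 0 and t = 1 cancel by periodicity. *)
Lemma I_const x : (0 < x <= 1)%R -> I G 1 0 1 = I G x 0 1.
Proof.
  intros Hx. pose proof (goursat x 0 1 Hx Rle_0_1) as H. unfold mu in H.
  assert (E : J G 1 x 1 = J G 0 x 1).
  { unfold J, G, g, c. rewrite e2pi_0, e2pi_1. reflexivity. }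
  rewrite E in H.
  replace (I G 1 0 1) with (I G 1 0 1 - I G x 0 1 - J G 0 x 1 + J G 0 x 1 + I G x 0 1) by ring.
  rewrite H. ring.
Qed.

Lemma ex_CInt_k : ex_CInt k 0 1.
Proof. apply ex_CInt_cont; [lra |]. intros; apply cauchy_rcont_k. Qed.

(** As s tends to 0, f (g s t) tends to [f z0] uniformly in t. *)
Lemma I_value : I G 1 0 1 = f z0 * CInt k 0 1.
Proof.
  assert (E : I G 1 0 1 - f z0 * CInt k 0 1 = 0).
  { apply Cmod_small_eq0. intros eps He.
    pose proof cauchy_K_pos as HK.
    assert (Hc : cont_at f z0) by (apply diff_cont, Hf; lra).
    assert (He' : (0 < eps / (2 * K))%R) by (apply Rdiv_lt_0_compat; lra).
    specialize (Hc _ He'). apply nbhd_Cmod in Hc. destruct Hc as [d [Hd H]].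
    (* |c t| <= 2 r, so this x keeps [g x t] within d of [z0] *)
    set (x := Rmin 1 (d / (4 * r))).
    assert (Hx : (0 < x <= 1)%R).
    { split; [apply Rmin_glb_lt; [lra | apply Rdiv_lt_0_compat; lra] | apply Rmin_l]. }
    assert (Hxr : (x * (2 * r) < d)%R).
    { assert (x <= d / (4 * r))%R by apply Rmin_r.
      apply Rle_lt_trans with (d / (4 * r) * (2 * r))%R;
        [apply Rmult_le_compat_r; lra |].
      replace (d / (4 * r) * (2 * r))%R with (d / 2)%R by (field; lra). lra. }
    rewrite (I_const x Hx), <- CInt_scal by apply ex_CInt_k. unfold I.
    rewrite <- CInt_minus; [| apply ex_CInt_I; [apply side_cont_G | lra | lra] | apply ex_CInt_scal, ex_CInt_k].
    apply Rle_lt_trans with ((1 - 0) * (eps / (2 * K) * K))%R.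
    - apply CInt_bound; [lra | |].
      + apply ex_CInt_minus; [apply ex_CInt_I; [apply side_cont_G | lra | lra] | apply ex_CInt_scal, ex_CInt_k].
      + intros t _. replace (G x t * k t - f z0 * k t) with ((G x t - f z0) * k t) by ring.
        rewrite Cmod_mult. apply Rmult_le_compat; try apply Cmod_ge_0; [| apply cauchy_k_bound].
        left. apply H. unfold g. replace (z0 + RtoC x * c t - z0) with (RtoC x * c t) by ring.
        rewrite Cmod_mult, Cmod_R, Rabs_pos_eq by lra.
        eapply Rle_lt_trans; [apply Rmult_le_compat_l; [lra | apply cauchy_c_upper] | exact Hxr].
    - replace ((1 - 0) * (eps / (2 * K) * K))%R with (eps / 2)%R by (field; lra). lra. }
  replace (I G 1 0 1) with (I G 1 0 1 - f z0 * CInt k 0 1 + f z0 * CInt k 0 1) by ring.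
  rewrite E. ring.
Qed.

Let ratio : C := (z0 - a) / RtoC r.

Lemma ratio_lt_1 : (Cmod ratio < 1)%R.
Proof.
  unfold ratio. rewrite Cmod_div by (apply RtoC_neq_0; lra). rewrite Cmod_R, Rabs_pos_eq by lra.
  apply Rmult_lt_reg_r with r; [exact Hr |]. unfold Rdiv. rewrite Rmult_assoc, Rinv_l; lra.
Qed.

(* the winding form twisted by the character of frequency - N *)
Let kN (N : nat) (t : R) : C := e2pi (RtoC (IZR (- Z.of_nat N)) * RtoC t + 0) * k t.

Lemma rcont_kN N t : rcont_at (kN N) t.
Proof.
  unfold kN, rcont_at. apply tends_mult; [typeclasses eauto | apply rcont_e2pi | apply cauchy_rcont_k].
Qed.

Lemma ex_CInt_kN N : ex_CInt (kN N) 0 1.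
Proof. apply ex_CInt_cont; [lra |]. intros; apply rcont_kN. Qed.

Lemma kN_rec N t : kN N t = twopii * e2pi (RtoC (IZR (- Z.of_nat N)) * RtoC t + 0) + ratio * kN (S N) t.
Proof.
  unfold kN, k. rewrite Nat2Z.inj_succ.
  replace (RtoC (IZR (- Z.succ (Z.of_nat N))) * RtoC t + 0)
    with (RtoC (IZR (- Z.of_nat N)) * RtoC t + 0 + - RtoC t)
    by (rewrite Z.opp_succ, <- Z.sub_1_r, minus_IZR, RtoC_minus; ring).
  rewrite (e2pi_plus _ (- RtoC t)), (e2pi_opp (RtoC t)).
  set (X := e2pi (RtoC (IZR (- Z.of_nat N)) * RtoC t + 0)).
  pose proof (cauchy_c_neq_0 t) as Hc. unfold c in Hc. unfold c', c, ratio.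
  field. repeat split; first [exact Hc | apply e2pi_neq_0 | apply RtoC_neq_0; exact Hr].
Qed.

Lemma CInt_kN_rec N : CInt (kN N) 0 1 =
  twopii * CInt (fun t => e2pi (RtoC (IZR (- Z.of_nat N)) * RtoC t + 0)) 0 1 + ratio * CInt (kN (S N)) 0 1.
Proof.
  assert (HX : ex_CInt (fun t => e2pi (RtoC (IZR (- Z.of_nat N)) * RtoC t + 0)) 0 1).
  { apply ex_CInt_cont; [lra |]. intros; apply rcont_e2pi. }
  rewrite <- !CInt_scal by (exact HX || apply ex_CInt_kN).
  rewrite <- CInt_plus by (apply ex_CInt_scal; (exact HX || apply ex_CInt_kN)).
  apply CInt_ext; [lra |]. intros t _. apply kN_rec.
Qed.

Lemma CInt_kN_bound N : (Cmod (CInt (kN N) 0 1) <= K)%R.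
Proof.
  replace K with ((1 - 0) * K)%R by ring. apply CInt_bound; [lra | apply ex_CInt_kN |].
  intros t _. unfold kN. rewrite Cmod_mult.
  replace (RtoC (IZR (- Z.of_nat N)) * RtoC t + 0) with (RtoC (IZR (- Z.of_nat N) * t))
    by (rewrite RtoC_mult; ring).
  rewrite Cmod_e2pi_R, Rmult_1_l. apply cauchy_k_bound.
Qed.

(** The geometric series in (z0 - a) / r: by [kN_rec] the integral of [kN 1]
    is [ratio ^ N] times a bounded quantity for every N, hence 0, and only
    the constant term of the series contributes. *)
Lemma CInt_k_value : CInt k 0 1 = twopii.
Proof.
  assert (E1 : CInt (kN 1) 0 1 = 0).
  { assert (P : forall N, CInt (kN 1) 0 1 = ratio ^ N * CInt (kN (S N)) 0 1).
    { induction N as [| N IH]; [simpl; ring |].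
      rewrite IH, (CInt_kN_rec (S N)), CInt_e2pi by lia. simpl. ring. }
    apply Cmod_small_eq0. intros eps He. pose proof cauchy_K_pos as HK.
    pose proof ratio_lt_1 as Hzz. pose proof (Cmod_ge_0 ratio) as Hzz0.
    destruct (pow_lt_1_zero (Cmod ratio) ltac:(rewrite Rabs_pos_eq; lra) (eps / (K + 1))
      ltac:(apply Rdiv_lt_0_compat; lra)) as [N HN].
    specialize (HN N (le_n _)). rewrite Rabs_pos_eq in HN by (apply pow_le; lra).
    rewrite (P N), Cmod_mult, Cmod_pow.
    pose proof (CInt_kN_bound (S N)). pose proof (pow_le _ N Hzz0).
    apply Rle_lt_trans with (Cmod ratio ^ N * (K + 1))%R; [apply Rmult_le_compat_l; lra |].
    apply Rmult_lt_compat_r with (r := (K + 1)%R) in HN; [| lra].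
    replace (eps / (K + 1) * (K + 1))%R with eps in HN by (field; lra). exact HN. }
  assert (E0 : CInt k 0 1 = CInt (kN 0) 0 1).
  { apply CInt_ext; [lra |]. intros t _. unfold kN. simpl Z.of_nat.
    replace (RtoC (IZR (- 0)) * RtoC t + 0) with (RtoC 0) by (simpl; ring).
    rewrite e2pi_0. ring. }
  rewrite E0, CInt_kN_rec, E1. simpl Z.of_nat.
  rewrite (CInt_ext _ (fun _ => 1)); [| lra |].
  - rewrite CInt_const, Rminus_0_r. ring.
  - intros t _. replace (RtoC (IZR (- 0)) * RtoC t + 0) with (RtoC 0) by (simpl; ring).
    apply e2pi_0.
Qed.

Lemma rcont_on_circle t : rcont_at (fun t => f (a + RtoC r * e2pi (RtoC t))) t.
Proof.
  apply (rcont_comp f (fun t => a + RtoC r * e2pi (RtoC t))).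
  - unfold rcont_at. pose proof (rcont_e2pi_R t). rcont_tac.
  - apply diff_cont, Hf.
    replace (a + RtoC r * e2pi (RtoC t) - a) with (RtoC r * e2pi (RtoC t)) by ring.
    rewrite Cmod_mult, Cmod_R, Cmod_e2pi_R, Rabs_pos_eq; lra.
Qed.

Lemma rcont_circle_kernel t :
  rcont_at (fun t => f (a + RtoC r * e2pi (RtoC t)) * (RtoC r * e2pi (RtoC t))
                 / (a + RtoC r * e2pi (RtoC t) - z0)) t.
Proof.
  unfold rcont_at, Cdiv. apply tends_mult; [typeclasses eauto | |].
  - apply tends_mult; [typeclasses eauto | apply rcont_on_circle |].
    pose proof (rcont_e2pi_R t). rcont_tac.
  - apply (rcont_inv c); [apply cauchy_rcont_c | apply cauchy_c_neq_0].
Qed.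

Theorem cauchy_formula :
  f z0 = CInt (fun t => f (a + RtoC r * e2pi (RtoC t)) * (RtoC r * e2pi (RtoC t))
                      / (a + RtoC r * e2pi (RtoC t) - z0)) 0 1.
Proof.
  pose proof I_value as H. rewrite CInt_k_value in H.
  assert (E : I G 1 0 1 = twopii * CInt (fun t => f (a + RtoC r * e2pi (RtoC t)) * (RtoC r * e2pi (RtoC t))
                      / (a + RtoC r * e2pi (RtoC t) - z0)) 0 1).
  { unfold I. rewrite <- CInt_scal.
    - apply CInt_ext; [lra |]. intros t _. unfold G, g, k, c', c.
      replace (z0 + 1 * (a + RtoC r * e2pi (RtoC t) - z0)) with (a + RtoC r * e2pi (RtoC t)) by ring.
      field. apply (cauchy_c_neq_0 t).
    - apply ex_CInt_cont; [lra |]. intros t _.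
      apply rcont_circle_kernel. }
  rewrite E in H.
  apply (f_equal (fun x => / twopii * x)) in H.
  rewrite Cmult_assoc, Cinv_l, Cmult_1_l in H by apply twopii_neq_0.
  rewrite H. field. apply twopii_neq_0.
Qed.
End Cauchy.

(** * Consequences of Cauchy's formula *)

Lemma diff_of_quadratic (f : C -> C) (z L : C) (K d : R) :
  (0 < d)%R ->
  (forall w, (Cmod (w - z) < d)%R ->
     (Cmod (f w - f z - L * (w - z)) <= K * (Cmod (w - z) * Cmod (w - z)))%R) ->
  diff_at f z.
Proof.
  intros Hd H. exists L. apply deriv_eps. intros eps He. apply nbhd_Cmod.
  pose proof (Rabs_pos K) as HK. pose proof (Rle_abs K) as HK'.
  assert (He' : (0 < eps / (Rabs K + 1))%R) by (apply Rdiv_lt_0_compat; lra).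
  exists (Rmin d (eps / (Rabs K + 1))). split; [now apply Rmin_glb_lt |].
  intros w Hw. pose proof (Rmin_l d (eps / (Rabs K + 1))).
  pose proof (Rmin_r d (eps / (Rabs K + 1))).
  specialize (H w ltac:(lra)). eapply Rle_trans; [exact H |].
  pose proof (Cmod_ge_0 (w - z)). rewrite <- Rmult_assoc.
  apply Rmult_le_compat_r; [assumption |].
  apply Rle_trans with ((Rabs K + 1) * Cmod (w - z))%R;
    [apply Rmult_le_compat_r; lra |].
  apply Rle_trans with ((Rabs K + 1) * (eps / (Rabs K + 1)))%R;
    [apply Rmult_le_compat_l; lra |].
  right. field. lra.
Qed.

Lemma rcont_bounded (f : R -> C) (a b : R) :
  (forall t, (a <= t <= b)%R -> rcont_at f t) ->
  exists M, forall t, (a <= t <= b)%R -> (Cmod (f t) <= M)%R.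
Proof.
  intros H. destruct (bounded_continuity (V := C_R_NormedModule) f a b) as [M HM].
  - intros t Ht. apply (rcont_continuous f t). now apply H.
  - exists M. intros t Ht. left. rewrite <- norm_C_R. now apply HM.
Qed.

Section Circle.
Variables (f : C -> C) (a : C) (r : R).
Hypothesis Hr : (0 < r)%R.
Hypothesis Hf : forall z, (Cmod (z - a) <= r)%R -> diff_at f z.

Let p (t : R) : C := a + RtoC r * e2pi (RtoC t).

Lemma circle_dist t z : (Cmod (z - a) < r)%R -> (r - Cmod (z - a) <= Cmod (p t - z))%R.
Proof. intros Hz. now apply cauchy_c_lower. Qed.

Lemma circle_neq t z : (Cmod (z - a) < r)%R -> p t - z <> 0.
Proof. intros Hz. apply (cauchy_c_neq_0 a z r Hr Hz t). Qed.

Lemma rcont_circle_inv z t : (Cmod (z - a) < r)%R -> rcont_at (fun t => / (p t - z)) t.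
Proof.
  intros Hz. apply (rcont_inv (fun t => p t - z)); [| now apply circle_neq].
  unfold p, rcont_at. pose proof (rcont_e2pi_R t). rcont_tac.
Qed.

Lemma rcont_f_circle t : rcont_at (fun t => f (p t)) t.
Proof. now apply rcont_on_circle. Qed.

Lemma circle_bounded : exists M, forall t, (0 <= t <= 1)%R -> (Cmod (f (p t)) <= M)%R.
Proof. apply rcont_bounded. intros t _. apply rcont_f_circle. Qed.

Lemma cauchy_estimate (M : R) z :
  (forall t, (0 <= t <= 1)%R -> (Cmod (f (p t)) <= M)%R) -> (Cmod (z - a) < r)%R ->
  (Cmod (f z) <= M * (r / (r - Cmod (z - a))))%R.
Proof.
  intros HM Hz. rewrite (cauchy_formula f a z r Hr Hf Hz).
  assert (HM0 : (0 <= M)%R).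
  { eapply Rle_trans; [apply Cmod_ge_0 | apply (HM 0%R); lra]. }
  eapply Rle_trans.
  - apply CInt_bound with (M := (M * (r / (r - Cmod (z - a))))%R); [lra | |].
    + apply ex_CInt_cont; [lra |]. intros t _. now apply rcont_circle_kernel.
    + intros t Ht. rewrite Cmod_div by now apply circle_neq.
      rewrite !Cmod_mult, Cmod_R, Cmod_e2pi_R, Rmult_1_r, Rabs_pos_eq by lra.
      unfold Rdiv. rewrite Rmult_assoc. apply Rmult_le_compat.
      * apply Cmod_ge_0.
      * apply Rmult_le_pos; [lra |]. left. apply Rinv_0_lt_compat.
        apply Cmod_gt_0. now apply circle_neq.
      * now apply HM.
      * apply Rmult_le_compat_l; [lra |]. apply Rinv_le_contravar; [lra |].
        now apply circle_dist.
  - lra.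
Qed.

(* the Cauchy transform, up to a constant factor the integral of f dp / ((p - a) (p - z)) *)
Let g (z : C) : C := CInt (fun t => f (p t) * / (p t - z)) 0 1.

Lemma cauchy_transform_cont z t : (Cmod (z - a) < r)%R -> rcont_at (fun t => f (p t) * / (p t - z)) t.
Proof.
  intros Hz. unfold rcont_at. apply tends_mult; [typeclasses eauto | apply rcont_f_circle |].
  now apply rcont_circle_inv.
Qed.

Lemma cauchy_transform_ex_CInt z : (Cmod (z - a) < r)%R -> ex_CInt (fun t => f (p t) * / (p t - z)) 0 1.
Proof. intros Hz. apply ex_CInt_cont; [lra |]. intros t _. now apply cauchy_transform_cont. Qed.

(** Under the integral sign, p / (p - z) - 1 = z / (p - z) for a circle
    centred at 0. *)
Lemma cauchy_transform_divides z : (Cmod (z - a) < r)%R -> f z = f a + (z - a) * g z.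
Proof.
  intros Hz.
  assert (Ha : (Cmod (a - a) < r)%R).
  { replace (a - a) with (RtoC 0) by ring. rewrite Cmod_0. exact Hr. }
  rewrite (cauchy_formula f a z r Hr Hf Hz), (cauchy_formula f a a r Hr Hf Ha).
  unfold g. rewrite <- CInt_scal by now apply cauchy_transform_ex_CInt.
  rewrite <- CInt_plus.
  - apply CInt_ext; [lra |]. intros t _. fold (p t).
    pose proof (circle_neq t z Hz) as H1. pose proof (circle_neq t a Ha) as H2.
    replace (RtoC r * e2pi (RtoC t)) with (p t - a) by (unfold p; ring). field. now split.
  - apply ex_CInt_cont; [lra |]. intros t _. now apply rcont_circle_kernel.
  - apply ex_CInt_scal. now apply cauchy_transform_ex_CInt.
Qed.

(** Differentiation under the integral sign, with the exact second-order
    remainder (w - z)^2 / ((p - w) (p - z)^2) of the kernel. *)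
Lemma cauchy_transform_diff z : (Cmod (z - a) < r)%R -> diff_at g z.
Proof.
  intros Hz. destruct circle_bounded as [M HM].
  set (d := ((r - Cmod (z - a)) / 2)%R).
  assert (Hd : (0 < d)%R) by (unfold d; lra).
  set (L := CInt (fun t => f (p t) * (/ (p t - z) * / (p t - z))) 0 1).
  assert (HL : ex_CInt (fun t => f (p t) * (/ (p t - z) * / (p t - z))) 0 1).
  { apply ex_CInt_cont; [lra |]. intros t _. unfold rcont_at.
    apply tends_mult; [typeclasses eauto | apply rcont_f_circle |].
    apply tends_mult; [typeclasses eauto | |]; now apply rcont_circle_inv. }
  apply (diff_of_quadratic g z L (M * (/ d * (/ d * / d))) d Hd).
  intros w Hw.
  assert (Hwa : (Cmod (w - a) < r - d)%R).
  { pose proof (Cmod_le_triangle w z a). unfold d in *. lra. }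
  assert (HC : ex_CInt (fun t => f (p t) * / (p t - w) - f (p t) * / (p t - z)) 0 1).
  { apply ex_CInt_minus; apply cauchy_transform_ex_CInt; lra. }
  assert (HC2 : ex_CInt (fun t => (w - z) * (f (p t) * (/ (p t - z) * / (p t - z)))) 0 1)
    by now apply ex_CInt_scal.
  replace (g w - g z - L * (w - z))
    with (CInt (fun t => f (p t) * / (p t - w) - f (p t) * / (p t - z)
               - (w - z) * (f (p t) * (/ (p t - z) * / (p t - z)))) 0 1).
  - eapply Rle_trans.
    + apply CInt_bound with
        (M := (M * (/ d * (/ d * / d)) * (Cmod (w - z) * Cmod (w - z)))%R); [lra | |].
      * now apply ex_CInt_minus.
      * intros t Ht.
        assert (Hwr : (Cmod (w - a) < r)%R) by lra.
        pose proof (circle_neq t z Hz) as H1. pose proof (circle_neq t w Hwr) as H2.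
        replace (f (p t) * / (p t - w) - f (p t) * / (p t - z)
               - (w - z) * (f (p t) * (/ (p t - z) * / (p t - z))))
          with (f (p t) * (/ (p t - w) * (/ (p t - z) * / (p t - z))) * ((w - z) * (w - z)))
          by (field; now split).
        rewrite !Cmod_mult, !Cmod_inv by assumption.
        pose proof (circle_dist t z Hz). pose proof (circle_dist t w Hwr).
        assert (B1 : (/ Cmod (p t - z) <= / d)%R)
          by (apply Rinv_le_contravar; [exact Hd | unfold d; lra]).
        assert (B2 : (/ Cmod (p t - w) <= / d)%R)
          by (apply Rinv_le_contravar; [exact Hd | lra]).
        assert (B3 : (0 < / Cmod (p t - z))%R) by (apply Rinv_0_lt_compat; lra).
        assert (B4 : (0 < / Cmod (p t - w))%R) by (apply Rinv_0_lt_compat; lra).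
        pose proof (Cmod_ge_0 (w - z)).
        apply Rmult_le_compat_r; [now apply Rmult_le_pos |].
        apply Rmult_le_compat; [apply Cmod_ge_0 | | now apply HM |].
        { repeat apply Rmult_le_pos; lra. }
        apply Rmult_le_compat; [lra | repeat apply Rmult_le_pos; lra | exact B2 |].
        apply Rmult_le_compat; lra.
    + lra.
  - rewrite CInt_minus by assumption.
    rewrite CInt_minus by (apply cauchy_transform_ex_CInt; lra).
    rewrite CInt_scal by exact HL. unfold g, L. ring.
Qed.
End Circle.

(** Away from [a] the quotient is differentiable by the rules of calculus,
    and near [a] it is the Cauchy transform of f. Repeated division takes the
    place of power series. *)
Lemma divide (f : C -> C) (a : C) (rho : R) : (0 < rho)%R ->
  (forall z, (Cmod (z - a) < rho)%R -> diff_at f z) ->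
  exists g, (forall z, diff_at f z -> diff_at g z) /\ (forall z, f z = f a + (z - a) * g z).
Proof.
  intros Hrho Hf. set (r := (rho / 2)%R).
  assert (Hr : (0 < r)%R) by (unfold r; lra).
  assert (Hf' : forall z, (Cmod (z - a) <= r)%R -> diff_at f z).
  { intros z Hz. apply Hf. unfold r in Hz. lra. }
  set (g0 := fun z => CInt (fun t => f (a + RtoC r * e2pi (RtoC t)) *
                            / (a + RtoC r * e2pi (RtoC t) - z)) 0 1).
  set (g := fun z => if Ceq_dec z a then g0 a else (f z - f a) / (z - a)).
  assert (Hg : forall z, f z = f a + (z - a) * g z).
  { intros z. unfold g. destruct (Ceq_dec z a) as [-> | Hne]; [ring |].
    field. intros E. apply Hne. replace z with (z - a + a) by ring. rewrite E. ring. }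
  exists g. split; [| exact Hg].
  intros z Hz. destruct (Ceq_dec z a) as [-> | Hne].
  - apply (diff_ext_loc g0).
    + apply nbhd_Cmod. exists r. split; [exact Hr |]. intros w Hw.
      unfold g. destruct (Ceq_dec w a) as [-> | Hwa]; [reflexivity |].
      rewrite (cauchy_transform_divides f a r Hr Hf' w Hw). unfold g0.
      field. intros E. apply Hwa. replace w with (w - a + a) by ring. rewrite E. ring.
    + apply cauchy_transform_diff; try assumption.
      replace (a - a) with (RtoC 0) by ring. now rewrite Cmod_0.
  - assert (Hza : z - a <> 0).
    { intros E. apply Hne. replace z with (z - a + a) by ring. rewrite E. ring. }
    apply (diff_ext_loc (fun w => (f w - f a) * / (w - a))).
    + apply nbhd_Cmod. exists (Cmod (z - a)). split; [now apply Cmod_pos |].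
      intros w Hw. unfold g. destruct (Ceq_dec w a) as [-> | _]; [| reflexivity].
      rewrite Cmod_minus_sym in Hw. lra.
    + apply diff_mult.
      * apply diff_minus; [exact Hz | apply diff_const].
      * apply diff_inv; [diff_tac | exact Hza].
Qed.

(** Division by z - a can be repeated forever, since each quotient vanishes
    at [a] by continuity. On the circle of radius r the N-th quotient is at
    most M / r^N, so |h z| is at most (|z - a| / r)^N times a constant for
    all N. *)
Lemma vanish_of_clustering_zeros (h : C -> C) (a : C) (rho : R) : (0 < rho)%R ->
  (forall z, (Cmod (z - a) < rho)%R -> diff_at h z) ->
  (forall eps, (0 < eps)%R -> exists z, z <> a /\ (Cmod (z - a) < eps)%R /\ h z = 0) ->
  forall z, (Cmod (z - a) < rho / 2)%R -> h z = 0.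
Proof.
  intros Hrho Hh Hz0.
  assert (HN : forall N : nat, exists g, (forall z, (Cmod (z - a) < rho)%R -> diff_at g z) /\
                   forall z, h z = (z - a) ^ N * g z).
  { induction N as [| N [g [Hg Eg]]].
    - exists h. split; [exact Hh |]. intros z. simpl. ring.
    - assert (Ega : g a = 0).
      { apply Cmod_small_eq0. intros eps He.
        assert (Hc : cont_at g a).
        { apply diff_cont, Hg. replace (a - a) with (RtoC 0) by ring. now rewrite Cmod_0. }
        specialize (Hc eps He). apply nbhd_Cmod in Hc. destruct Hc as [d [Hd Hc]].
        destruct (Hz0 d Hd) as [z [Hza [Hzd Hz]]].
        specialize (Hc z Hzd). rewrite Eg in Hz.
        assert (Hpow : (z - a) ^ N <> 0).
        { apply Cpow_nz. intros E. apply Hza. replace z with (z - a + a) by ring.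
          rewrite E. ring. }
        assert (Ez : g z = 0).
        { replace (g z) with (/ (z - a) ^ N * ((z - a) ^ N * g z)) by (field; exact Hpow).
          rewrite Hz. ring. }
        rewrite Ez in Hc. replace (0 - g a) with (- g a) in Hc by ring.
        now rewrite Cmod_opp in Hc. }
      destruct (divide g a rho Hrho Hg) as [g' [Hg' Eg']].
      exists g'. split; [auto |]. intros z. rewrite Eg, Eg', Ega. simpl. ring. }
  set (r := (rho / 2)%R).
  assert (Hr : (0 < r)%R) by (unfold r; lra).
  intros z Hz. fold r in Hz.
  destruct (circle_bounded h a r Hr) as [M HM].
  { intros w Hw. apply Hh. unfold r in Hw. lra. }
  assert (HM0 : (0 <= M)%R).
  { eapply Rle_trans; [apply Cmod_ge_0 | apply (HM 0%R); lra]. }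
  set (q := (Cmod (z - a) / r)%R).
  assert (Hq : (0 <= q < 1)%R).
  { pose proof (Cmod_ge_0 (z - a)). unfold q. split; [apply Rdiv_le_0_compat; lra |].
    apply Rmult_lt_reg_r with r; [exact Hr |]. unfold Rdiv.
    rewrite Rmult_assoc, Rinv_l; lra. }
  set (B := (M * (r / (r - Cmod (z - a))))%R).
  assert (HB0 : (0 <= B)%R).
  { unfold B. apply Rmult_le_pos; [exact HM0 |]. apply Rdiv_le_0_compat; lra. }
  assert (HB : forall N, (Cmod (h z) <= q ^ N * B)%R).
  { intros N. destruct (HN N) as [g [Hg Eg]].
    assert (HrN : (0 < r ^ N)%R) by now apply pow_lt.
    assert (Hgb : (Cmod (g z) <= M / r ^ N * (r / (r - Cmod (z - a))))%R).
    { apply (cauchy_estimate g a r Hr).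
      - intros w Hw. apply Hg. unfold r in Hw. lra.
      - intros t Ht. specialize (HM t Ht). rewrite Eg in HM.
        replace (a + RtoC r * e2pi (RtoC t) - a) with (RtoC r * e2pi (RtoC t)) in HM by ring.
        rewrite Cmod_mult, Cmod_pow, Cmod_mult, Cmod_R, Cmod_e2pi_R, Rmult_1_r,
          Rabs_pos_eq in HM by lra.
        apply Rmult_le_reg_l with (r ^ N)%R; [exact HrN |].
        replace (r ^ N * (M / r ^ N))%R with M by (field; lra). exact HM.
      - exact Hz. }
    rewrite Eg, Cmod_mult, Cmod_pow. unfold q, B.
    eapply Rle_trans;
      [apply Rmult_le_compat_l; [apply pow_le, Cmod_ge_0 | exact Hgb] |].
    right. unfold Rdiv. rewrite Rpow_mult_distr, pow_inv. ring. }
  apply Cmod_small_eq0. intros eps He.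
  destruct (pow_lt_1_zero q ltac:(rewrite Rabs_pos_eq; lra) (eps / (B + 1))
    ltac:(apply Rdiv_lt_0_compat; lra)) as [N HNN].
  specialize (HNN N (le_n _)). rewrite Rabs_pos_eq in HNN by (apply pow_le; lra).
  eapply Rle_lt_trans; [apply (HB N) |].
  apply Rle_lt_trans with (q ^ N * (B + 1))%R.
  - apply Rmult_le_compat_l; [apply pow_le; lra | lra].
  - apply Rmult_lt_compat_r with (r := (B + 1)%R) in HNN; [| lra].
    replace (eps / (B + 1) * (B + 1))%R with eps in HNN by (field; lra). exact HNN.
Qed.

Lemma entire_bounded_disk (f : C -> C) (r : R) : (0 < r)%R -> (forall z, diff_at f z) ->
  exists M, (0 <= M)%R /\ forall z, (Cmod z <= r)%R -> (Cmod (f z) <= M)%R.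
Proof.
  intros Hr Hf.
  destruct (circle_bounded f 0 (2 * r)) as [M HM]; [lra | intros; apply Hf |].
  assert (HM0 : (0 <= M)%R).
  { eapply Rle_trans; [apply Cmod_ge_0 | apply (HM 0%R); lra]. }
  exists (M * 2)%R. split; [lra |]. intros z Hz.
  assert (E : Cmod (z - 0) = Cmod z) by (f_equal; ring).
  eapply Rle_trans.
  - apply (cauchy_estimate f 0 (2 * r)) with (M := M); try lra; [intros; apply Hf | exact HM].
  - rewrite E. apply Rmult_le_compat_l; [exact HM0 |].
    apply Rmult_le_reg_r with (2 * r - Cmod z)%R; [lra |].
    unfold Rdiv. rewrite Rmult_assoc, Rinv_l; lra.
Qed.

(** The difference quotient at 0 is at most 2 M / r on the circle of radius
    r. *)
Lemma liouville (g : C -> C) (M : R) : (forall z, diff_at g z) ->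
  (forall z, (Cmod (g z) <= M)%R) -> forall z, g z = g 0.
Proof.
  intros Hg HM z. destruct (divide g 0 1 Rlt_0_1) as [h [Hh Eh]]; [auto |].
  assert (HM0 : (0 <= M)%R) by (eapply Rle_trans; [apply Cmod_ge_0 | apply (HM 0)]).
  assert (E : h z = 0).
  { apply Cmod_small_eq0. intros eps He.
    assert (HMe : (0 <= 4 * M / eps)%R) by (apply Rdiv_le_0_compat; lra).
    (* large enough for the Cauchy estimate 2 M / (r - |z|) to fall below eps *)
    set (r := (2 * Cmod z + 4 * M / eps + 1)%R).
    pose proof (Cmod_ge_0 z) as Hz0.
    assert (Hr : (0 < r)%R) by (unfold r; lra).
    assert (Ez : Cmod (z - 0) = Cmod z) by (f_equal; ring).
    assert (B : (Cmod (h z) <= 2 * M / r * (r / (r - Cmod (z - 0))))%R).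
    { apply (cauchy_estimate h 0 r Hr); [auto | | rewrite Ez; unfold r; lra].
      intros t _. set (w := 0 + RtoC r * e2pi (RtoC t)).
      assert (Hw : Cmod w = r).
      { unfold w. rewrite Cplus_0_l, Cmod_mult, Cmod_R, Cmod_e2pi_R, Rabs_pos_eq; lra. }
      assert (Hw0 : w <> 0) by (apply Cmod_gt_0; lra).
      replace (h w) with ((g w - g 0) / w) by (rewrite (Eh w); field; exact Hw0).
      rewrite Cmod_div by exact Hw0. rewrite Hw. unfold Rdiv.
      apply Rmult_le_compat_r; [left; now apply Rinv_0_lt_compat |].
      unfold Cminus. eapply Rle_trans; [apply Cmod_triangle |]. rewrite Cmod_opp.
      pose proof (HM w). pose proof (HM 0). lra. }
    rewrite Ez in B. eapply Rle_lt_trans; [exact B |].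
    assert (Hd : (0 < r - Cmod z)%R) by (unfold r; lra).
    replace (2 * M / r * (r / (r - Cmod z)))%R with (2 * M / (r - Cmod z))%R
      by (field; split; lra).
    apply Rmult_lt_reg_r with (r - Cmod z)%R; [exact Hd |].
    unfold Rdiv. rewrite Rmult_assoc, Rinv_l, Rmult_1_r by lra.
    assert (eps * (4 * M / eps) = 4 * M)%R by (field; lra).
    unfold r. nra. }
  rewrite Eh, E. ring.
Qed.

(** The difference quotient at 0 is a bounded entire function. *)
Lemma liouville_linear (f : C -> C) (A B : R) : (0 <= A)%R -> (0 <= B)%R ->
  (forall z, diff_at f z) ->
  (forall z, (Cmod (f z) <= A + B * Cmod z)%R) -> exists b, forall z, f z = f 0 + b * z.
Proof.
  intros HA HB Hf HM. destruct (divide f 0 1 Rlt_0_1) as [g [Hg Eg]]; [auto |].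
  destruct (entire_bounded_disk g 1 Rlt_0_1) as [M [HM0 HM1]]; [auto |].
  exists (g 0). intros z.
  assert (E : g z = g 0).
  { apply (liouville g (M + (A + B + Cmod (f 0)))); [auto |]. intros w.
    pose proof (Cmod_ge_0 (f 0)).
    destruct (Rle_dec (Cmod w) 1) as [Hw | Hw]; [specialize (HM1 w Hw); lra |].
    assert (Hw0 : w <> 0) by (apply Cmod_gt_0; lra).
    replace (g w) with ((f w - f 0) / w) by (rewrite (Eg w); field; exact Hw0).
    rewrite Cmod_div by exact Hw0.
    apply Rle_trans with (A + B + Cmod (f 0))%R; [| lra].
    apply Rmult_le_reg_r with (Cmod w); [lra |].
    unfold Rdiv. rewrite Rmult_assoc, Rinv_l, Rmult_1_r by lra.
    unfold Cminus. eapply Rle_trans; [apply Cmod_triangle |]. rewrite Cmod_opp.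
    specialize (HM w). nra. }
  rewrite (Eg z), E. ring.
Qed.

Lemma quasi_periodic_shift (f : C -> C) (s c : C) : (forall x, f (x + s) = f x + c) ->
  forall (k : Z) x, f (x + RtoC (IZR k) * s) = f x + RtoC (IZR k) * c.
Proof.
  intros H k x. induction k as [| k IH | k IH] using Z.peano_ind.
  - simpl. replace (x + 0 * s) with x by ring. ring.
  - rewrite succ_IZR, RtoC_plus.
    replace (x + (RtoC (IZR k) + 1) * s) with (x + RtoC (IZR k) * s + s) by ring.
    rewrite H, IH. ring.
  - rewrite <- Z.sub_1_r, minus_IZR, RtoC_minus.
    pose proof (H (x + (RtoC (IZR k) - 1) * s)) as E.
    replace (x + (RtoC (IZR k) - 1) * s + s) with (x + RtoC (IZR k) * s) in E by ring.
    rewrite IH in E.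
    transitivity (f (x + (RtoC (IZR k) - 1) * s) + c - c); [ring |]. rewrite <- E. ring.
Qed.

(** On a fundamental parallelogram f is bounded, and the number of periods
    needed to reach it from z is O(|z|); so f grows at most linearly. *)
Lemma entire_quasi_periodic_affine (tau : C) (f : C -> C) (c1 c2 : C) : (0 < Im tau)%R ->
  (forall z, diff_at f z) -> (forall x, f (x + 1) = f x + c1) ->
  (forall x, f (x + tau) = f x + c2) -> exists b, forall z, f z = f 0 + b * z.
Proof.
  intros Ht Hf H1 H2.
  pose proof (Cmod_ge_0 tau) as Hct. pose proof (Cmod_ge_0 c1). pose proof (Cmod_ge_0 c2).
  destruct (entire_bounded_disk f (1 + Cmod tau)) as [M [HM0 HM]]; [lra | exact Hf |].
  set (T := Im tau) in *.
  assert (HTi : (0 < / T)%R) by now apply Rinv_0_lt_compat.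
  set (B2 := (/ T * Cmod c2)%R). set (B1 := ((1 + / T * Cmod tau) * Cmod c1)%R).
  assert (0 <= B2)%R by (apply Rmult_le_pos; lra).
  assert (Htt : (0 <= / T * Cmod tau)%R) by (apply Rmult_le_pos; lra).
  assert (0 <= B1)%R by (apply Rmult_le_pos; lra).
  apply (liouville_linear f (M + 2 * Cmod c1 + 2 * Cmod c2) (B1 + B2)); try lra; try exact Hf.
  intros z.
  set (y := (Im z / T)%R). set (x := (Re z - y * Re tau)%R).
  assert (Ez : z = RtoC x + RtoC y * tau).
  { destruct z as [z1 z2], tau as [t1 t2]. unfold x, y, T, RtoC, Cplus, Cmult, Re, Im in *.
    simpl in *. f_equal; field; lra. }
  set (n := Int_part y). set (m := Int_part x).
  destruct (base_Int_part y) as [Hy1 Hy2]. destruct (base_Int_part x) as [Hx1 Hx2].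
  fold n in Hy1, Hy2. fold m in Hx1, Hx2.
  set (z' := RtoC (x - IZR m) + RtoC (y - IZR n) * tau).
  assert (Ez' : z = z' + RtoC (IZR m) * 1 + RtoC (IZR n) * tau).
  { unfold z'. rewrite !RtoC_minus, Ez at 1. ring. }
  assert (Ef : f z = f z' + RtoC (IZR m) * c1 + RtoC (IZR n) * c2).
  { rewrite Ez' at 1. rewrite (quasi_periodic_shift f tau c2) by exact H2.
    rewrite (quasi_periodic_shift f 1 c1) by exact H1. reflexivity. }
  assert (Hz' : (Cmod z' <= 1 + Cmod tau)%R).
  { unfold z'. eapply Rle_trans; [apply Cmod_triangle |].
    rewrite Cmod_mult, !Cmod_R, !Rabs_pos_eq by lra. nra. }
  assert (HIm : (Rabs (Im z) <= Cmod z)%R).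
  { eapply Rle_trans; [apply Rmax_r | apply (Rmax_Cmod z)]. }
  assert (Hy : (Rabs y <= / T * Cmod z)%R).
  { unfold y, Rdiv. rewrite Rabs_mult, (Rabs_pos_eq (/ T)) by lra. rewrite Rmult_comm.
    apply Rmult_le_compat_l; lra. }
  assert (Hx : (Rabs x <= (1 + / T * Cmod tau) * Cmod z)%R).
  { unfold x. unfold Rminus. eapply Rle_trans; [apply Rabs_triang |].
    rewrite Rabs_Ropp, Rabs_mult. pose proof (re_le_Cmod z). pose proof (re_le_Cmod tau).
    pose proof (Rabs_pos y). pose proof (Rabs_pos (Re tau)).
    assert (Rabs y * Rabs (Re tau) <= (/ T * Cmod z) * Cmod tau)%R
      by (apply Rmult_le_compat; lra). lra. }
  assert (Hn : (Rabs (IZR n) <= Rabs y + 1)%R).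
  { pose proof (Rle_abs y). pose proof (Rle_abs (- y)). rewrite Rabs_Ropp in *.
    apply Rabs_le. lra. }
  assert (Hm : (Rabs (IZR m) <= Rabs x + 1)%R).
  { pose proof (Rle_abs x). pose proof (Rle_abs (- x)). rewrite Rabs_Ropp in *.
    apply Rabs_le. lra. }
  rewrite Ef. eapply Rle_trans; [apply Cmod_triangle |].
  eapply Rle_trans; [apply Rplus_le_compat_r, Cmod_triangle |].
  rewrite !Cmod_mult, !Cmod_R. specialize (HM z' Hz').
  assert (Rabs (IZR m) * Cmod c1 <= ((1 + / T * Cmod tau) * Cmod z + 1) * Cmod c1)%R
    by (apply Rmult_le_compat_r; lra).
  assert (Rabs (IZR n) * Cmod c2 <= (/ T * Cmod z + 1) * Cmod c2)%R
    by (apply Rmult_le_compat_r; lra).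
  unfold B1, B2. nra.
Qed.

(** * Identity theorem for meromorphic functions *)

(** Here [h z0 = 0] is allowed: differences then need only a common
    denominator, and no zeros have to be divided out. *)
Definition merom_at (F : C -> C) (z0 : C) : Prop :=
  exists (N : nat) (h : C -> C), nbhd z0 (diff_at h) /\ nbhd' z0 (fun z => F z = h z / (z - z0) ^ N).

Lemma Cminus_neq_0 (z a : C) : z <> a -> z - a <> 0.
Proof. intros H E. apply H. replace z with (z - a + a) by ring. rewrite E. ring. Qed.

Lemma merom_at_vanish (F : C -> C) (z0 : C) : merom_at F z0 ->
  (forall eps, (0 < eps)%R -> exists z, z <> z0 /\ (Cmod (z - z0) < eps)%R /\ F z = 0) ->
  nbhd' z0 (fun z => F z = 0).
Proof.
  intros [N [h [Hh HF]]] H0. apply nbhd_Cmod in Hh. destruct Hh as [d1 [Hd1 Hh]].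
  apply nbhd'_Cmod in HF. destruct HF as [d2 [Hd2 HF]].
  assert (Z : forall z, (Cmod (z - z0) < d1 / 2)%R -> h z = 0).
  { apply (vanish_of_clustering_zeros h z0 d1 Hd1 Hh). intros eps He.
    destruct (H0 (Rmin eps d2)) as [z [Hz [Hd Hz0]]]; [now apply Rmin_glb_lt |].
    pose proof (Rmin_l eps d2). pose proof (Rmin_r eps d2).
    exists z. split; [exact Hz |]. split; [lra |].
    rewrite (HF z ltac:(lra) Hz) in Hz0.
    assert (Hp : (z - z0) ^ N <> 0) by now apply Cpow_nz, Cminus_neq_0.
    replace (h z) with (h z / (z - z0) ^ N * (z - z0) ^ N) by (field; exact Hp).
    rewrite Hz0. ring. }
  apply nbhd'_Cmod. exists (Rmin (d1 / 2) d2). split; [apply Rmin_glb_lt; lra |].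
  intros z Hz Hne. pose proof (Rmin_l (d1 / 2) d2). pose proof (Rmin_r (d1 / 2) d2).
  rewrite (HF z ltac:(lra) Hne), (Z z ltac:(lra)). unfold Cdiv. ring.
Qed.

Lemma merom_at_minus (F G : C -> C) (z0 : C) :
  merom_at F z0 -> merom_at G z0 -> merom_at (fun z => F z - G z) z0.
Proof.
  intros [N [h [Hh HF]]] [M [k [Hk HG]]].
  exists (N + M)%nat, (fun z => h z * (z - z0) ^ M - k z * (z - z0) ^ N). split.
  - generalize (filter_and _ _ Hh Hk). apply filter_imp. intros z [H1 H2]. diff_tac.
  - assert (Hne : nbhd' z0 (fun z => z <> z0)) by (apply nbhd'_Cmod; exists 1%R; split; [lra | auto]).
    generalize (filter_and _ _ Hne (filter_and _ _ HF HG)). apply filter_imp.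
    intros z [Hz [-> ->]]. rewrite Cpow_add_r. apply Cminus_neq_0 in Hz. field.
    split; now apply Cpow_nz.
Qed.

(** The set of points of the segment from p to q near which F vanishes is
    open and closed in it. All neighbourhoods are punctured, so poles on the
    segment are harmless. *)
Lemma merom_at_identity (F : C -> C) (p q : C) : (forall z, merom_at F z) ->
  nbhd' p (fun z => F z = 0) -> nbhd' q (fun z => F z = 0).
Proof.
  intros HM Hp. destruct (Ceq_dec p q) as [-> | Hpq]; [exact Hp |].
  set (ga := fun t : R => p + RtoC t * (q - p)).
  assert (Hl : (0 < Cmod (q - p))%R) by (apply Cmod_pos, Cminus_neq_0; congruence).
  set (l := Cmod (q - p)) in *.
  assert (Hga : forall s t, Cmod (ga s - ga t) = (Rabs (s - t) * l)%R).
  { intros s t. unfold ga. replace (p + RtoC s * (q - p) - (p + RtoC t * (q - p)))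
      with (RtoC (s - t) * (q - p)) by (rewrite RtoC_minus; ring).
    now rewrite Cmod_mult, Cmod_R. }
  assert (Hinj : forall s t, s <> t -> ga s <> ga t).
  { intros s t Hst E. assert (H : Cmod (ga s - ga t) = 0%R).
    { rewrite E. replace (ga t - ga t) with (RtoC 0) by ring. apply Cmod_0. }
    rewrite Hga in H. apply Rmult_integral in H. destruct H as [H | H]; [| lra].
    revert H. apply Rabs_no_R0. lra. }
  set (P := fun t => nbhd' (ga t) (fun z => F z = 0)).
  assert (P0 : P 0%R).
  { unfold P. replace (ga 0%R) with p by (unfold ga; ring). exact Hp. }
  (* openness to the right *)
  assert (Hopen : forall t, P t -> exists e, (0 < e)%R /\ forall s, (t <= s < t + e)%R -> P s).
  { intros t Pt. pose proof (nbhd'_nbhd _ _ Pt) as H. apply nbhd'_Cmod in H.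
    destruct H as [d [Hd H]]. exists (d / l)%R. split; [now apply Rdiv_lt_0_compat |].
    intros s Hs. destruct (Req_dec s t) as [-> | Hst]; [exact Pt |].
    apply nbhd_nbhd'. apply H; [| now apply Hinj].
    rewrite Hga, Rabs_pos_eq by lra.
    apply Rlt_le_trans with (d / l * l)%R; [apply Rmult_lt_compat_r; lra |].
    right. field. lra. }
  set (E := fun t => (0 <= t <= 1)%R /\ forall s, (0 <= s <= t)%R -> P s).
  destruct (completeness E) as [T [HT1 HT2]].
  { exists 1%R. intros t [Ht _]. lra. }
  { exists 0%R. split; [lra |]. intros s Hs. replace s with 0%R by lra. exact P0. }
  assert (HT0 : (0 <= T <= 1)%R).
  { split.
    - apply HT1. split; [lra |]. intros s Hs. replace s with 0%R by lra. exact P0.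
    - apply HT2. intros t [Ht _]. lra. }
  assert (Hbelow : forall s, (0 <= s < T)%R -> P s).
  { intros s Hs. destruct (Classical_Prop.classic (exists t, E t /\ (s < t)%R)) as [[t [[_ Ht] Hst]] | Hn].
    - apply Ht. lra.
    - exfalso. assert (T <= s)%R; [| lra]. apply HT2. intros t Ht.
      apply Rnot_lt_le. intros Hlt. apply Hn. now exists t. }
  (* closedness: zeros cluster at the point with parameter T *)
  assert (PT : P T).
  { destruct (Req_dec T 0) as [-> | HTne]; [exact P0 |].
    apply merom_at_vanish; [apply HM |]. intros eps He.
    set (d := Rmin (T / 2) (eps / (2 * l))).
    assert (Hd : (0 < d)%R).
    { apply Rmin_glb_lt; [lra | apply Rdiv_lt_0_compat; lra]. }
    assert (Hd1 : (d <= T / 2)%R) by apply Rmin_l.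
    assert (Hd2 : (d <= eps / (2 * l))%R) by apply Rmin_r.
    assert (Ps : P (T - d)%R) by (apply Hbelow; lra).
    apply nbhd'_Cmod in Ps. destruct Ps as [e [He' Hs]].
    set (e2 := (Rmin (e / l) d / 2)%R).
    assert (Hmin : (0 < Rmin (e / l) d)%R).
    { apply Rmin_glb_lt; [now apply Rdiv_lt_0_compat | exact Hd]. }
    pose proof (Rmin_l (e / l) d). pose proof (Rmin_r (e / l) d).
    exists (ga (T - d + e2)%R). split; [| split].
    - apply Hinj. unfold e2. lra.
    - rewrite Hga, Rabs_left1 by (unfold e2; lra).
      apply Rlt_le_trans with (eps / l * l)%R; [| right; field; lra].
      apply Rmult_lt_compat_r; [exact Hl |].
      assert (eps / (2 * l) < eps / l)%R; [| unfold e2; lra].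
      replace (eps / (2 * l))%R with (eps / l / 2)%R by (field; lra).
      assert (0 < eps / l)%R by now apply Rdiv_lt_0_compat. lra.
    - apply Hs; [| apply Hinj; unfold e2; lra].
      rewrite Hga, Rabs_pos_eq by (unfold e2; lra).
      apply Rlt_le_trans with (e / l * l)%R; [| right; field; lra].
      apply Rmult_lt_compat_r; [exact Hl |]. unfold e2. lra. }
  assert (T1 : T = 1%R).
  { apply Rle_antisym; [lra |]. apply Rnot_lt_le. intros Hlt.
    destruct (Hopen T PT) as [e [He Hs]].
    set (t := (T + Rmin (e / 2) (1 - T))%R).
    assert (0 < Rmin (e / 2) (1 - T))%R by (apply Rmin_glb_lt; lra).
    pose proof (Rmin_l (e / 2) (1 - T)). pose proof (Rmin_r (e / 2) (1 - T)).
    assert (E t).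
    { split; [unfold t; lra |]. intros s Hst.
      destruct (Rlt_le_dec s T); [apply Hbelow; lra |]. apply Hs. unfold t in Hst. lra. }
    assert (t <= T)%R by now apply HT1. unfold t in *. lra. }
  unfold P in PT. rewrite T1 in PT.
  replace (ga 1%R) with q in PT by (unfold ga; ring). exact PT.
Qed.

(** * Poles of order at most one *)

(** A principal part of order at most one, where [r = 0] stands for a
    removable singularity. Unlike the order of a pole, this is additive in f. *)
Definition simple_pole (f : C -> C) (z0 r : C) : Prop :=
  exists h, nbhd z0 (diff_at h) /\ nbhd' z0 (fun z => f z = r / (z - z0) + h z).

Lemma nbhd'_ne (z0 : C) : nbhd' z0 (fun z => z <> z0).
Proof. apply nbhd'_Cmod. exists 1%R. split; [lra | auto]. Qed.

Lemma filter_and3 {T} (F : (T -> Prop) -> Prop) {FF : Filter F} (P Q R S : T -> Prop) :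
  F P -> F Q -> F R -> (forall x, P x -> Q x -> R x -> S x) -> F S.
Proof.
  intros HP HQ HR H. generalize (filter_and _ _ HP (filter_and _ _ HQ HR)).
  apply filter_imp. intros x [? [? ?]]. now apply H.
Qed.

Lemma filter_and2 {T} (F : (T -> Prop) -> Prop) {FF : Filter F} (P Q S : T -> Prop) :
  F P -> F Q -> (forall x, P x -> Q x -> S x) -> F S.
Proof.
  intros HP HQ H. generalize (filter_and _ _ HP HQ).
  apply filter_imp. intros x [? ?]. now apply H.
Qed.

Lemma simple_pole_ext_loc f g z0 r : nbhd' z0 (fun z => f z = g z) -> simple_pole f z0 r -> simple_pole g z0 r.
Proof.
  intros E [h [Hh Hf]]. exists h. split; [exact Hh |].
  apply (filter_and2 _ _ _ _ E Hf). intros z <-. auto.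
Qed.

Lemma simple_pole_eq f z0 (r s : C) : simple_pole f z0 r -> r = s -> simple_pole f z0 s.
Proof. now intros H <-. Qed.

Lemma simple_pole_hol f z0 : nbhd z0 (diff_at f) -> simple_pole f z0 0.
Proof.
  intros H. exists f. split; [exact H |].
  generalize (nbhd'_ne z0). apply filter_imp. intros z Hz.
  apply Cminus_neq_0 in Hz. field. exact Hz.
Qed.

Lemma simple_pole_entire f z0 : (forall z, diff_at f z) -> simple_pole f z0 0.
Proof. intros H. apply simple_pole_hol. now apply filter_forall. Qed.

Lemma simple_pole_const c z0 : simple_pole (fun _ => c) z0 0.
Proof. apply simple_pole_entire. intros z. apply diff_const. Qed.

Lemma simple_pole_plus f g z0 r s : simple_pole f z0 r -> simple_pole g z0 s -> simple_pole (fun z => f z + g z) z0 (r + s).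
Proof.
  intros [h [Hh Hf]] [k [Hk Hg]]. exists (fun z => h z + k z). split.
  - apply (filter_and2 _ _ _ _ Hh Hk). intros z H1 H2. diff_tac.
  - apply (filter_and3 _ _ _ _ _ (nbhd'_ne z0) Hf Hg). intros z Hz -> ->.
    apply Cminus_neq_0 in Hz. field. exact Hz.
Qed.

Lemma simple_pole_scal c f z0 r : simple_pole f z0 r -> simple_pole (fun z => c * f z) z0 (c * r).
Proof.
  intros [h [Hh Hf]]. exists (fun z => c * h z). split.
  - revert Hh. apply filter_imp. intros z H1. diff_tac.
  - apply (filter_and2 _ _ _ _ (nbhd'_ne z0) Hf). intros z Hz ->.
    apply Cminus_neq_0 in Hz. field. exact Hz.
Qed.

Lemma simple_pole_minus f g z0 r s : simple_pole f z0 r -> simple_pole g z0 s -> simple_pole (fun z => f z - g z) z0 (r - s).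
Proof.
  intros Hf Hg. apply (simple_pole_ext_loc (fun z => f z + - (1) * g z)).
  - apply filter_forall. intros z. ring.
  - eapply simple_pole_eq; [apply simple_pole_plus; [exact Hf | apply simple_pole_scal, Hg] | ring].
Qed.

Lemma nbhd_shift (z s : C) (P : C -> Prop) : nbhd (z + s) P -> nbhd z (fun x => P (x + s)).
Proof.
  intros H. apply nbhd_Cmod in H. destruct H as [d [Hd H]]. apply nbhd_Cmod.
  exists d. split; [exact Hd |]. intros w Hw. apply H.
  replace (w + s - (z + s)) with (w - z) by ring. exact Hw.
Qed.

Lemma nbhd_reflect (z s : C) (P : C -> Prop) : nbhd (s - z) P -> nbhd z (fun x => P (s - x)).
Proof.
  intros H. apply nbhd_Cmod in H. destruct H as [d [Hd H]]. apply nbhd_Cmod.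
  exists d. split; [exact Hd |]. intros w Hw. apply H.
  replace (s - w - (s - z)) with (- (w - z)) by ring. now rewrite Cmod_opp.
Qed.

Lemma simple_pole_shift f z0 s r : simple_pole f (z0 + s) r -> simple_pole (fun x => f (x + s)) z0 r.
Proof.
  intros [h [Hh Hf]]. exists (fun x => h (x + s)). split.
  - apply nbhd_shift in Hh. revert Hh. apply filter_imp. intros z Hz.
    apply (diff_comp (fun x => x + s) h); [diff_tac | exact Hz].
  - apply nbhd'_shift in Hf. revert Hf. apply filter_imp. intros z ->.
    f_equal. f_equal. ring.
Qed.

Lemma simple_pole_reflect f z0 s r : simple_pole f (s - z0) r -> simple_pole (fun x => f (s - x)) z0 (- r).
Proof.
  intros [h [Hh Hf]]. exists (fun x => h (s - x)). split.
  - apply nbhd_reflect in Hh. revert Hh. apply filter_imp. intros z Hz.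
    apply (diff_comp (fun x => s - x) h); [diff_tac | exact Hz].
  - apply nbhd'_reflect in Hf. apply (filter_and2 _ _ _ _ (nbhd'_ne z0) Hf). intros z Hz ->.
    apply Cminus_neq_0 in Hz. f_equal.
    replace (s - z - (s - z0)) with (- (z - z0)) by ring. set (u := z - z0) in *.
    field. exact Hz.
Qed.

Lemma tends_nbhd' (f : C -> C) (z0 l : C) : tends (nbhd z0) f l -> tends (nbhd' z0) f l.
Proof. intros H eps He. apply nbhd_nbhd'. now apply H. Qed.

Lemma simple_pole_tends f z0 r : simple_pole f z0 r -> tends (nbhd' z0) (fun z => (z - z0) * f z) r.
Proof.
  intros [h [Hh Hf]].
  apply (tends_ext_loc (nbhd' z0) (fun z => r + (z - z0) * h z)).
  - apply (filter_and2 _ _ _ _ (nbhd'_ne z0) Hf). intros z Hz ->.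
    apply Cminus_neq_0 in Hz. field. exact Hz.
  - apply nbhd_here, diff_cont in Hh. unfold cont_at in Hh.
    apply tends_nbhd'. eapply tends_eq; [tends_tac | ring].
Qed.

(** The numerator minus its value at [z0] is divisible by z - z0. *)
Lemma pole_order_simple_pole f z0 N : pole_order f z0 N -> (N <= 1)%nat -> exists r, simple_pole f z0 r.
Proof.
  intros [h [Hh [_ Hf]]] HN. apply hol_diff in Hh. change (nbhd' z0 (fun z => f z = h z / (z - z0) ^ N)) in Hf.
  assert (N = 0 \/ N = 1)%nat as [-> | ->] by lia.
  - exists 0. apply (simple_pole_ext_loc h); [| now apply simple_pole_hol].
    revert Hf. apply filter_imp. intros z ->. simpl. field.
  - pose proof Hh as Hh'. apply nbhd_Cmod in Hh'. destruct Hh' as [d [Hd Hd']].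
    destruct (divide h z0 d Hd Hd') as [g [Hg Eg]].
    exists (h z0), g. split.
    + revert Hh. apply filter_imp. auto.
    + apply (filter_and2 _ _ _ _ (nbhd'_ne z0) Hf). intros z Hz ->.
      apply Cminus_neq_0 in Hz. rewrite Eg. simpl. field. exact Hz.
Qed.

(** As (z - z0) f has the limit r, the function (z - z0)^N f tends to 0 for N
    >= 2, and also for N = 1 if r = 0; but a pole of order N gives it a
    nonzero limit. *)
Lemma simple_pole_order_pos f z0 (r : C) N : simple_pole f z0 r -> pole_order f z0 N -> (0 < N)%nat ->
  N = 1%nat /\ r <> 0.
Proof.
  intros Hs [h [Hh [Hne Hf]]] HN. destruct Hne as [-> | Hne]; [lia |].
  apply hol_diff in Hh. change (nbhd' z0 (fun z => f z = h z / (z - z0) ^ N)) in Hf.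
  assert (L : tends (nbhd' z0) (fun z => (z - z0) ^ N * f z) (h z0)).
  { apply (tends_ext_loc (nbhd' z0) h).
    - apply (filter_and2 _ _ _ _ (nbhd'_ne z0) Hf). intros z Hz ->.
      apply Cminus_neq_0 in Hz. field. now apply Cpow_nz.
    - apply tends_nbhd'. now apply nbhd_here, diff_cont in Hh. }
  apply simple_pole_tends in Hs. destruct N as [| [| N]]; [lia | |].
  - split; [reflexivity |]. intros ->. apply Hne.
    apply (tends_unique (nbhd' z0) _ _ _ L). revert Hs. apply tends_ext.
    { typeclasses eauto. } intros z. simpl. ring.
  - exfalso. apply Hne. apply (tends_unique (nbhd' z0) _ _ _ L).
    apply (tends_ext (nbhd' z0) (fun z => (z - z0) ^ N * ((z - z0) * ((z - z0) * f z)))).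
    { intros z. simpl. ring. }
    assert (Hp : tends (nbhd' z0) (fun z => (z - z0) ^ N) ((z0 - z0) ^ N)).
    { apply tends_nbhd'. apply (diff_cont (fun z => (z - z0) ^ N)). diff_tac. }
    assert (Hi : tends (nbhd' z0) (fun z => z - z0) (z0 - z0)).
    { apply tends_nbhd'. tends_tac. }
    eapply tends_eq; [apply tends_mult; [typeclasses eauto | exact Hp |];
      apply tends_mult; [typeclasses eauto | exact Hi | exact Hs] | ring].
Qed.

Lemma simple_pole_order_0 f z0 : simple_pole f z0 0 -> pole_order f z0 0.
Proof.
  intros [h [Hh Hf]]. exists h. split; [now apply hol_diff |]. split; [now left |].
  change (nbhd' z0 (fun z => f z = h z / (z - z0) ^ 0)).
  apply (filter_and2 _ _ _ _ (nbhd'_ne z0) Hf). intros z Hz ->.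
  apply Cminus_neq_0 in Hz. simpl. field. exact Hz.
Qed.

Lemma simple_pole_order_1 f z0 (r : C) : simple_pole f z0 r -> r <> 0 -> pole_order f z0 1.
Proof.
  intros [h [Hh Hf]] Hr. exists (fun z => r + (z - z0) * h z).
  split; [apply hol_diff | split; [right |]].
  - revert Hh. apply filter_imp. intros z Hz. diff_tac.
  - replace (r + (z0 - z0) * h z0) with r by ring. exact Hr.
  - change (nbhd' z0 (fun z => f z = (r + (z - z0) * h z) / (z - z0) ^ 1)).
    apply (filter_and2 _ _ _ _ (nbhd'_ne z0) Hf). intros z Hz ->.
    apply Cminus_neq_0 in Hz. simpl. field. exact Hz.
Qed.

(** * Equality of meromorphic functions *)

Lemma mer_eq_of_eq f g : (forall z, f z = g z) -> mer_eq f g.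
Proof. intros H z0. apply (filter_forall (F := nbhd' z0)). exact H. Qed.

Lemma mer_eq_refl f : mer_eq f f.
Proof. now apply mer_eq_of_eq. Qed.

Lemma mer_eq_sym f g : mer_eq f g -> mer_eq g f.
Proof.
  intros H z0. generalize (H z0 : nbhd' z0 _). apply (filter_imp (F := nbhd' z0)). auto.
Qed.

Lemma mer_eq_trans f g h : mer_eq f g -> mer_eq g h -> mer_eq f h.
Proof.
  intros H1 H2 z0. apply (filter_and2 (nbhd' z0) _ _ _ (H1 z0) (H2 z0)). intros z -> ->. auto.
Qed.

Lemma mer_eq_plus f f' g g' : mer_eq f f' -> mer_eq g g' ->
  mer_eq (fun z => f z + g z) (fun z => f' z + g' z).
Proof.
  intros H1 H2 z0. apply (filter_and2 (nbhd' z0) _ _ _ (H1 z0) (H2 z0)). intros z -> ->. auto.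
Qed.

Lemma mer_eq_minus f f' g g' : mer_eq f f' -> mer_eq g g' ->
  mer_eq (fun z => f z - g z) (fun z => f' z - g' z).
Proof.
  intros H1 H2 z0. apply (filter_and2 (nbhd' z0) _ _ _ (H1 z0) (H2 z0)). intros z -> ->. auto.
Qed.

Lemma mer_eq_scal a f f' : mer_eq f f' -> mer_eq (fun z => a * f z) (fun z => a * f' z).
Proof.
  intros H z0. generalize (H z0 : nbhd' z0 _). apply (filter_imp (F := nbhd' z0)). now intros z ->.
Qed.

Lemma mer_eq_shift s f f' : mer_eq f f' -> mer_eq (fun z => f (z + s)) (fun z => f' (z + s)).
Proof. intros H z0. exact (nbhd'_shift z0 s _ (H (z0 + s))). Qed.

Lemma mer_eq_Delta tau f f' : mer_eq f f' -> mer_eq (Delta tau f) (Delta tau f').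
Proof. intros H. apply mer_eq_minus; [now apply mer_eq_shift | exact H]. Qed.

Lemma mer_eq_iter_Delta tau k f f' : mer_eq f f' ->
  mer_eq (Nat.iter k (Delta tau) f) (Nat.iter k (Delta tau) f').
Proof. intros H. induction k as [| k IH]; [exact H | now apply mer_eq_Delta]. Qed.

Lemma simple_pole_mer_eq f g z0 r : mer_eq f g -> simple_pole f z0 r -> simple_pole g z0 r.
Proof. intros H. apply simple_pole_ext_loc. exact (H z0). Qed.

Lemma mer_eq_const_inj (c d : C) : mer_eq (fun _ => c) (fun _ => d) -> c = d.
Proof.
  intros H. refine (tends_unique (nbhd' 0) (fun _ => c) c d _ _); [tends_tac |].
  apply (tends_ext_loc (nbhd' 0) (fun _ => d)); [| tends_tac].
  exact (mer_eq_sym _ _ H 0).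
Qed.

Lemma mer_eq_entire f g : (forall z, diff_at f z) -> (forall z, diff_at g z) -> mer_eq f g ->
  forall z, f z = g z.
Proof.
  intros Hf Hg H z. refine (tends_unique (nbhd' z) f _ _ _ _).
  - apply tends_nbhd', diff_cont, Hf.
  - apply (tends_ext_loc (nbhd' z) g); [exact (mer_eq_sym _ _ H z) |].
    apply tends_nbhd', diff_cont, Hg.
Qed.

Lemma const_value_mer_eq f c : mer_eq f (fun _ => c) -> const_value f = c.
Proof.
  intros H. unfold const_value.
  apply (iota_unique (V := C_R_CompleteNormedModule) (fun c => mer_eq f (fun _ => c)) c);
    [| exact H].
  intros d Hd. apply mer_eq_const_inj. eapply mer_eq_trans; [| exact H]. now apply mer_eq_sym.
Qed.

(** [G] is the limit of f at every point; near each point it coincides with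
    the holomorphic function that represents f there. *)
Lemma simple_pole_0_entire f : (forall z0, simple_pole f z0 0) -> exists G, (forall z, diff_at G z) /\ mer_eq f G.
Proof.
  intros H.
  assert (L : forall z0, exists l, tends (nbhd' z0) f l).
  { intros z0. destruct (H z0) as [h [Hh Hf]]. exists (h z0).
    apply (tends_ext_loc (nbhd' z0) h).
    - apply (filter_and2 _ _ _ _ (nbhd'_ne z0) Hf). intros z Hz ->.
      apply Cminus_neq_0 in Hz. field. exact Hz.
    - apply tends_nbhd'. now apply nbhd_here, diff_cont in Hh. }
  exists (fun z => proj1_sig (constructive_indefinite_description _ (L z))).
  set (G := fun z => proj1_sig (constructive_indefinite_description _ (L z))).
  assert (HG : forall z, tends (nbhd' z) f (G z)).
  { intros z. unfold G. destruct (constructive_indefinite_description _ (L z)). auto. }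
  assert (Loc : forall z0, exists h, nbhd z0 (diff_at h) /\ nbhd z0 (fun z => h z = G z) /\
                  nbhd' z0 (fun z => f z = h z)).
  { intros z0. destruct (H z0) as [h [Hh Hf]].
    assert (Hf' : nbhd' z0 (fun z => f z = h z)).
    { apply (filter_and2 _ _ _ _ (nbhd'_ne z0) Hf). intros z Hz ->.
      apply Cminus_neq_0 in Hz. field. exact Hz. }
    exists h. split; [exact Hh |]. split; [| exact Hf'].
    assert (A : forall z, nbhd' z (fun w => f w = h w) -> diff_at h z -> h z = G z).
    { intros z Hz Dz. refine (tends_unique (nbhd' z) f _ _ _ _); [| apply HG].
      apply (tends_ext_loc (nbhd' z) h).
      - revert Hz. apply filter_imp. auto.
      - now apply tends_nbhd', diff_cont. }
    assert (B : nbhd z0 (fun z => nbhd' z (fun w => f w = h w))).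
    { pose proof Hf' as B. apply nbhd'_Cmod in B. destruct B as [d [Hd B]].
      apply nbhd_Cmod. exists d. split; [exact Hd |]. intros z Hz.
      destruct (Ceq_dec z z0) as [-> | Hne]; [exact Hf' |]. apply nbhd_nbhd'.
      assert (Hzz : (0 < Cmod (z - z0))%R) by now apply Cmod_pos, Cminus_neq_0.
      apply nbhd_Cmod. exists (Rmin (Cmod (z - z0)) (d - Cmod (z - z0)))%R.
      split; [apply Rmin_glb_lt; lra |]. intros w Hw.
      pose proof (Rmin_l (Cmod (z - z0)) (d - Cmod (z - z0))).
      pose proof (Rmin_r (Cmod (z - z0)) (d - Cmod (z - z0))).
      apply B.
      - pose proof (Cmod_le_triangle w z z0). lra.
      - intros ->. rewrite Cmod_minus_sym in Hw. lra. }
    apply (filter_and2 _ _ _ _ B Hh). intros z Hz Dz. now apply A. }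
  split.
  - intros z. destruct (Loc z) as [h [Hh [E _]]].
    apply (diff_ext_loc h); [exact E | now apply nbhd_here in Hh].
  - intros z0. destruct (Loc z0) as [h [_ [E Hf]]].
    apply (filter_and2 (nbhd' z0) _ _ _ (nbhd_nbhd' _ _ E) Hf). intros z <-. auto.
Qed.

(** * The space V *)

(** The form of [V] used below: residues are additive, orders of poles are
    not. *)
Definition Vsimple (tau : C) (f : C -> C) : Prop :=
  (forall z0, exists r, simple_pole f z0 r /\ (r <> 0 -> Lambda tau z0)) /\ period1 f /\
  exists k : nat, mer_eq (Nat.iter k (Delta tau) f) (fun _ => 0).

Lemma V_Vsimple tau f : V tau f <-> Vsimple tau f.
Proof.
  split.
  - intros [[Hm [Hp [Hpl Hk]]] [o [[Ho _] Ho1]]]. split; [| now split].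
    intros z0. destruct (Hm z0) as [N HN]. assert (N <= 1)%nat by (specialize (Ho _ _ HN); lia).
    destruct (pole_order_simple_pole f z0 N HN H) as [r Hr]. exists r. split; [exact Hr |].
    intros Hne. apply (Hpl z0 1%nat); [| lia]. now apply simple_pole_order_1 with r.
  - intros [Hs [Hp Hk]].
    assert (Hle : forall z0 N, pole_order f z0 N -> (N <= 1)%nat).
    { intros z0 N HN. destruct (Hs z0) as [r [Hr _]].
      destruct N as [| N]; [lia |]. destruct (simple_pole_order_pos f z0 r _ Hr HN); lia. }
    split; [split; [| split; [exact Hp | split; [| exact Hk]]] |].
    + intros z0. destruct (Hs z0) as [r [Hr _]]. destruct (Ceq_dec r 0) as [-> | Hne].
      * exists 0%nat. now apply simple_pole_order_0.
      * exists 1%nat. now apply simple_pole_order_1 with r.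
    + intros z0 N HN HN0. destruct (Hs z0) as [r [Hr Hl]]. apply Hl.
      now apply (simple_pole_order_pos f z0 r N Hr HN).
    + destruct (Classical_Prop.classic (exists z0, pole_order f z0 1)) as [[z0 Hz0] | Hn].
      * exists 1%nat. split; [split; [exact Hle | now exists z0] | lia].
      * exists 0%nat. split; [| lia]. split.
        -- intros z0 N HN. pose proof (Hle _ _ HN). destruct N as [| [| N]]; [lia | | lia].
           exfalso. apply Hn. now exists z0.
        -- exists 0. destruct (Hs 0) as [r [Hr _]]. destruct (Ceq_dec r 0) as [-> | Hne].
           ++ now apply simple_pole_order_0.
           ++ exfalso. apply Hn. exists 0. now apply simple_pole_order_1 with r.
Qed.

Lemma Delta_plus tau f g x : Delta tau (fun z => f z + g z) x = Delta tau f x + Delta tau g x.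
Proof. unfold Delta. ring. Qed.

Lemma iter_Delta_plus tau k f g : mer_eq (Nat.iter k (Delta tau) (fun z => f z + g z))
  (fun z => Nat.iter k (Delta tau) f z + Nat.iter k (Delta tau) g z).
Proof.
  induction k as [| k IH]; [apply mer_eq_refl |]. simpl.
  eapply mer_eq_trans; [apply mer_eq_Delta, IH |]. apply mer_eq_of_eq. intros z. apply Delta_plus.
Qed.

Lemma iter_Delta_scal tau k a f : mer_eq (Nat.iter k (Delta tau) (fun z => a * f z))
  (fun z => a * Nat.iter k (Delta tau) f z).
Proof.
  induction k as [| k IH]; [apply mer_eq_refl |]. simpl.
  eapply mer_eq_trans; [apply mer_eq_Delta, IH |]. apply mer_eq_of_eq. intros z.
  unfold Delta. ring.
Qed.

Lemma iter_Delta_zero tau k : mer_eq (Nat.iter k (Delta tau) (fun _ => 0)) (fun _ => 0).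
Proof.
  induction k as [| k IH]; [apply mer_eq_refl |]. simpl.
  eapply mer_eq_trans; [apply mer_eq_Delta, IH |]. apply mer_eq_of_eq. intros z.
  unfold Delta. ring.
Qed.

Lemma iter_Delta_0_mono tau k j f : mer_eq (Nat.iter k (Delta tau) f) (fun _ => 0) ->
  mer_eq (Nat.iter (j + k) (Delta tau) f) (fun _ => 0).
Proof.
  intros H. rewrite Nat.iter_add.
  eapply mer_eq_trans; [apply mer_eq_iter_Delta, H |]. apply iter_Delta_zero.
Qed.

Lemma Vsimple_mer_eq tau f g : mer_eq f g -> Vsimple tau f -> Vsimple tau g.
Proof.
  intros E [Hs [Hp [k Hk]]]. split; [| split].
  - intros z0. destruct (Hs z0) as [r [Hr Hl]]. exists r. split; [| exact Hl].
    now apply (simple_pole_mer_eq f).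
  - unfold period1. eapply mer_eq_trans; [| eapply mer_eq_trans; [exact Hp | exact E]].
    apply (mer_eq_shift 1 g f). now apply mer_eq_sym.
  - exists k. eapply mer_eq_trans; [| exact Hk]. apply mer_eq_iter_Delta. now apply mer_eq_sym.
Qed.

Lemma Vsimple_const tau c : Vsimple tau (fun _ => c).
Proof.
  split; [| split].
  - intros z0. exists 0. split; [apply simple_pole_const | congruence].
  - apply mer_eq_refl.
  - exists 1%nat. apply mer_eq_of_eq. intros z. simpl. unfold Delta. ring.
Qed.

Lemma Vsimple_plus tau f g : Vsimple tau f -> Vsimple tau g -> Vsimple tau (fun z => f z + g z).
Proof.
  intros [Hs1 [Hp1 [k1 Hk1]]] [Hs2 [Hp2 [k2 Hk2]]]. split; [| split].
  - intros z0. destruct (Hs1 z0) as [r [Hr Hl]]. destruct (Hs2 z0) as [s [Hs Hm]].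
    exists (r + s). split; [now apply simple_pole_plus |]. intros Hne.
    destruct (Ceq_dec r 0) as [-> | Hr0]; [| now apply Hl].
    apply Hm. intros ->. apply Hne. ring.
  - exact (mer_eq_plus _ _ _ _ Hp1 Hp2).
  - exists (k1 + k2)%nat. eapply mer_eq_trans; [apply iter_Delta_plus |].
    eapply mer_eq_trans.
    + apply mer_eq_plus; [| apply iter_Delta_0_mono, Hk2].
      rewrite Nat.add_comm. apply iter_Delta_0_mono, Hk1.
    + apply mer_eq_of_eq. intros z. ring.
Qed.

Lemma Vsimple_scal tau a f : Vsimple tau f -> Vsimple tau (fun z => a * f z).
Proof.
  intros [Hs1 [Hp1 [k1 Hk1]]]. split; [| split].
  - intros z0. destruct (Hs1 z0) as [r [Hr Hl]].
    exists (a * r). split; [now apply simple_pole_scal |]. intros Hne. apply Hl. intros ->. apply Hne. ring.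
  - exact (mer_eq_scal a _ _ Hp1).
  - exists k1. eapply mer_eq_trans; [apply iter_Delta_scal |].
    eapply mer_eq_trans; [apply mer_eq_scal, Hk1 |]. apply mer_eq_of_eq. intros z. ring.
Qed.

Lemma Lambda_shift tau z0 : Lambda tau (z0 + tau) -> Lambda tau z0.
Proof.
  intros [a [b H]]. exists a, (b - 1)%Z. rewrite minus_IZR, RtoC_minus.
  replace z0 with (z0 + tau - tau) by ring. rewrite H. ring.
Qed.

Lemma Vsimple_Delta tau f : Vsimple tau f -> Vsimple tau (Delta tau f).
Proof.
  intros [Hs1 [Hp1 [k1 Hk1]]]. split; [| split].
  - intros z0. destruct (Hs1 (z0 + tau)) as [r [Hr Hl]]. destruct (Hs1 z0) as [s [Hs Hm]].
    exists (r - s). split; [apply simple_pole_minus; [now apply simple_pole_shift | exact Hs] |]. intros Hne.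
    destruct (Ceq_dec s 0) as [-> | Hs0]; [| now apply Hm].
    apply Lambda_shift, Hl. intros ->. apply Hne. ring.
  - unfold period1, Delta. apply mer_eq_minus; [| exact Hp1].
    eapply mer_eq_trans; [| apply (mer_eq_shift tau _ _ Hp1)].
    apply mer_eq_of_eq. intros z. f_equal. ring.
  - exists k1. change (Nat.iter k1 (Delta tau) (Delta tau f)) with
      (Nat.iter k1 (Delta tau) (Nat.iter 1 (Delta tau) f)).
    rewrite <- Nat.iter_add, Nat.add_comm. apply (iter_Delta_0_mono tau k1 1 f Hk1).
Qed.

(** * Limits of holomorphic functions *)

Lemma Cmod_triangle_minus (x y : C) : (Cmod (x - y) <= Cmod x + Cmod y)%R.
Proof. unfold Cminus. rewrite <- (Cmod_opp y). apply Cmod_triangle. Qed.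

Lemma tends_cauchy {T} (F : (T -> Prop) -> Prop) {PF : ProperFilter F} (f : T -> C) :
  (forall eps, (0 < eps)%R ->
     exists P, F P /\ forall u v, P u -> P v -> (Cmod (f u - f v) < eps)%R) ->
  exists l, tends F f l.
Proof.
  intros H.
  destruct (proj1 (filterlim_locally_cauchy (U := C_R_CompleteNormedModule) (F := F) f)) as [l Hl].
  - intros eps. destruct (H eps (cond_pos eps)) as [P [HP HC]].
    exists P. split; [exact HP |]. intros u v Hu Hv.
    apply C_NormedModule_mixin_compat1. now apply HC.
  - exists l. intros eps He.
    apply (Hl (fun y => (Cmod (y - l) < eps)%R)).
    apply (proj2 (nbhd_Cmod l (fun y => (Cmod (y - l) < eps)%R))). exists eps. auto.
Qed.

(** Dividing twice, the remainder is (w - a)^2 times a holomorphic function,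
    estimated on the circle of radius r. The constant depends only on M and
    r, hence is uniform in a bounded family. *)
Lemma quadratic_remainder (f : C -> C) (a : C) (r M : R) : (0 < r)%R ->
  (forall z, (Cmod (z - a) < 2 * r)%R -> diff_at f z /\ (Cmod (f z) <= M)%R) ->
  exists L, forall w, (Cmod (w - a) <= r / 2)%R ->
    (Cmod (f w - f a - L * (w - a)) <= 8 * M / (r * r) * (Cmod (w - a) * Cmod (w - a)))%R.
Proof.
  intros Hr Hf. assert (H2r : (0 < 2 * r)%R) by lra.
  destruct (divide f a (2 * r) H2r) as [g [Hg Eg]]; [intros; now apply Hf |].
  destruct (divide g a (2 * r) H2r) as [h [Hh Eh]]; [intros; now apply Hg, Hf |].
  exists (g a). intros w Hw.
  assert (Haa : Cmod (a - a) = 0%R) by (replace (a - a) with (RtoC 0) by ring; apply Cmod_0).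
  assert (HM : (0 <= M)%R).
  { eapply Rle_trans; [apply Cmod_ge_0 | apply (Hf a); lra]. }
  assert (Hp : forall t, Cmod (a + RtoC r * e2pi (RtoC t) - a) = r).
  { intros t. replace (a + RtoC r * e2pi (RtoC t) - a) with (RtoC r * e2pi (RtoC t)) by ring.
    rewrite Cmod_mult, Cmod_R, Cmod_e2pi_R, Rabs_pos_eq; lra. }
  assert (Hgc : forall t, (Cmod (g (a + RtoC r * e2pi (RtoC t))%C) <= 2 * M / r)%R).
  { intros t. set (p := a + RtoC r * e2pi (RtoC t)) in *. specialize (Hp t). fold p in Hp.
    assert (Hpa : p - a <> 0) by (apply Cmod_gt_0; lra).
    replace (g p) with ((f p - f a) / (p - a)) by (rewrite (Eg p); field; exact Hpa).
    rewrite Cmod_div, Hp by exact Hpa. unfold Rdiv.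
    apply Rmult_le_compat_r; [left; now apply Rinv_0_lt_compat |].
    unfold Cminus. eapply Rle_trans; [apply Cmod_triangle |]. rewrite Cmod_opp.
    destruct (Hf p) as [_ B1]; [lra |]. destruct (Hf a) as [_ B2]; [lra |]. lra. }
  assert (Hga : (Cmod (g a) <= 2 * M / r)%R).
  { eapply Rle_trans.
    - apply (cauchy_estimate g a r Hr) with (M := (2 * M / r)%R).
      + intros z Hz. apply Hg, Hf. lra.
      + intros t _. apply Hgc.
      + lra.
    - rewrite Haa, Rminus_0_r. right. field. lra. }
  assert (Hhw : (Cmod (h w) <= 8 * M / (r * r))%R).
  { eapply Rle_trans.
    - apply (cauchy_estimate h a r Hr) with (M := (4 * M / (r * r))%R).
      + intros z Hz. apply Hh, Hg, Hf. lra.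
      + intros t _. specialize (Hgc t).
        set (p := a + RtoC r * e2pi (RtoC t)) in *. specialize (Hp t). fold p in Hp.
        assert (Hpa : p - a <> 0) by (apply Cmod_gt_0; lra).
        replace (h p) with ((g p - g a) / (p - a)) by (rewrite (Eh p); field; exact Hpa).
        rewrite Cmod_div, Hp by exact Hpa.
        replace (4 * M / (r * r))%R with ((2 * M / r + 2 * M / r) / r)%R by (field; lra).
        unfold Rdiv at 1 2. apply Rmult_le_compat_r; [left; now apply Rinv_0_lt_compat |].
        unfold Cminus. eapply Rle_trans; [apply Cmod_triangle |]. rewrite Cmod_opp. lra.
      + lra.
    - apply Rle_trans with (4 * M / (r * r) * 2)%R; [| right; field; lra].
      apply Rmult_le_compat_l; [apply Rdiv_le_0_compat; nra |].
      apply Rmult_le_reg_r with (r - Cmod (w - a))%R; [lra |].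
      unfold Rdiv. rewrite Rmult_assoc, Rinv_l; lra. }
  replace (f w - f a - g a * (w - a)) with (h w * ((w - a) * (w - a)))
    by (rewrite (Eg w), (Eh w); ring).
  rewrite !Cmod_mult. apply Rmult_le_compat_r; [| exact Hhw].
  apply Rmult_le_pos; apply Cmod_ge_0.
Qed.

(** The difference quotients converge, and by [quadratic_remainder] they are
    uniformly close to the derivatives at [a]; so the derivatives converge as
    well, and the quadratic bound passes to the limit. *)
Lemma limit_holomorphic {T} (F : (T -> Prop) -> Prop) {PF : ProperFilter F}
    (f : T -> C -> C) (g : C -> C) (a : C) (r M : R) : (0 < r)%R ->
  (forall t z, (Cmod (z - a) < r)%R -> diff_at (f t) z /\ (Cmod (f t z) <= M)%R) ->
  (forall z, (Cmod (z - a) < r)%R -> tends F (fun t => f t z) (g z)) ->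
  diff_at g a.
Proof.
  intros Hr Hf Hg. assert (HF : Filter F) by apply PF.
  assert (HPF : ProperFilter' F) by apply (Proper_StrongProper _ PF).
  set (K := (8 * M / (r / 2 * (r / 2)))%R).
  assert (HL : forall t, exists L, forall w, (Cmod (w - a) <= r / 2 / 2)%R ->
     (Cmod (f t w - f t a - L * (w - a)) <= K * (Cmod (w - a) * Cmod (w - a)))%R).
  { intros t. apply quadratic_remainder; [lra |]. intros z Hz. apply Hf. lra. }
  set (L := fun t => proj1_sig (constructive_indefinite_description _ (HL t))).
  assert (HL' : forall t w, (Cmod (w - a) <= r / 2 / 2)%R ->
     (Cmod (f t w - f t a - L t * (w - a)) <= K * (Cmod (w - a) * Cmod (w - a)))%R).
  { intros t. unfold L. destruct (constructive_indefinite_description _ (HL t)). auto. }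
  assert (Haa : Cmod (a - a) = 0%R) by (replace (a - a) with (RtoC 0) by ring; apply Cmod_0).
  assert (Lim : exists l, tends F L l).
  { apply tends_cauchy; [exact PF |]. intros eps He.
    pose proof (Rabs_pos K) as HK. pose proof (Rle_abs K) as HK'.
    (* a step for which the two remainders add at most eps / 4 to the difference quotients *)
    set (s := Rmin (r / 2 / 2) (eps / (8 * (Rabs K + 1)))).
    assert (Hs : (0 < s)%R).
    { apply Rmin_glb_lt; [lra |]. apply Rdiv_lt_0_compat; lra. }
    assert (Hs1 : (s <= r / 2 / 2)%R) by apply Rmin_l.
    assert (Hs2 : (s <= eps / (8 * (Rabs K + 1)))%R) by apply Rmin_r.
    set (w := a + RtoC s).
    assert (Ew : w - a = RtoC s) by (unfold w; ring).
    assert (Hw : Cmod (w - a) = s) by (rewrite Ew, Cmod_R, Rabs_pos_eq; lra).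
    assert (Hes : (0 < eps * s / 16)%R) by (apply Rdiv_lt_0_compat; nra).
    exists (fun t => (Cmod (f t w - g w) < eps * s / 16)%R /\ (Cmod (f t a - g a) < eps * s / 16)%R).
    split.
    - apply filter_and; apply Hg; lra.
    - intros u v [U1 U2] [V1 V2].
      pose proof (HL' u w ltac:(lra)) as Bu. pose proof (HL' v w ltac:(lra)) as Bv.
      rewrite Hw in Bu, Bv.
      apply Rmult_lt_reg_r with s; [exact Hs |].
      rewrite <- Hw at 1. rewrite <- Cmod_mult.
      replace ((L u - L v) * (w - a))
        with (((f u w - g w) - (f v w - g w)) - ((f u a - g a) - (f v a - g a))
              - ((f u w - f u a - L u * (w - a)) - (f v w - f v a - L v * (w - a)))) by ring.
      assert (HKs : (K * (s * s) <= eps * s / 8)%R).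
      { assert (K * s <= eps / 8)%R; [| nra].
        apply Rle_trans with ((Rabs K + 1) * s)%R; [apply Rmult_le_compat_r; lra |].
        apply Rle_trans with ((Rabs K + 1) * (eps / (8 * (Rabs K + 1))))%R;
          [apply Rmult_le_compat_l; lra |]. right. field. lra. }
      eapply Rle_lt_trans; [apply Cmod_triangle_minus |].
      eapply Rle_lt_trans; [apply Rplus_le_compat; apply Cmod_triangle_minus |].
      pose proof (Cmod_triangle_minus (f u w - g w) (f v w - g w)).
      pose proof (Cmod_triangle_minus (f u a - g a) (f v a - g a)).
      lra. }
  destruct Lim as [l Hl].
  apply (diff_of_quadratic g a l K (r / 2 / 2)); [lra |]. intros w Hw.
  apply (tends_bound F (fun t => f t w - f t a - L t * (w - a))).
  - exact HPF.
  - apply filter_forall. intros t. apply HL'. lra.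
  - apply tends_minus; [exact HF | apply tends_minus; [exact HF | |] |].
    + apply Hg. lra.
    + apply Hg. lra.
    + apply tends_mult; [exact HF | exact Hl | apply tends_const; exact HF].
Qed.

(** * Series dominated by a geometric series *)

Fixpoint psum (a : nat -> C) (N : nat) : C :=
  match N with O => 0 | S N => psum a N + a N end.

Definition csum (a : nat -> C) (s : C) : Prop := tends eventually (psum a) s.

Lemma psum_ext a b N : (forall k, a k = b k) -> psum a N = psum b N.
Proof. intros E. induction N as [| N IH]; simpl; [reflexivity | now rewrite IH, E]. Qed.

Lemma psum_plus a b N : psum (fun k => a k + b k) N = psum a N + psum b N.
Proof. induction N as [| N IH]; simpl; [ring | rewrite IH; ring]. Qed.

Lemma psum_scal c a N : psum (fun k => c * a k) N = c * psum a N.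
Proof. induction N as [| N IH]; simpl; [ring | rewrite IH; ring]. Qed.

Lemma csum_ext a b s : (forall k, a k = b k) -> csum a s -> csum b s.
Proof.
  intros E. apply tends_ext; [typeclasses eauto |]. intros N. now apply psum_ext.
Qed.

Lemma csum_plus a b s t : csum a s -> csum b t -> csum (fun k => a k + b k) (s + t).
Proof.
  intros Ha Hb. apply (tends_ext eventually (fun N => psum a N + psum b N)).
  - intros N. now rewrite psum_plus.
  - apply tends_plus; [typeclasses eauto | exact Ha | exact Hb].
Qed.

Lemma csum_scal c a s : csum a s -> csum (fun k => c * a k) (c * s).
Proof.
  intros Ha. apply (tends_ext eventually (fun N => c * psum a N)).
  - intros N. now rewrite psum_scal.
  - apply tends_scal; [typeclasses eauto | exact Ha].
Qed.

Lemma csum_unique a s t : csum a s -> csum a t -> s = t.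
Proof. intros H1 H2. refine (tends_unique eventually _ s t H1 H2). Qed.

Section Geometric.
Variables (a : nat -> C) (K rho : R).
Hypothesis Hrho : (0 <= rho < 1)%R.
Hypothesis Ha : forall k, (Cmod (a k) <= K * rho ^ k)%R.

Lemma geom_K : (0 <= K)%R.
Proof. pose proof (Ha 0) as H. simpl in H. pose proof (Cmod_ge_0 (a 0%nat)). lra. Qed.

Lemma psum_geom_diff N j : (Cmod (psum a (N + j) - psum a N) <= K / (1 - rho) * (rho ^ N - rho ^ (N + j)))%R.
Proof.
  induction j as [| j IH].
  - rewrite Nat.add_0_r. replace (psum a N - psum a N) with (RtoC 0) by ring.
    rewrite Cmod_0. right. ring.
  - rewrite Nat.add_succ_r. simpl psum.
    replace (psum a (N + j) + a (N + j)%nat - psum a N)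
      with ((psum a (N + j) - psum a N) + a (N + j)%nat) by ring.
    eapply Rle_trans; [apply Cmod_triangle |].
    eapply Rle_trans; [apply Rplus_le_compat; [exact IH | apply Ha] |].
    right. simpl. field. lra.
Qed.

Lemma psum_geom_tail N j : (Cmod (psum a (N + j) - psum a N) <= K / (1 - rho) * rho ^ N)%R.
Proof.
  eapply Rle_trans; [apply psum_geom_diff |]. pose proof geom_K.
  apply Rmult_le_compat_l; [apply Rdiv_le_0_compat; lra |].
  pose proof (pow_le rho (N + j) (proj1 Hrho)). lra.
Qed.

Lemma psum_geom_bound N : (Cmod (psum a N) <= K / (1 - rho))%R.
Proof.
  pose proof (psum_geom_tail 0 N) as H. simpl in H.
  replace (psum a N - 0) with (psum a N) in H by ring. lra.
Qed.

Lemma geom_small eps : (0 < eps)%R -> exists N, forall n, (N <= n)%nat -> (K / (1 - rho) * rho ^ n < eps)%R.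
Proof.
  intros He. pose proof geom_K as HK.
  assert (HK1 : (0 <= K / (1 - rho))%R) by (apply Rdiv_le_0_compat; lra).
  destruct (pow_lt_1_zero rho ltac:(rewrite Rabs_pos_eq; lra) (eps / (K / (1 - rho) + 1))
    ltac:(apply Rdiv_lt_0_compat; lra)) as [N HN].
  exists N. intros n Hn. specialize (HN n Hn). rewrite Rabs_pos_eq in HN by (apply pow_le; lra).
  apply Rle_lt_trans with ((K / (1 - rho) + 1) * rho ^ n)%R.
  - apply Rmult_le_compat_r; [apply pow_le; lra | lra].
  - apply Rmult_lt_compat_l with (r := (K / (1 - rho) + 1)%R) in HN; [| lra].
    replace ((K / (1 - rho) + 1) * (eps / (K / (1 - rho) + 1)))%R with eps in HN by (field; lra).
    exact HN.
Qed.

Lemma csum_geom_ex : exists s, csum a s.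
Proof.
  apply tends_cauchy; [typeclasses eauto |]. intros eps He.
  assert (He2 : (0 < eps / 2)%R) by lra.
  destruct (geom_small (eps / 2) He2) as [N HN].
  exists (fun n => (N <= n)%nat). split; [now exists N |].
  intros u v Hu Hv.
  assert (B : forall u, (N <= u)%nat -> (Cmod (psum a u - psum a N) < eps / 2)%R).
  { intros k Hk. replace k with (N + (k - N))%nat by lia.
    eapply Rle_lt_trans; [apply psum_geom_tail | now apply HN]. }
  pose proof (B u Hu). pose proof (B v Hv).
  pose proof (Cmod_le_triangle (psum a u) (psum a N) (psum a v)) as H1.
  rewrite (Cmod_minus_sym (psum a N)) in H1. lra.
Qed.

Lemma csum_geom_tail s N : csum a s -> (Cmod (s - psum a N) <= K / (1 - rho) * rho ^ N)%R.
Proof.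
  intros Hs. apply (tends_bound eventually (fun n => psum a n - psum a N)).
  - typeclasses eauto.
  - exists N. intros n Hn. replace n with (N + (n - N))%nat by lia. apply psum_geom_tail.
  - apply tends_minus; [typeclasses eauto | exact Hs | apply tends_const; typeclasses eauto].
Qed.
End Geometric.

(** * Explicit convolution powers *)

Section Explicit.
Variable tau : C.
Hypothesis Htau : (0 < Im tau)%R.

Let q : C := e2pi tau.

Lemma Cmod_e2pi_lt_1 x : (0 < Im x)%R -> (Cmod (e2pi x) < 1)%R.
Proof.
  intros Hx. rewrite Cmod_e2pi, <- exp_0. apply exp_increasing.
  pose proof PI_RGT_0. assert (0 < 2 * PI * Im x)%R by (apply Rmult_lt_0_compat; lra).
  lra.
Qed.

Let delta : R := (1 - Cmod q)%R.

Lemma delta_pos : (0 < delta)%R.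
Proof. unfold delta, q. pose proof (Cmod_e2pi_lt_1 tau Htau). lra. Qed.

Lemma one_minus_qk_lower k : (delta <= Cmod (1 - q ^ S k))%R.
Proof.
  pose proof (Cmod_rev_triangle 1 (q ^ S k)) as H. rewrite Cmod_1, Cmod_pow in H.
  assert (Cmod q ^ S k <= Cmod q)%R.
  { assert (B : (Cmod q ^ k <= 1)%R).
    { rewrite <- (pow1 k). apply pow_incr. split; [apply Cmod_ge_0 |].
      left. now apply Cmod_e2pi_lt_1. }
    simpl. pose proof (Cmod_ge_0 q). nra. }
  unfold delta. lra.
Qed.

Lemma one_minus_qk_neq_0 k : 1 - q ^ S k <> 0.
Proof. apply Cmod_gt_0. pose proof (one_minus_qk_lower k). pose proof delta_pos. lra. Qed.

(** The frequency k + 1 of the n-th convolution power, up to the factor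
    (- 2 pi i)^n. *)
Definition qterm (n : nat) (w : C) (k : nat) : C := w ^ S k / (1 - e2pi tau ^ S k) ^ n.

Lemma qterm_bound n w (rho : R) k : (Cmod w <= rho)%R ->
  (Cmod (qterm n w k) <= rho / delta ^ n * rho ^ k)%R.
Proof.
  intros Hw. unfold qterm. fold q.
  rewrite Cmod_div by apply Cpow_nz, one_minus_qk_neq_0.
  rewrite !Cmod_pow. pose proof delta_pos as Hd.
  replace (rho / delta ^ n * rho ^ k)%R with (rho ^ S k * / delta ^ n)%R
    by (simpl; field; apply pow_nonzero; lra).
  apply Rmult_le_compat.
  - apply pow_le, Cmod_ge_0.
  - left. apply Rinv_0_lt_compat, pow_lt. pose proof (one_minus_qk_lower k). lra.
  - apply pow_incr. split; [apply Cmod_ge_0 | exact Hw].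
  - apply Rinv_le_contravar; [now apply pow_lt |]. apply pow_incr. split; [lra |].
    apply one_minus_qk_lower.
Qed.

Lemma qterm_csum_ex n w : (Cmod w < 1)%R -> exists s, csum (qterm n w) s.
Proof.
  intros Hw. apply (csum_geom_ex _ (Cmod w / delta ^ n) (Cmod w)).
  - split; [apply Cmod_ge_0 | exact Hw].
  - intros k. apply qterm_bound. lra.
Qed.

Definition qseries (n : nat) (w : C) : C := epsilon (inhabits (RtoC 0)) (csum (qterm n w)).

Lemma qseries_csum n w : (Cmod w < 1)%R -> csum (qterm n w) (qseries n w).
Proof. intros Hw. unfold qseries. apply epsilon_spec. now apply qterm_csum_ex. Qed.

Lemma qseries_0 w : (Cmod w < 1)%R -> qseries 0 w = w / (1 - w).
Proof.
  intros Hw. apply (csum_unique (qterm 0 w)); [now apply qseries_csum |].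
  assert (Hw1 : 1 - w <> 0).
  { apply Cmod_gt_0. pose proof (Cmod_rev_triangle 1 w) as H. rewrite Cmod_1 in H. lra. }
  assert (E : forall N, psum (qterm 0 w) N = w / (1 - w) - w ^ N * (w / (1 - w))).
  { induction N as [| N IH]; simpl psum.
    - simpl. ring.
    - rewrite IH. unfold qterm. simpl. field. exact Hw1. }
  apply (tends_ext eventually (fun N => w / (1 - w) - w ^ N * (w / (1 - w)))).
  { intros N. now rewrite E. }
  assert (L : tends eventually (fun N => w ^ N) 0).
  { intros eps He.
    destruct (pow_lt_1_zero (Cmod w) ltac:(rewrite Rabs_pos_eq; [lra | apply Cmod_ge_0]) eps He) as [N HN].
    exists N. intros n Hn. specialize (HN n Hn).
    rewrite Rabs_pos_eq in HN by apply pow_le, Cmod_ge_0.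
    replace (w ^ n - 0) with (w ^ n) by ring. now rewrite Cmod_pow. }
  assert (FE : Filter eventually) by typeclasses eauto.
  eapply tends_eq; [apply tends_minus; [exact FE | apply tends_const, FE |];
    apply tends_mult; [exact FE | exact L | apply tends_const, FE] | ring].
Qed.

(** Termwise, w^k - (q w)^k = w^k (1 - q^k) cancels one factor of the
    denominator. *)
Lemma qseries_rec n w : (Cmod w < 1)%R -> qseries (S n) w - qseries (S n) (w * q) = qseries n w.
Proof.
  intros Hw.
  assert (Hwq : (Cmod (w * q) < 1)%R).
  { rewrite Cmod_mult. pose proof (Cmod_e2pi_lt_1 tau Htau : (Cmod q < 1)%R).
    pose proof (Cmod_ge_0 w). pose proof (Cmod_ge_0 q). nra. }
  apply (csum_unique (qterm n w)); [| now apply qseries_csum].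
  replace (qseries (S n) w - qseries (S n) (w * q)) with (qseries (S n) w + - (1) * qseries (S n) (w * q)) by ring.
  apply (csum_ext (fun k => qterm (S n) w k + - (1) * qterm (S n) (w * q) k)).
  - intros k. unfold qterm. fold q. rewrite Cpow_mult_l.
    pose proof (one_minus_qk_neq_0 k) as H.
    set (d := 1 - q ^ S k) in *.
    assert (Hq : q ^ S k = 1 - d) by (unfold d; ring).
    rewrite Hq. simpl Cpow. field. split; [now apply Cpow_nz | exact H].
  - apply csum_plus; [| apply csum_scal]; now apply qseries_csum.
Qed.

Lemma diff_psum (f : nat -> C -> C) N z : (forall k, diff_at (f k) z) ->
  diff_at (fun w => psum (fun k => f k w) N) z.
Proof.
  intros H. induction N as [| N IH]; simpl; [apply diff_const |].
  apply diff_plus; [exact IH | apply H].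
Qed.

Lemma qseries_diff n w : (Cmod w < 1)%R -> diff_at (qseries n) w.
Proof.
  intros Hw. set (r := ((1 - Cmod w) / 2)%R). set (rho := (Cmod w + r)%R).
  pose proof (Cmod_ge_0 w) as Hw0.
  assert (Hr : (0 < r)%R) by (unfold r; lra).
  assert (Hrho : (0 <= rho < 1)%R) by (unfold rho, r; lra).
  assert (Hz : forall z, (Cmod (z - w) < r)%R -> (Cmod z <= rho)%R).
  { intros z Hz. replace z with (z - w + w) by ring.
    eapply Rle_trans; [apply Cmod_triangle |]. unfold rho. lra. }
  apply (limit_holomorphic eventually (fun N z => psum (qterm n z) N) (qseries n) w r
           (rho / delta ^ n / (1 - rho)) Hr).
  - intros N z Hzw. split.
    + apply (diff_psum (fun k z => qterm n z k)). intros k. unfold qterm, Cdiv.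
      apply diff_mult; [| apply diff_const]. apply diff_pow, diff_id.
    + apply psum_geom_bound; [exact Hrho |]. intros k. apply qterm_bound. now apply Hz.
  - intros z Hzw. apply qseries_csum. specialize (Hz z Hzw). lra.
Qed.

(** A number of steps [tau] that lifts [x] into the upper half plane; it is 0
    there, so that the continuation agrees with the series pointwise. *)
Definition level (x : C) : nat := Z.to_nat (up (- Im x / Im tau)).

Lemma level_0 x : (0 < Im x)%R -> level x = 0%nat.
Proof.
  intros Hx. unfold level.
  assert (H : (- Im x / Im tau < 0)%R).
  { unfold Rdiv. rewrite Ropp_mult_distr_l_reverse.
    apply Ropp_lt_gt_0_contravar. apply Rdiv_lt_0_compat; assumption. }
  destruct (archimed (- Im x / Im tau)) as [_ H2].
  assert (IZR (up (- Im x / Im tau)) < 1)%R by lra.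
  apply lt_IZR in H0. lia.
Qed.

Lemma level_pos x : (level x = 0)%nat -> (0 < Im x)%R.
Proof.
  intros H. unfold level in H. destruct (archimed (- Im x / Im tau)) as [H1 _].
  assert (IZR (up (- Im x / Im tau)) <= 0)%R by (apply (IZR_le _ 0); lia).
  assert (H2 : (- Im x / Im tau < 0)%R) by lra.
  apply Rmult_lt_compat_r with (r := Im tau) in H2; [| exact Htau].
  unfold Rdiv in H2. rewrite Rmult_assoc, Rinv_l, Rmult_1_r in H2 by lra. lra.
Qed.

Lemma level_shift x m : level x = S m -> level (x + tau) = m.
Proof.
  unfold level. intros H.
  replace (- Im (x + tau) / Im tau)%R with (- Im x / Im tau - 1)%R
    by (unfold Im in *; simpl; field; lra).
  set (r := (- Im x / Im tau)%R) in *.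
  assert (E : up (r - 1) = (up r - 1)%Z).
  { symmetry. destruct (archimed r) as [H1 H2]. apply tech_up; rewrite minus_IZR; lra. }
  rewrite E. lia.
Qed.

Lemma level_1 x : level (x + 1) = level x.
Proof.
  unfold level. replace (Im (x + 1)) with (Im x); [reflexivity |]. unfold Im; simpl; ring.
Qed.

(** The continuation of [fun x => qseries n (e2pi x)] from the upper half
    plane to the plane by its functional equation [qcont_rec]. *)
Fixpoint qcont (n : nat) (x : C) : C :=
  match n with
  | O => e2pi x / (1 - e2pi x)
  | S n' => psum (fun i => qcont n' (x + RtoC (INR i) * tau)) (level x)
            + qseries n (e2pi (x + RtoC (INR (level x)) * tau))
  end.

Lemma qcont_upper n x : (0 < Im x)%R -> qcont n x = qseries n (e2pi x).
Proof.
  intros Hx. destruct n as [| n].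
  - simpl. symmetry. apply qseries_0. now apply Cmod_e2pi_lt_1.
  - simpl qcont. rewrite level_0 by exact Hx. simpl psum. simpl INR.
    rewrite Cplus_0_l. f_equal. f_equal. ring.
Qed.

Lemma psum_shift (a : nat -> C) N : psum a (S N) = a 0%nat + psum (fun k => a (S k)) N.
Proof. induction N as [| N IH]; [simpl; ring |]. simpl in *. rewrite IH. ring. Qed.

(** At level 0 this is [qseries_rec]; at a higher level both sides stop at
    the same point of the upper half plane. *)
Lemma qcont_rec n x : qcont (S n) x = qcont n x + qcont (S n) (x + tau).
Proof.
  destruct (level x) as [| m] eqn:E.
  - pose proof (level_pos x E) as Hx.
    assert (Hxt : (0 < Im (x + tau))%R) by (unfold Im in *; simpl; lra).
    rewrite !qcont_upper by assumption. rewrite e2pi_plus. fold q.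
    rewrite <- (qseries_rec n (e2pi x)) by now apply Cmod_e2pi_lt_1. ring.
  - simpl qcont. rewrite (level_shift x m E), E, psum_shift.
    replace (x + RtoC (INR 0) * tau) with x by (simpl; ring).
    replace (x + tau + RtoC (INR m) * tau) with (x + RtoC (INR (S m)) * tau)
      by (rewrite S_INR, RtoC_plus; ring).
    rewrite (psum_ext (fun k => qcont n (x + RtoC (INR (S k)) * tau))
                      (fun k => qcont n (x + tau + RtoC (INR k) * tau))).
    + ring.
    + intros k. f_equal. rewrite S_INR, RtoC_plus. ring.
Qed.

Lemma e2pi_add_1 x : e2pi (x + 1) = e2pi x.
Proof. rewrite e2pi_plus, e2pi_1. ring. Qed.

Lemma qcont_period n : forall x, qcont n (x + 1) = qcont n x.
Proof.
  induction n as [| n IH]; intros x.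
  - simpl. now rewrite e2pi_add_1.
  - simpl qcont. rewrite level_1. f_equal.
    + apply psum_ext. intros k. rewrite <- (IH (x + RtoC (INR k) * tau)). f_equal. ring.
    + f_equal. rewrite <- (e2pi_add_1 (x + RtoC (INR (level x)) * tau)). f_equal. ring.
Qed.

Lemma e2pi_eq_1 x : e2pi x = 1 -> exists k : Z, x = RtoC (IZR k).
Proof.
  intros H.
  assert (HI : Im x = 0%R).
  { pose proof (f_equal Cmod H) as HC. rewrite Cmod_e2pi, Cmod_1, <- exp_0 in HC.
    apply exp_inv in HC. pose proof PI_RGT_0. nra. }
  destruct x as [x y]. unfold Im in HI. simpl in HI. subst y.
  apply (f_equal fst) in H.
  unfold e2pi, twopii, cexp, Cmult, Ci, RtoC, Re, Im in H. simpl in H.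
  replace ((2 * PI * 0 - 0 * 1) * x - (2 * PI * 1 + 0 * 0) * 0)%R with 0%R in H by ring.
  replace ((2 * PI * 0 - 0 * 1) * 0 + (2 * PI * 1 + 0 * 0) * x)%R with (2 * (PI * x))%R in H by ring.
  rewrite exp_0 in H.
  assert (Hs : sin (PI * x) = 0%R).
  { assert (Hc : (cos (2 * (PI * x)) = 1)%R) by lra.
    rewrite cos_2a_sin in Hc.
    assert (sin (PI * x) * sin (PI * x) = 0)%R by lra.
    apply Rmult_integral in H0. tauto. }
  destruct (sin_eq_0_0 _ Hs) as [k Hk]. exists k. unfold RtoC. f_equal.
  pose proof PI_RGT_0. apply (Rmult_eq_reg_l PI); lra.
Qed.

Lemma nbhd_neq (f : C -> C) (z c : C) : cont_at f z -> f z <> c -> nbhd z (fun w => f w <> c).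
Proof.
  intros Hc Hne. apply Cminus_neq_0 in Hne.
  assert (H : tends (nbhd z) (fun w => f w - c) (f z - c)) by (unfold cont_at in Hc; tends_tac).
  generalize (tends_away_from_0 (nbhd z) _ _ Hne H). apply filter_imp. intros w Hw E.
  rewrite E in Hw. replace (c - c) with (RtoC 0) in Hw by ring. rewrite Cmod_0 in Hw.
  apply Cmod_pos in Hne. lra.
Qed.

(** 1 - e2pi x = x g(x) with g holomorphic and g(0) = - 2 pi i. *)
Lemma simple_pole_qcont_0_at_0 : simple_pole (qcont 0) 0 (- / twopii).
Proof.
  destruct (divide (fun x => 1 - e2pi x) 0 1 Rlt_0_1) as [g [Hg Eg]].
  { intros z _. apply diff_minus; [apply diff_const | apply diff_e2pi]. }
  assert (Dg : forall z, diff_at g z).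
  { intros z. apply Hg. apply diff_minus; [apply diff_const | apply diff_e2pi]. }
  assert (E0 : forall x, 1 - e2pi x = x * g x).
  { intros x. rewrite (Eg x), e2pi_0. ring. }
  assert (G0 : g 0 = - twopii).
  { assert (Hd : has_deriv (fun x => 1 - e2pi x) 0 (- twopii)).
    { destruct (deriv_e2pi 0) as [phi [H1 [H2 H3]]]. exists (fun x => - phi x). split; [| split].
      - intros w. transitivity (- (e2pi w - e2pi 0)); [ring |]. rewrite H1. ring.
      - unfold cont_at in *. apply tends_opp; [typeclasses eauto | exact H2].
      - rewrite H3, e2pi_0. ring. }
    destruct Hd as [phi [H1 [H2 H3]]]. rewrite <- H3.
    refine (tends_unique (nbhd' 0) g _ _ _ _).
    - apply tends_nbhd', diff_cont, Dg.
    - apply (tends_ext_loc (nbhd' 0) phi).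
      + generalize (nbhd'_ne 0). apply filter_imp. intros w Hw.
        specialize (H1 w). rewrite e2pi_0, E0 in H1.
        replace (phi w) with (phi w * (w - 0) / w) by (field; exact Hw).
        rewrite <- H1. field. exact Hw.
      + apply tends_nbhd'. exact H2. }
  assert (Hne : nbhd 0 (fun x => g x <> 0)).
  { apply nbhd_neq; [apply diff_cont, Dg |]. rewrite G0. intros E. apply twopii_neq_0.
    replace twopii with (- - twopii) by ring. rewrite E. ring. }
  pose proof Hne as Hne'. apply nbhd_Cmod in Hne'. destruct Hne' as [d [Hd Hd']].
  destruct (divide (fun x => e2pi x / g x) 0 d Hd) as [h [Hh Eh]].
  { intros z Hz. apply diff_mult; [apply diff_e2pi |]. apply diff_inv; [apply Dg | now apply Hd']. }
  exists h. split.
  - revert Hne. apply filter_imp. intros z Hz. apply Hh.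
    apply diff_mult; [apply diff_e2pi |]. apply diff_inv; [apply Dg | exact Hz].
  - apply (filter_and2 _ _ _ _ (nbhd'_ne 0) (nbhd_nbhd' _ _ Hne)). intros x Hx Hgx.
    simpl qcont. rewrite E0. specialize (Eh x). rewrite e2pi_0, G0 in Eh.
    replace (e2pi x / (x * g x)) with (e2pi x / g x / x) by (field; split; assumption).
    rewrite Eh. pose proof twopii_neq_0. replace (x - 0) with x by ring. field. split; assumption.
Qed.

Lemma Lambda_Z k : Lambda tau (RtoC (IZR k)).
Proof. exists k, 0%Z. ring. Qed.

Lemma simple_pole_qcont_0 x0 : exists r, simple_pole (qcont 0) x0 r /\ (r <> 0 -> Lambda tau x0).
Proof.
  destruct (Ceq_dec (e2pi x0) 1) as [E | Hne].
  - apply e2pi_eq_1 in E. destruct E as [k ->]. exists (- / twopii).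
    split; [| intros _; apply Lambda_Z].
    apply (simple_pole_ext_loc (fun x => qcont 0 (x + - RtoC (IZR k)))).
    + apply filter_forall. intros x. simpl. rewrite e2pi_plus, e2pi_opp, e2pi_IZR.
      replace (e2pi x * / 1) with (e2pi x) by field. reflexivity.
    + apply simple_pole_shift. replace (RtoC (IZR k) + - RtoC (IZR k)) with (RtoC 0) by ring.
      apply simple_pole_qcont_0_at_0.
  - exists 0. split; [| congruence]. apply simple_pole_hol.
    generalize (nbhd_neq e2pi x0 1 (diff_cont _ _ (diff_e2pi x0)) Hne). apply filter_imp.
    intros z Hz. simpl. apply diff_mult; [apply diff_e2pi |].
    apply diff_inv; [apply diff_minus; [apply diff_const | apply diff_e2pi] |].
    apply Cminus_neq_0. congruence.
Qed.

Lemma nbhd_Im_pos x0 : (0 < Im x0)%R -> nbhd x0 (fun x => (0 < Im x)%R).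
Proof.
  intros H. apply nbhd_Cmod. exists (Im x0). split; [exact H |]. intros w Hw.
  assert (B : (Rabs (Im w - Im x0) <= Cmod (w - x0))%R).
  { eapply Rle_trans; [| apply Rmax_Cmod]. eapply Rle_trans; [| apply Rmax_r].
    right. reflexivity. }
  pose proof (Rle_abs (- (Im w - Im x0))). rewrite Rabs_Ropp in H0. lra.
Qed.

Lemma qcont_hol_upper n x0 : (0 < Im x0)%R -> nbhd x0 (diff_at (qcont n)).
Proof.
  intros H. pose proof (nbhd_Im_pos x0 H) as HI. generalize (nbhd_nbhd _ _ HI).
  apply filter_imp. intros x Hx.
  apply (diff_ext_loc (fun x => qseries n (e2pi x))).
  - revert Hx. apply filter_imp. intros z Hz. symmetry. now apply qcont_upper.
  - apply (diff_comp e2pi (qseries n)); [apply diff_e2pi |]. apply qseries_diff.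
    apply Cmod_e2pi_lt_1. now apply nbhd_here in Hx.
Qed.

(** The recursion carries the poles downwards from the upper half plane,
    where there are none. *)
Lemma simple_pole_qcont n : forall x0, exists r, simple_pole (qcont n) x0 r /\ (r <> 0 -> Lambda tau x0).
Proof.
  induction n as [| n IH]; [apply simple_pole_qcont_0 |].
  assert (Hj : forall j x0, level x0 = j ->
     exists r, simple_pole (qcont (S n)) x0 r /\ (r <> 0 -> Lambda tau x0)).
  { induction j as [| j IHj]; intros x0 Hx.
    - exists 0. split; [| congruence]. apply simple_pole_hol, qcont_hol_upper. now apply level_pos.
    - destruct (IH x0) as [r [Hr Lr]].
      destruct (IHj (x0 + tau) (level_shift _ _ Hx)) as [s [Hs Ls]].
      exists (r + s). split.
      + apply (simple_pole_ext_loc (fun x => qcont n x + qcont (S n) (x + tau))).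
        * apply filter_forall. intros x. now rewrite <- qcont_rec.
        * apply simple_pole_plus; [exact Hr | now apply simple_pole_shift].
      + intros Hne. destruct (Ceq_dec r 0) as [-> | Hr0]; [| now apply Lr].
        apply Lambda_shift, Ls. intros ->. apply Hne. ring. }
  intros x0. now apply (Hj (level x0)).
Qed.

(** The recursion changes [qcont n] by a function holomorphic at 0. *)
Lemma simple_pole_qcont_at_0 n : simple_pole (qcont n) 0 (- / twopii).
Proof.
  induction n as [| n IH]; [apply simple_pole_qcont_0_at_0 |].
  apply (simple_pole_ext_loc (fun x => qcont n x + qcont (S n) (x + tau))).
  - apply filter_forall. intros x. now rewrite <- qcont_rec.
  - eapply simple_pole_eq; [apply simple_pole_plus; [exact IH |] |].
    + apply simple_pole_shift. apply simple_pole_hol, qcont_hol_upper. now rewrite Cplus_0_l.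
    + ring.
Qed.

(** The n-th convolution power of [Z]. The second summand comes from the
    negative frequencies, since w^(-k) / (1 - q^(-k))^n = (-1)^n (q^n / w)^k
    / (1 - q^k)^n. For n = 0 the function is 0 outside the integers, so
    recursions in n can start there. *)
Definition Zconv (n : nat) (x : C) : C :=
  (- twopii / 2) ^ n
  + (- twopii) ^ n * (qcont n x + (- (1)) ^ n * qcont n (RtoC (INR n) * tau - x)).

(** [qcont_rec] at x for the first summand and at n tau - x for the second. *)
Lemma Zconv_Delta n x : Zconv (S n) (x + tau) - Zconv (S n) x = twopii * (Zconv n x - (- twopii / 2) ^ n).
Proof.
  unfold Zconv. rewrite S_INR, RtoC_plus.
  rewrite (qcont_rec n x).
  pose proof (qcont_rec n (RtoC (INR n) * tau - x)) as H.
  replace ((RtoC (INR n) + 1) * tau - (x + tau)) with (RtoC (INR n) * tau - x) by ring.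
  replace ((RtoC (INR n) + 1) * tau - x) with (RtoC (INR n) * tau - x + tau) by ring.
  rewrite H. simpl Cpow. ring.
Qed.

Lemma qcont_0_sum x : e2pi x <> 1 -> qcont 0 x + qcont 0 (- x) = - (1).
Proof.
  intros H. simpl. rewrite e2pi_opp. pose proof (e2pi_neq_0 x) as H0.
  assert (H1 : 1 - e2pi x <> 0) by (apply Cminus_neq_0; congruence).
  assert (H2 : e2pi x - 1 <> 0) by now apply Cminus_neq_0.
  field. repeat split; assumption.
Qed.

Lemma e2pi_near_neq_1 x0 : nbhd' x0 (fun x => e2pi x <> 1).
Proof.
  destruct (Ceq_dec (e2pi x0) 1) as [E | Hne].
  - apply nbhd'_Cmod. exists 1%R. split; [lra |]. intros w Hw Hne E'.
    apply e2pi_eq_1 in E. apply e2pi_eq_1 in E'. destruct E as [j ->], E' as [k ->].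
    rewrite <- RtoC_minus, Cmod_R, <- minus_IZR, <- abs_IZR in Hw.
    apply lt_IZR in Hw. apply Hne. do 2 f_equal. lia.
  - apply nbhd_nbhd'. apply nbhd_neq; [apply diff_cont, diff_e2pi | exact Hne].
Qed.

Lemma Zconv_0 : mer_eq (Zconv 0) (fun _ => 0).
Proof.
  intros x0. generalize (e2pi_near_neq_1 x0). apply (filter_imp (F := nbhd' x0)). intros x Hx.
  unfold Zconv. simpl Cpow. simpl INR.
  replace (RtoC 0 * tau - x) with (- x) by ring.
  rewrite !Cmult_1_l, (qcont_0_sum x Hx). ring.
Qed.

Lemma Zconv_period n x : Zconv n (x + 1) = Zconv n x.
Proof.
  unfold Zconv. rewrite qcont_period. do 4 f_equal.
  rewrite <- (qcont_period n (RtoC (INR n) * tau - (x + 1))). f_equal. ring.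
Qed.

Lemma Lambda_reflect n x0 : Lambda tau (RtoC (INR n) * tau - x0) -> Lambda tau x0.
Proof.
  intros [a [b H]]. exists (- a)%Z, (Z.of_nat n - b)%Z.
  rewrite opp_IZR, minus_IZR, <- INR_IZR_INZ, RtoC_opp, RtoC_minus.
  replace x0 with (RtoC (INR n) * tau - (RtoC (INR n) * tau - x0)) by ring. rewrite H. ring.
Qed.

Lemma simple_pole_Zconv n x0 : exists r, simple_pole (Zconv n) x0 r /\ (r <> 0 -> Lambda tau x0).
Proof.
  destruct (simple_pole_qcont n x0) as [r [Hr Lr]].
  destruct (simple_pole_qcont n (RtoC (INR n) * tau - x0)) as [s [Hs Ls]].
  exists (0 + (- twopii) ^ n * (r + (- (1)) ^ n * - s)). split.
  - unfold Zconv. apply simple_pole_plus; [apply simple_pole_const |]. apply simple_pole_scal, simple_pole_plus; [exact Hr |].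
    apply simple_pole_scal. now apply (simple_pole_reflect (qcont n)).
  - intros Hne. destruct (Ceq_dec r 0) as [-> | Hr0]; [| now apply Lr].
    apply (Lambda_reflect n), Ls. intros ->. apply Hne. ring.
Qed.

Lemma Zconv_Delta_mer n :
  mer_eq (Delta tau (Zconv (S n))) (fun x => twopii * Zconv n x + - (twopii * (- twopii / 2) ^ n)).
Proof. apply mer_eq_of_eq. intros x. unfold Delta. rewrite Zconv_Delta. ring. Qed.

(** [Delta] lowers the index by one, and [Zconv 0] is 0. *)
Lemma Vsimple_Zconv n : Vsimple tau (Zconv n).
Proof.
  induction n as [| n IH].
  - apply (Vsimple_mer_eq tau (fun _ => 0)); [apply mer_eq_sym, Zconv_0 | apply Vsimple_const].
  - split; [intros x0; apply simple_pole_Zconv | split].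
    + apply mer_eq_of_eq. intros x. apply Zconv_period.
    + assert (HV : Vsimple tau (Delta tau (Zconv (S n)))).
      { eapply Vsimple_mer_eq; [apply mer_eq_sym, Zconv_Delta_mer |].
        apply Vsimple_plus; [now apply Vsimple_scal | apply Vsimple_const]. }
      destruct HV as [_ [_ [k Hk]]]. exists (S k).
      change (S k) with (1 + k)%nat. rewrite Nat.add_comm, Nat.iter_add. exact Hk.
Qed.

Lemma simple_pole_Zconv_at_0 n : simple_pole (Zconv (S n)) 0 ((- twopii) ^ n).
Proof.
  unfold Zconv.
  assert (H : simple_pole (fun x => qcont (S n) (RtoC (INR (S n)) * tau - x)) 0 (- 0)).
  { apply simple_pole_reflect, simple_pole_hol, qcont_hol_upper.
    replace (RtoC (INR (S n)) * tau - 0) with (RtoC (INR (S n)) * tau) by ring.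
    replace (Im (RtoC (INR (S n)) * tau)) with (INR (S n) * Im tau)%R
      by (unfold Im, RtoC, Cmult; simpl; ring).
    apply Rmult_lt_0_compat; [apply lt_0_INR; lia | exact Htau]. }
  eapply simple_pole_eq.
  - apply simple_pole_plus; [apply simple_pole_const |]. apply simple_pole_scal, simple_pole_plus; [apply simple_pole_qcont_at_0 |].
    apply simple_pole_scal, H.
  - simpl Cpow. pose proof twopii_neq_0. field. assumption.
Qed.

Lemma gbinom_0 a : gbinom a 0 = 1%R.
Proof. unfold gbinom. simpl. field. Qed.

Lemma falling_pascal a r : falling (a + 1) (S r) = (falling a (S r) + INR (S r) * falling a r)%R.
Proof.
  induction r as [| r IH]; [simpl; ring |].
  change (falling (a + 1) (S (S r))) with (falling (a + 1) (S r) * (a + 1 - INR (S r)))%R.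
  rewrite IH. change (falling a (S (S r))) with (falling a (S r) * (a - INR (S r)))%R.
  change (falling a (S r)) with (falling a r * (a - INR r))%R. rewrite !S_INR. ring.
Qed.

Lemma gbinom_pascal a r : gbinom (a + 1) (S r) = (gbinom a (S r) + gbinom a r)%R.
Proof.
  unfold gbinom. rewrite falling_pascal, fact_simpl, mult_INR.
  pose proof (INR_fact_neq_0 r). pose proof (not_0_INR (S r) ltac:(lia)). field. split; assumption.
Qed.

Lemma gbinom_m1 r : gbinom (-1) r = ((-1) ^ r)%R.
Proof.
  induction r as [| r IH]; [apply gbinom_0 |].
  pose proof (gbinom_pascal (-1) r) as H. replace (-1 + 1)%R with 0%R in H by ring.
  assert (Z : gbinom 0 (S r) = 0%R).
  { unfold gbinom.
    assert (F : falling 0 (S r) = 0%R).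
    { clear. induction r as [| r IH]; [simpl; ring |].
      change (falling 0 (S (S r))) with (falling 0 (S r) * (0 - INR (S r)))%R.
      rewrite IH. ring. }
    rewrite F. unfold Rdiv. ring. }
  rewrite Z, IH in H. simpl. lra.
Qed.

(** By [Zconv_Delta], passing from m to m + 1 adds 2 pi i times the residue
    of the preceding power, which is Pascal's rule. At m = 0 only the first
    summand of [Zconv] has a pole. *)
Lemma simple_pole_Zconv_at n m : simple_pole (Zconv (S n)) (RtoC (INR m) * tau) (twopii ^ n * RtoC (gbinom (INR m - 1) n)).
Proof.
  revert n. induction m as [| m IH]; intros n.
  - simpl INR. replace (0 * tau) with (RtoC 0) by ring.
    eapply simple_pole_eq; [apply simple_pole_Zconv_at_0 |].
    replace (0 - 1)%R with (-1)%R by ring. rewrite gbinom_m1, RtoC_pow, <- Cpow_mult_l.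
    f_equal. replace (RtoC (-1)) with (- (1)) by (rewrite <- RtoC_opp; f_equal; ring). ring.
  - assert (Hs : simple_pole (fun x => Zconv (S n) (x + tau)) (RtoC (INR m) * tau)
                  (twopii ^ n * RtoC (gbinom (INR (S m) - 1) n))).
    { apply (simple_pole_ext_loc (fun x => Zconv (S n) x + twopii * (Zconv n x + - (- twopii / 2) ^ n))).
      - apply filter_forall. intros x.
        transitivity (Zconv (S n) x + (Zconv (S n) (x + tau) - Zconv (S n) x)); [rewrite Zconv_Delta |]; ring.
      - destruct n as [| n].
        + eapply simple_pole_eq; [apply simple_pole_plus; [apply IH |] |].
          * apply simple_pole_scal, simple_pole_plus; [| apply simple_pole_const].
            apply (simple_pole_mer_eq (fun _ => 0)); [apply mer_eq_sym, Zconv_0 | apply simple_pole_const].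
          * rewrite !gbinom_0. ring.
        + eapply simple_pole_eq; [apply simple_pole_plus; [apply IH |] |].
          * apply simple_pole_scal, simple_pole_plus; [apply IH | apply simple_pole_const].
          * rewrite S_INR. replace (INR m + 1 - 1)%R with (INR m - 1 + 1)%R by ring.
            rewrite gbinom_pascal, RtoC_plus. simpl Cpow. ring. }
    apply (simple_pole_ext_loc (fun x => (fun y => Zconv (S n) (y + tau)) (x + - tau))).
    + apply filter_forall. intros x. f_equal. ring.
    + apply (simple_pole_shift (fun y => Zconv (S n) (y + tau)) _ (- tau)).
      replace (RtoC (INR (S m)) * tau + - tau) with (RtoC (INR m) * tau)
        by (rewrite S_INR, RtoC_plus; ring).
      exact Hs.
Qed.

(** By the recursion, the reflection exchanges the two summands up to
    [qcont 0 x + qcont 0 (- x) = - 1]. *)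
Lemma Zconv_1_odd x : e2pi x <> 1 -> Zconv 1 (- x) = - Zconv 1 x.
Proof.
  intros Hx. unfold Zconv. simpl Cpow. simpl INR.
  replace (1 * tau - - x) with (x + tau) by ring.
  replace (1 * tau - x) with (- x + tau) by ring.
  pose proof (qcont_rec 0 x) as H1. pose proof (qcont_rec 0 (- x)) as H2.
  pose proof (qcont_0_sum x Hx) as H3. rewrite H1, H2.
  assert (H4 : qcont 0 (- x) = - (1) - qcont 0 x) by (rewrite <- H3; ring).
  rewrite H4. field.
Qed.
End Explicit.

(** * Convolution of Fourier series *)

Lemma ex_CInt_mult f g : (forall t, rcont_at f t) -> (forall t, rcont_at g t) -> ex_CInt (fun t => f t * g t) 0 1.
Proof.
  intros Hf Hg. apply ex_CInt_cont; [lra |]. intros t _. unfold rcont_at.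
  apply tends_mult; [typeclasses eauto | apply Hf | apply Hg].
Qed.

Lemma CInt_plus4 a b c d : ex_CInt a 0 1 -> ex_CInt b 0 1 -> ex_CInt c 0 1 -> ex_CInt d 0 1 ->
  CInt (fun t => (a t + b t) + (c t + d t)) 0 1
  = (CInt a 0 1 + CInt b 0 1) + (CInt c 0 1 + CInt d 0 1).
Proof.
  intros Ha Hb Hc Hd.
  rewrite (CInt_plus (fun t => a t + b t) (fun t => c t + d t)) by now apply ex_CInt_plus.
  rewrite (CInt_plus a b) by assumption. now rewrite (CInt_plus c d) by assumption.
Qed.

Lemma rcont_psum (f : nat -> R -> C) N t : (forall k, rcont_at (f k) t) ->
  rcont_at (fun t => psum (fun k => f k t) N) t.
Proof.
  intros H. induction N as [| N IH]; simpl.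
  - apply tends_const. typeclasses eauto.
  - unfold rcont_at in *. apply tends_plus; [typeclasses eauto | exact IH | apply H].
Qed.

Lemma CInt_psum_mult (f : nat -> R -> C) (h : R -> C) N :
  (forall k t, rcont_at (f k) t) -> (forall t, rcont_at h t) ->
  CInt (fun t => psum (fun k => f k t) N * h t) 0 1 = psum (fun k => CInt (fun t => f k t * h t) 0 1) N.
Proof.
  intros Hf Hh. induction N as [| N IH]; simpl.
  - rewrite (CInt_ext _ (fun _ => 0)); [rewrite CInt_const; ring | lra | intros; ring].
  - rewrite <- IH, <- CInt_plus.
    + apply CInt_ext; [lra |]. intros t _. ring.
    + apply ex_CInt_mult; [| exact Hh]. intros t. apply rcont_psum. auto.
    + apply ex_CInt_mult; auto.
Qed.

Section Blocks.
Variables (f g : R -> C) (fk gk : nat -> R -> C) (s : nat -> C) (K rho : R).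
Hypothesis Hrho : (0 <= rho < 1)%R.
Hypothesis Cf : forall t, rcont_at f t.
Hypothesis Cg : forall t, rcont_at g t.
Hypothesis Cfk : forall k t, rcont_at (fk k) t.
Hypothesis Cgk : forall k t, rcont_at (gk k) t.
Hypothesis Bf : forall k t, (Cmod (fk k t) <= K * rho ^ k)%R.
Hypothesis Bg : forall k t, (Cmod (gk k t) <= K * rho ^ k)%R.
Hypothesis Sf : forall t, csum (fun k => fk k t) (f t).
Hypothesis Sg : forall t, csum (fun k => gk k t) (g t).
Hypothesis Orth : forall j k, j <> k -> CInt (fun t => fk j t * gk k t) 0 1 = 0.
Hypothesis Diag : forall k, CInt (fun t => fk k t * gk k t) 0 1 = s k.

Let F (N : nat) (t : R) : C := psum (fun k => fk k t) N.
Let G (N : nat) (t : R) : C := psum (fun k => gk k t) N.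

Lemma psum_zero (a : nat -> C) N : (forall k, (k < N)%nat -> a k = 0) -> psum a N = 0.
Proof.
  induction N as [| N IH]; simpl; intros H; [reflexivity |].
  rewrite IH by (intros; apply H; lia). rewrite H by lia. ring.
Qed.

Lemma CInt_partial N : CInt (fun t => F N t * G N t) 0 1 = psum s N.
Proof.
  assert (CF : forall N t, rcont_at (F N) t) by (intros; apply rcont_psum; auto).
  assert (CG : forall N t, rcont_at (G N) t) by (intros; apply rcont_psum; auto).
  induction N as [| N IH].
  - simpl. rewrite (CInt_ext _ (fun _ => 0)); [rewrite CInt_const; ring | lra |].
    intros. unfold F. simpl. ring.
  - simpl psum. rewrite <- IH, <- Diag.
    assert (E1 : CInt (fun t => F N t * gk N t) 0 1 = 0).
    { unfold F. rewrite (CInt_psum_mult fk (gk N)) by auto. apply psum_zero.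
      intros k Hk. apply Orth. lia. }
    assert (E2 : CInt (fun t => G N t * fk N t) 0 1 = 0).
    { unfold G. rewrite (CInt_psum_mult gk (fk N)) by auto. apply psum_zero.
      intros k Hk. rewrite (CInt_ext _ (fun t => fk N t * gk k t)); [apply Orth; lia | lra |].
      intros; ring. }
    rewrite (CInt_ext _ (fun t => (F N t * G N t + F N t * gk N t)
                                + (G N t * fk N t + fk N t * gk N t))); [| lra |].
    + rewrite (CInt_plus4 (fun t => F N t * G N t) (fun t => F N t * gk N t)
                (fun t => G N t * fk N t) (fun t => fk N t * gk N t))
        by (apply ex_CInt_mult; auto).
      rewrite E1, E2. ring.
    + intros t _. unfold F, G. simpl. ring.
Qed.

(** Partial sums multiply diagonally, by orthogonality; the bounds make the
    convergence uniform in t, which carries this over to the limit. *)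
Lemma CInt_blocks : csum s (CInt (fun t => f t * g t) 0 1).
Proof.
  set (M := (K / (1 - rho))%R).
  assert (HK : (0 <= K)%R) by (apply (geom_K (fun k => fk k 0%R) K rho); auto).
  assert (HM : (0 <= M)%R) by (apply Rdiv_le_0_compat; lra).
  assert (CF : forall N t, rcont_at (F N) t) by (intros; apply rcont_psum; auto).
  assert (CG : forall N t, rcont_at (G N) t) by (intros; apply rcont_psum; auto).
  intros eps He.
  assert (He' : (0 < eps / (2 * M + 1))%R) by (apply Rdiv_lt_0_compat; lra).
  destruct (geom_small (fun k => fk k 0%R) K rho Hrho (fun k => Bf k 0%R) _ He') as [N HN].
  exists N. intros n Hn. specialize (HN n Hn). fold M in HN.
  set (e := (M * rho ^ n)%R) in *.
  assert (He0 : (0 <= e)%R).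
  { unfold e. apply Rmult_le_pos; [exact HM |]. apply pow_le. lra. }
  rewrite <- CInt_partial, <- CInt_minus by (apply ex_CInt_mult; auto).
  apply Rle_lt_trans with ((1 - 0) * (M * e + e * M))%R.
  - apply CInt_bound; [lra | apply ex_CInt_minus; apply ex_CInt_mult; auto |].
    intros t _.
    replace (F n t * G n t - f t * g t)
      with (F n t * - (g t - G n t) + - (f t - F n t) * g t) by ring.
    eapply Rle_trans; [apply Cmod_triangle |]. rewrite !Cmod_mult, !Cmod_opp.
    assert (Tf : (Cmod (f t - F n t) <= e)%R) by (apply csum_geom_tail; auto).
    assert (Tg : (Cmod (g t - G n t) <= e)%R) by (apply csum_geom_tail; auto).
    assert (MF : (Cmod (F n t) <= M)%R) by (apply psum_geom_bound; auto).
    assert (MG : (Cmod (g t) <= M)%R).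
    { pose proof (csum_geom_tail (fun k => gk k t) K rho Hrho (fun k => Bg k t) (g t) 0 (Sg t)) as H.
      simpl in H. replace (g t - 0) with (g t) in H by ring. fold M in H. lra. }
    apply Rplus_le_compat; apply Rmult_le_compat; try apply Cmod_ge_0; assumption.
  - apply Rlt_le_trans with (eps / (2 * M + 1) * (2 * M + 1))%R; [| right; field; lra].
    nra.
Qed.
End Blocks.

Definition monomial (a : C) (m : Z) (c : C) (t : R) : C := a * e2pi (RtoC (IZR m) * RtoC t + c).

Lemma rcont_monomial a m c t : rcont_at (monomial a m c) t.
Proof.
  unfold monomial, rcont_at. apply tends_mult; [typeclasses eauto | apply tends_const; typeclasses eauto |].
  apply rcont_e2pi.
Qed.

Lemma CInt_mon2 a m c a' m' c' :
  CInt (fun t => monomial a m c t * monomial a' m' c' t) 0 1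
  = if Z.eq_dec (m + m') 0 then a * a' * e2pi (c + c') else 0.
Proof.
  rewrite (CInt_ext _ (fun t => a * a' * e2pi (RtoC (IZR (m + m')) * RtoC t + (c + c')))).
  - rewrite CInt_scal.
    + destruct (Z.eq_dec (m + m') 0) as [E | E].
      * rewrite E. rewrite (CInt_ext _ (fun _ => e2pi (c + c'))); [rewrite CInt_const | lra |].
        -- rewrite Rminus_0_r. ring.
        -- intros t _. f_equal. ring.
      * rewrite CInt_e2pi by exact E. ring.
    + apply ex_CInt_cont; [lra |]. intros; apply rcont_e2pi.
  - lra.
  - intros t _. unfold monomial. rewrite plus_IZR, RtoC_plus.
    replace ((RtoC (IZR m) + RtoC (IZR m')) * RtoC t + (c + c'))
      with ((RtoC (IZR m) * RtoC t + c) + (RtoC (IZR m') * RtoC t + c')) by ring.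
    rewrite (e2pi_plus (_ * _ + c)). ring.
Qed.

Lemma CInt_monomial_block a1 m1 c1 b1 n1 d1 a2 m2 c2 b2 n2 d2 :
  CInt (fun t => (monomial a1 m1 c1 t + monomial b1 n1 d1 t) * (monomial a2 m2 c2 t + monomial b2 n2 d2 t)) 0 1
  = (if Z.eq_dec (m1 + m2) 0 then a1 * a2 * e2pi (c1 + c2) else 0)
    + (if Z.eq_dec (m1 + n2) 0 then a1 * b2 * e2pi (c1 + d2) else 0)
    + ((if Z.eq_dec (n1 + m2) 0 then b1 * a2 * e2pi (d1 + c2) else 0)
       + (if Z.eq_dec (n1 + n2) 0 then b1 * b2 * e2pi (d1 + d2) else 0)).
Proof.
  rewrite (CInt_ext _ (fun t => (monomial a1 m1 c1 t * monomial a2 m2 c2 t + monomial a1 m1 c1 t * monomial b2 n2 d2 t)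
    + (monomial b1 n1 d1 t * monomial a2 m2 c2 t + monomial b1 n1 d1 t * monomial b2 n2 d2 t))); [| lra | intros; ring].
  rewrite (CInt_plus4 (fun t => monomial a1 m1 c1 t * monomial a2 m2 c2 t)
     (fun t => monomial a1 m1 c1 t * monomial b2 n2 d2 t) (fun t => monomial b1 n1 d1 t * monomial a2 m2 c2 t)
     (fun t => monomial b1 n1 d1 t * monomial b2 n2 d2 t))
    by (apply ex_CInt_mult; intros; apply rcont_monomial).
  now rewrite !CInt_mon2.
Qed.

Section Convolution.
Variable tau : C.
Hypothesis Htau : (0 < Im tau)%R.

(** The frequencies k and - k are kept together, which turns a two-sided
    Fourier series into an ordinary one. *)
Definition block (n : nat) (x : C) (k : nat) : C :=
  match k with
  | O => (- twopii / 2) ^ n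
  | S j => (- twopii) ^ n * (qterm tau n (e2pi x) j
             + (- (1)) ^ n * qterm tau n (e2pi (RtoC (INR n) * tau - x)) j)
  end.

Lemma csum_cons (a : nat -> C) s : csum (fun k => a (S k)) s -> csum a (a 0%nat + s).
Proof.
  intros H.
  assert (H' : tends eventually (fun N => psum a (S N)) (a 0%nat + s)).
  { apply (tends_ext eventually (fun N => a 0%nat + psum (fun k => a (S k)) N)).
    - intros N. now rewrite psum_shift.
    - apply tends_plus; [typeclasses eauto | apply tends_const; typeclasses eauto | exact H]. }
  intros eps He. destruct (H' eps He) as [N HN]. exists (S N). intros n Hn.
  destruct n as [| n]; [lia |]. apply HN. lia.
Qed.

Lemma Im_reflect n x : Im (RtoC (INR n) * tau - x) = (INR n * Im tau - Im x)%R.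
Proof. unfold Im, RtoC, Cmult, Cminus, Cplus, Copp; simpl. ring. Qed.

Lemma block_csum n x : (0 < Im x < INR n * Im tau)%R -> csum (block n x) (Zconv tau n x).
Proof.
  intros Hx. unfold Zconv.
  assert (Hy : (0 < Im (RtoC (INR n) * tau - x))%R) by (rewrite Im_reflect; lra).
  rewrite !qcont_upper by (assumption || lra).
  apply (csum_cons (block n x)). simpl block.
  apply csum_scal, csum_plus; [| apply csum_scal]; apply qseries_csum; try exact Htau;
    apply Cmod_e2pi_lt_1; lra.
Qed.

Lemma block_bound n (y : R) : (0 < y < INR n * Im tau)%R ->
  exists K rho, (0 <= rho < 1)%R /\
    forall x k, Im x = y -> (Cmod (block n x k) <= K * rho ^ k)%R.
Proof.
  intros Hy.
  set (r1 := exp (- (2 * PI * y))). set (r2 := exp (- (2 * PI * (INR n * Im tau - y)))).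
  set (rho := Rmax r1 r2). pose proof PI_RGT_0 as HPI.
  assert (R1 : (0 < r1 < 1)%R).
  { split; [apply exp_pos |]. unfold r1. rewrite <- exp_0. apply exp_increasing. nra. }
  assert (R2 : (0 < r2 < 1)%R).
  { split; [apply exp_pos |]. unfold r2. rewrite <- exp_0. apply exp_increasing. nra. }
  assert (Hrho : (0 < rho < 1)%R).
  { unfold rho. split; [eapply Rlt_le_trans; [apply R1 | apply Rmax_l] | apply Rmax_lub_lt; lra]. }
  pose proof (delta_pos tau Htau) as Hd. set (d := (1 - Cmod (e2pi tau))%R) in *.
  assert (Hdn : (0 < / d ^ n)%R) by (apply Rinv_0_lt_compat, pow_lt; exact Hd).
  set (A := (Cmod twopii ^ n)%R). assert (HA : (0 <= A)%R) by (apply pow_le, Cmod_ge_0).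
  set (B := Cmod ((- twopii / 2) ^ n)). assert (HB : (0 <= B)%R) by apply Cmod_ge_0.
  exists (B + 2 * A * / d ^ n)%R, rho. split; [lra |].
  intros x k Hx. destruct k as [| j].
  - simpl. fold B. assert (0 <= 2 * A * / d ^ n)%R by (repeat apply Rmult_le_pos; lra). lra.
  - unfold block. rewrite Cmod_mult, Cmod_pow, Cmod_opp. fold A.
    assert (P1 : (Cmod (qterm tau n (e2pi x) j) <= rho / d ^ n * rho ^ j)%R).
    { apply (qterm_bound tau Htau). rewrite Cmod_e2pi, Hx. apply Rmax_l. }
    assert (P2 : (Cmod (qterm tau n (e2pi (RtoC (INR n) * tau - x)) j) <= rho / d ^ n * rho ^ j)%R).
    { apply (qterm_bound tau Htau). rewrite Cmod_e2pi, Im_reflect, Hx. apply Rmax_r. }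
    assert (P3 : (Cmod (qterm tau n (e2pi x) j + (- (1)) ^ n * qterm tau n (e2pi (RtoC (INR n) * tau - x)) j)
                  <= 2 * (rho / d ^ n * rho ^ j))%R).
    { eapply Rle_trans; [apply Cmod_triangle |].
      rewrite Cmod_mult, Cmod_pow, Cmod_m1, pow1, Rmult_1_l. lra. }
    apply Rle_trans with (A * (2 * (rho / d ^ n * rho ^ j)))%R; [now apply Rmult_le_compat_l |].
    assert (0 <= B * (rho * rho ^ j))%R.
    { apply Rmult_le_pos; [exact HB |]. apply Rmult_le_pos; [lra | apply pow_le; lra]. }
    simpl. unfold Rdiv. lra.
Qed.

Definition bcoef (n k : nat) : C :=
  match k with O => (- twopii / 2) ^ n | S j => (- twopii) ^ n / (1 - e2pi tau ^ S j) ^ n end.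

(** The second character of a block is dropped at k = 0, where both have
    frequency 0. *)
Definition bcoef' (n k : nat) : C :=
  match k with O => 0 | S j => (- (1)) ^ n * bcoef n k end.

(** The sign [s] is - 1 for the argument x - z and 1 for the argument z, when
    z = t + i y. *)
Lemma block_monomial n (s : Z) (w : C) k t :
  block n (RtoC (IZR s) * RtoC t + w) k = monomial (bcoef n k) (s * Z.of_nat k) (RtoC (INR k) * w) t
    + monomial (bcoef' n k) (- s * Z.of_nat k) (RtoC (INR k) * (RtoC (INR n) * tau - w)) t.
Proof.
  destruct k as [| j].
  - unfold monomial. simpl block. simpl bcoef. simpl bcoef'. simpl INR. simpl Z.of_nat.
    rewrite Z.mul_0_r. replace (0 * RtoC t + 0 * w) with (RtoC 0) by ring. rewrite e2pi_0. ring.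
  - unfold block, monomial, bcoef', bcoef, qterm. rewrite !e2pi_pow.
    rewrite !mult_IZR, !RtoC_mult, <- !INR_IZR_INZ, opp_IZR, RtoC_opp.
    set (k := S j). set (K := RtoC (INR k)). set (zeta_series := RtoC (IZR s)).
    replace (K * (zeta_series * RtoC t + w)) with (zeta_series * K * RtoC t + K * w) by ring.
    replace (K * (RtoC (INR n) * tau - (zeta_series * RtoC t + w)))
      with (- zeta_series * K * RtoC t + K * (RtoC (INR n) * tau - w)) by ring.
    unfold Cdiv. ring.
Qed.

Lemma block_product n (x w w' : C) k : x = w + w' ->
  CInt (fun t => block n (RtoC (IZR (-1)) * RtoC t + w) k * block 1 (RtoC (IZR 1) * RtoC t + w') k) 0 1
  = block (S n) x k.
Proof.
  intros ->.
  rewrite (CInt_ext _ (fun t =>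
    (monomial (bcoef n k) (-1 * Z.of_nat k) (RtoC (INR k) * w) t
     + monomial (bcoef' n k) (- -1 * Z.of_nat k) (RtoC (INR k) * (RtoC (INR n) * tau - w)) t)
    * (monomial (bcoef 1 k) (1 * Z.of_nat k) (RtoC (INR k) * w') t
     + monomial (bcoef' 1 k) (- 1 * Z.of_nat k) (RtoC (INR k) * (RtoC (INR 1) * tau - w')) t))).
  2: lra.
  2: { intros t _. rewrite !block_monomial. reflexivity. }
  rewrite CInt_monomial_block. destruct k as [| j].
  - simpl. replace (0 * w + 0 * w') with (RtoC 0) by ring. rewrite e2pi_0. ring.
  - destruct (Z.eq_dec (-1 * Z.of_nat (S j) + 1 * Z.of_nat (S j)) 0) as [_ |]; [| lia].
    destruct (Z.eq_dec (-1 * Z.of_nat (S j) + -1 * Z.of_nat (S j)) 0) as [|_]; [lia |].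
    destruct (Z.eq_dec (- -1 * Z.of_nat (S j) + 1 * Z.of_nat (S j)) 0) as [|_]; [lia |].
    destruct (Z.eq_dec (- -1 * Z.of_nat (S j) + -1 * Z.of_nat (S j)) 0) as [_|]; [| lia].
    unfold block, bcoef', bcoef, qterm. rewrite !e2pi_pow. rewrite (S_INR n), RtoC_plus.
    set (K := RtoC (INR (S j))). simpl (INR 1).
    replace (K * w + K * w') with (K * (w + w')) by ring.
    replace (K * (RtoC (INR n) * tau - w) + K * (1 * tau - w'))
      with (K * ((RtoC (INR n) + 1) * tau - (w + w'))) by ring.
    pose proof (one_minus_qk_neq_0 tau Htau j) as H.
    rewrite e2pi_pow in H. fold K in H. set (D := 1 - e2pi (K * tau)) in *.
    simpl Cpow. field. split; first [exact H | now apply Cpow_nz].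
Qed.

Lemma block_orth n (w w' : C) j k : j <> k ->
  CInt (fun t => block n (RtoC (IZR (-1)) * RtoC t + w) j * block 1 (RtoC (IZR 1) * RtoC t + w') k) 0 1
  = 0.
Proof.
  intros Hjk.
  rewrite (CInt_ext _ (fun t =>
    (monomial (bcoef n j) (-1 * Z.of_nat j) (RtoC (INR j) * w) t
     + monomial (bcoef' n j) (- -1 * Z.of_nat j) (RtoC (INR j) * (RtoC (INR n) * tau - w)) t)
    * (monomial (bcoef 1 k) (1 * Z.of_nat k) (RtoC (INR k) * w') t
     + monomial (bcoef' 1 k) (- 1 * Z.of_nat k) (RtoC (INR k) * (RtoC (INR 1) * tau - w')) t))).
  2: lra.
  2: { intros t _. rewrite !block_monomial. reflexivity. }
  rewrite CInt_monomial_block.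
  repeat destruct Z.eq_dec; try lia. ring.
Qed.

Lemma rcont_block n (s : Z) (w : C) k t : rcont_at (fun t => block n (RtoC (IZR s) * RtoC t + w) k) t.
Proof.
  unfold rcont_at.
  apply (tends_ext (nbR t) (fun t => monomial (bcoef n k) (s * Z.of_nat k) (RtoC (INR k) * w) t
    + monomial (bcoef' n k) (- s * Z.of_nat k) (RtoC (INR k) * (RtoC (INR n) * tau - w)) t)).
  - intros u. rewrite block_monomial. reflexivity.
  - rewrite (block_monomial n s w k t).
    apply tends_plus; [typeclasses eauto | |]; apply rcont_monomial.
Qed.

Lemma Zconv_diff_strip n x : (0 < Im x < INR n * Im tau)%R -> diff_at (Zconv tau n) x.
Proof.
  intros Hx. unfold Zconv. apply diff_plus; [apply diff_const |].
  apply diff_mult; [apply diff_const |]. apply diff_plus.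
  - apply (nbhd_here x (diff_at (qcont tau n))). apply qcont_hol_upper; [exact Htau | lra].
  - apply diff_mult; [apply diff_const |].
    apply (diff_comp (fun x => RtoC (INR n) * tau - x) (qcont tau n)); [diff_tac |].
    apply (nbhd_here _ (diff_at (qcont tau n))). apply qcont_hol_upper; [exact Htau |].
    rewrite Im_reflect. lra.
Qed.

Lemma rcont_Zconv_line n (s : Z) (w : C) t : (0 < Im w < INR n * Im tau)%R ->
  rcont_at (fun t => Zconv tau n (RtoC (IZR s) * RtoC t + w)) t.
Proof.
  intros Hw. apply (rcont_comp (Zconv tau n) (fun t => RtoC (IZR s) * RtoC t + w)).
  - eapply rderiv_rcont, rderiv_affine.
  - apply diff_cont, Zconv_diff_strip.
    replace (Im (RtoC (IZR s) * RtoC t + w)) with (Im w); [exact Hw |].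
    unfold Im, RtoC; simpl. ring.
Qed.

(** Convolution multiplies Fourier coefficients: on the contour both factors
    are given by their Fourier series. *)
Lemma conv_int_Zconv n x : (1 <= n)%nat -> (0 < Im x < 2 * Im tau)%R ->
  conv_int (Zconv tau n) (Zconv tau 1) x = Zconv tau (S n) x.
Proof.
  intros Hn Hx. set (y := (Im x / 2)%R).
  (* the contour is z = t + w', so that x - z = - t + w *)
  set (w' := Ci * RtoC y). set (w := x - w').
  assert (HIw' : Im w' = y) by (unfold w', Im, Ci, RtoC; simpl; ring).
  assert (HIw : Im w = y).
  { unfold w. replace (Im (x - w')) with (Im x - Im w')%R by (unfold Im; simpl; ring).
    rewrite HIw'. unfold y. field. }
  assert (Hn1 : (1 <= INR n)%R) by (apply (le_INR 1); exact Hn).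
  assert (Hy1 : (0 < y < INR 1 * Im tau)%R) by (simpl; unfold y; lra).
  assert (Hyn : (0 < y < INR n * Im tau)%R) by (unfold y; nra).
  destruct (block_bound n y Hyn) as [K1 [r1 [Hr1 B1]]].
  destruct (block_bound 1 y Hy1) as [K2 [r2 [Hr2 B2]]].
  assert (Eint : conv_int (Zconv tau n) (Zconv tau 1) x
     = CInt (fun t => Zconv tau n (RtoC (IZR (-1)) * RtoC t + w) * Zconv tau 1 (RtoC (IZR 1) * RtoC t + w')) 0 1).
  { apply (CInt_ext (fun t => Zconv tau n (x - (t, y)) * Zconv tau 1 (t, y))); [lra |].
    intros t _.
    assert (Ez : (t, y) = RtoC (IZR 1) * RtoC t + w').
    { unfold w', RtoC, Ci, Cmult, Cplus; simpl. f_equal; ring. }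
    rewrite Ez. f_equal. f_equal. unfold w.
    replace (RtoC (IZR (-1))) with (- (1)) by (rewrite <- RtoC_opp; f_equal; ring). ring. }
  rewrite Eint.
  apply (csum_unique (block (S n) x)).
  2: { apply block_csum. rewrite S_INR. nra. }
  assert (HIt : forall (s : Z) (v : C) t, Im (RtoC (IZR s) * RtoC t + v) = Im v).
  { intros s v t. unfold Im, RtoC; simpl. ring. }
  assert (HK1 : (0 <= K1)%R).
  { specialize (B1 w 0%nat HIw). simpl in B1. pose proof (Cmod_ge_0 ((- twopii / 2) ^ n)). lra. }
  assert (HK2 : (0 <= K2)%R).
  { specialize (B2 w 0%nat HIw). cbn [block pow] in B2.
    pose proof (Cmod_ge_0 ((- twopii / 2) ^ 1)). lra. }
  assert (Hrho : (0 <= Rmax r1 r2 < 1)%R).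
  { split; [eapply Rle_trans; [apply Hr1 | apply Rmax_l] | apply Rmax_lub_lt; lra]. }
  assert (Bnd : forall (K r b : R) k, (0 <= K)%R -> (K <= Rmax K1 K2)%R -> (0 <= r)%R ->
    (r <= Rmax r1 r2)%R -> (b <= K * r ^ k)%R -> (b <= Rmax K1 K2 * Rmax r1 r2 ^ k)%R).
  { intros K r b k HK HKM Hr HrM Hb. eapply Rle_trans; [exact Hb |].
    apply Rmult_le_compat; [exact HK | now apply pow_le | exact HKM |].
    apply pow_incr. now split. }
  apply (CInt_blocks _ _
    (fun k t => block n (RtoC (IZR (-1)) * RtoC t + w) k)
    (fun k t => block 1 (RtoC (IZR 1) * RtoC t + w') k)
    (block (S n) x) (Rmax K1 K2) (Rmax r1 r2)).
  - exact Hrho.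
  - intros t. apply (rcont_Zconv_line n (-1)). now rewrite HIw.
  - intros t. apply (rcont_Zconv_line 1 1). now rewrite HIw'.
  - intros k t. apply (rcont_block n (-1)).
  - intros k t. apply (rcont_block 1 1).
  - intros k t. apply (Bnd K1 r1); try apply Rmax_l; try lra. apply B1. now rewrite HIt.
  - intros k t. apply (Bnd K2 r2); try apply Rmax_r; try lra. apply B2. now rewrite HIt.
  - intros t. apply block_csum. now rewrite HIt, HIw.
  - intros t. apply block_csum. now rewrite HIt, HIw'.
  - intros j k Hjk. now apply block_orth.
  - intros k. apply block_product. unfold w. ring.
Qed.
End Convolution.

(** * Finite sums over lists *)

Section ListSums.
Context {X : Type}.

Definition lsum (f : X -> C) (l : list X) : C := fold_right (fun x s => f x + s) 0 l.
Definition rsum (v : X -> R) (l : list X) : R := fold_right (fun x s => (v x + s)%R) 0%R l.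

Lemma lsum_app f l l' : lsum f (l ++ l') = lsum f l + lsum f l'.
Proof. induction l as [| x l IH]; simpl; [ring | rewrite IH; ring]. Qed.

Lemma lsum_plus f g l : lsum (fun x => f x + g x) l = lsum f l + lsum g l.
Proof. induction l as [| x l IH]; simpl; [ring | rewrite IH; ring]. Qed.

Lemma lsum_scal c f l : lsum (fun x => c * f x) l = c * lsum f l.
Proof. induction l as [| x l IH]; simpl; [ring | rewrite IH; ring]. Qed.

Lemma lsum_ext f g l : (forall x, In x l -> f x = g x) -> lsum f l = lsum g l.
Proof.
  induction l as [| x l IH]; simpl; intros H; [reflexivity |].
  rewrite H, IH; auto.
Qed.

Lemma rsum_app v l l' : rsum v (l ++ l') = (rsum v l + rsum v l')%R.
Proof. induction l as [| x l IH]; simpl; [ring | rewrite IH; ring]. Qed.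

Lemma rsum_nonneg v l : (forall x, 0 <= v x)%R -> (0 <= rsum v l)%R.
Proof. intros H. induction l as [| x l IH]; simpl; [lra | specialize (H x); lra]. Qed.

Lemma rsum_le v w l : (forall x, In x l -> (v x <= w x)%R) -> (rsum v l <= rsum w l)%R.
Proof.
  induction l as [| x l IH]; simpl; intros H; [lra |].
  apply Rplus_le_compat; [apply H; auto | apply IH; auto].
Qed.

Lemma rsum_scal c v l : rsum (fun x => (c * v x)%R) l = (c * rsum v l)%R.
Proof. induction l as [| x l IH]; simpl; [ring | rewrite IH; ring]. Qed.

Lemma rsum_const (c : R) (l : list X) : rsum (fun _ => c) l = (INR (length l) * c)%R.
Proof.
  induction l as [| x l IH]; [simpl; ring |].
  change (length (x :: l)) with (S (length l)). rewrite S_INR. simpl. rewrite IH. ring.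
Qed.

Lemma Cmod_lsum f l : (Cmod (lsum f l) <= rsum (fun x => Cmod (f x)) l)%R.
Proof.
  induction l as [| x l IH]; simpl; [rewrite Cmod_0; lra |].
  eapply Rle_trans; [apply Cmod_triangle | lra].
Qed.

Lemma rsum_incl v (l l' : list X) : (forall x, 0 <= v x)%R -> NoDup l -> incl l l' ->
  (rsum v l <= rsum v l')%R.
Proof.
  intros Hv. revert l'. induction l as [| x l IH]; intros l' Hn Hi; simpl.
  - now apply rsum_nonneg.
  - destruct (in_split x l' (Hi x (or_introl eq_refl))) as [l1 [l2 ->]].
    inversion Hn as [| ? ? Hx Hl]; subst.
    assert (Hi' : incl l (l1 ++ l2)).
    { intros y Hy. specialize (Hi y (or_intror Hy)). apply in_app_or in Hi.
      apply in_or_app. destruct Hi as [Hi | [-> | Hi]]; [now left | contradiction | now right]. }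
    specialize (IH _ Hl Hi'). rewrite rsum_app in *. simpl. lra.
Qed.

Variable dec : forall x y : X, {x = y} + {x <> y}.

Lemma lsum_remove f p l : NoDup l -> In p l -> lsum f l = f p + lsum f (remove dec p l).
Proof.
  induction l as [| x l IH]; intros Hn Hi; [destruct Hi |].
  inversion Hn as [| ? ? Hx Hl]; subst. simpl. destruct (dec p x) as [<- | Hne].
  - now rewrite notin_remove.
  - simpl. rewrite IH; [ring | exact Hl |]. destruct Hi; congruence.
Qed.

Lemma lsum_split f (l l' : list X) : NoDup l -> NoDup l' -> incl l l' ->
  exists r, NoDup r /\ incl r l' /\ (forall x, In x r -> ~ In x l) /\
    lsum f l' = lsum f l + lsum f r /\ forall v, rsum v l' = (rsum v l + rsum v r)%R.
Proof.
  revert l'. induction l as [| x l IH]; intros l' Hn Hn' Hi.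
  - exists l'. split; [exact Hn' |]. split; [intros y Hy; exact Hy |]. split; [auto |].
    split; [simpl; ring | intros v; simpl; ring].
  - destruct (in_split x l' (Hi x (or_introl eq_refl))) as [l1 [l2 ->]].
    inversion Hn as [| ? ? Hx Hl]; subst.
    assert (Hi' : incl l (l1 ++ l2)).
    { intros y Hy. specialize (Hi y (or_intror Hy)). apply in_app_or in Hi.
      apply in_or_app. destruct Hi as [Hi | [-> | Hi]]; [now left | contradiction | now right]. }
    destruct (NoDup_remove _ _ _ Hn') as [Hn2 Hx2].
    destruct (IH _ Hl Hn2 Hi') as [r [H1 [H2 [H3 [H4 H5]]]]].
    exists r. split; [exact H1 |]. split; [| split; [| split]].
    + intros y Hy. specialize (H2 y Hy). apply in_app_or in H2. apply in_or_app.
      simpl. tauto.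
    + intros y Hy [-> | Hyl]; [apply Hx2; now apply H2 | now apply (H3 y)].
    + rewrite lsum_app in *. simpl. transitivity (f x + (lsum f l1 + lsum f l2)); [ring |].
      rewrite H4. ring.
    + intros v. specialize (H5 v). rewrite rsum_app in *. simpl. lra.
Qed.
End ListSums.

Lemma lsum_list_prod {X Y} (f : X * Y -> C) l l' :
  lsum f (list_prod l l') = lsum (fun a => lsum (fun b => f (a, b)) l') l.
Proof.
  induction l as [| x l IH]; simpl; [reflexivity |].
  rewrite lsum_app, IH. f_equal. clear. induction l' as [| y l' IH]; simpl; congruence.
Qed.

Lemma rsum_list_prod {X Y} (g : X -> R) (h : Y -> R) l l' :
  rsum (fun p => (g (fst p) * h (snd p))%R) (list_prod l l') = (rsum g l * rsum h l')%R.
Proof.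
  induction l as [| x l IH]; simpl; [ring |].
  rewrite rsum_app, IH.
  assert (E : rsum (fun p => (g (fst p) * h (snd p))%R) (map (fun y => (x, y)) l') = (g x * rsum h l')%R).
  { clear. induction l' as [| y l' IH]; simpl; [ring | rewrite IH; ring]. }
  rewrite E. ring.
Qed.

Lemma lsum_exchange {X Y} (f : X -> Y -> C) l l' :
  lsum (fun a => lsum (fun b => f a b) l') l = lsum (fun b => lsum (fun a => f a b) l) l'.
Proof.
  induction l as [| x l IH]; simpl.
  - induction l' as [| y l' IH]; simpl; [reflexivity | rewrite <- IH; ring].
  - rewrite IH. now rewrite <- lsum_plus.
Qed.

Lemma NoDup_list_prod {X Y} (l : list X) (l' : list Y) :
  NoDup l -> NoDup l' -> NoDup (list_prod l l').
Proof.
  intros Hl Hl'. induction Hl as [| x l Hx Hl IH]; simpl; [constructor |].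
  apply NoDup_app; [| exact IH |].
  - apply FinFun.Injective_map_NoDup; [| exact Hl']. intros a b E. now inversion E.
  - intros [a b] H1 H2. apply in_map_iff in H1. destruct H1 as [c [E _]]. inversion E; subst.
    apply in_prod_iff in H2. tauto.
Qed.

(** Ordered from the ends inwards, so that passing from N to N + 1 puts two
    entries in front; telescoping sums then follow by induction. *)
Fixpoint zrange (N : nat) : list Z :=
  match N with
  | O => 0%Z :: nil
  | S N' => (- Z.of_nat N)%Z :: Z.of_nat N :: zrange N'
  end.

Lemma In_zrange N a : In a (zrange N) <-> (Z.abs a <= Z.of_nat N)%Z.
Proof.
  induction N as [| N IH]; [simpl; lia |].
  change (zrange (S N)) with ((- Z.of_nat (S N))%Z :: Z.of_nat (S N) :: zrange N).
  simpl In. rewrite IH. lia.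
Qed.

Lemma NoDup_zrange N : NoDup (zrange N).
Proof.
  induction N as [| N IH]; [simpl; constructor; [simpl; tauto | constructor] |].
  change (zrange (S N)) with ((- Z.of_nat (S N))%Z :: Z.of_nat (S N) :: zrange N).
  constructor; [| constructor; [| exact IH]].
  - simpl In. rewrite In_zrange. lia.
  - rewrite In_zrange. lia.
Qed.

Lemma length_zrange N : length (zrange N) = (2 * N + 1)%nat.
Proof. induction N as [| N IH]; simpl; [reflexivity |]. simpl in IH. rewrite IH. lia. Qed.

Lemma lsum_zrange_telescope (H : Z -> C) N :
  lsum (fun a => H (a - 1)%Z - H a) (zrange N) = H (- Z.of_nat N - 1)%Z - H (Z.of_nat N).
Proof.
  induction N as [| N IH].
  - simpl. ring.
  - change (zrange (S N)) with ((- Z.of_nat (S N))%Z :: Z.of_nat (S N) :: zrange N).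
    unfold lsum in *. cbn [fold_right]. rewrite IH.
    replace (Z.of_nat (S N) - 1)%Z with (Z.of_nat N) by lia.
    replace (- Z.of_nat N - 1)%Z with (- Z.of_nat (S N))%Z by lia. ring.
Qed.

(** |a + b tau|^(-3) is at most a constant times weight a * weight b, which
    reduces the double sum over the lattice to two simple ones. *)
Definition weight (a : Z) : R := (/ (sqrt (1 + Rabs (IZR a)) ^ 3))%R.

Lemma sqrt_1_pos (a : Z) : (0 < sqrt (1 + Rabs (IZR a)))%R.
Proof. apply sqrt_lt_R0. pose proof (Rabs_pos (IZR a)). lra. Qed.

Lemma weight_gt_0 a : (0 < weight a)%R.
Proof. apply Rinv_0_lt_compat, pow_lt, sqrt_1_pos. Qed.

Lemma sqrt_telescope (m : R) : (0 < m)%R ->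
  (/ (sqrt (m + 1) ^ 3) <= 2 * (/ sqrt m - / sqrt (m + 1)))%R.
Proof.
  intros Hm. set (s := sqrt m). set (t := sqrt (m + 1)).
  assert (Hs : (0 < s)%R) by now apply sqrt_lt_R0.
  assert (Ht : (0 < t)%R) by (apply sqrt_lt_R0; lra).
  assert (Hst : (s <= t)%R) by (apply sqrt_le_1; lra).
  assert (E : ((t - s) * (t + s) = 1)%R).
  { replace ((t - s) * (t + s))%R with (t * t - s * s)%R by ring.
    unfold s, t. rewrite !sqrt_sqrt by lra. ring. }
  replace (/ s - / t)%R with ((t - s) / (s * t))%R by (field; lra).
  replace (t - s)%R with (/ (t + s))%R.
  2: { apply (Rmult_eq_reg_r (t + s)); [| lra]. rewrite E. field. lra. }
  replace (2 * (/ (t + s) / (s * t)))%R with (/ ((t + s) * (s * t) / 2))%R by (field; lra).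
  apply Rinv_le_contravar.
  - apply Rdiv_lt_0_compat; [| lra]. repeat apply Rmult_lt_0_compat; lra.
  - simpl. rewrite Rmult_1_r.
    assert ((t + s) * (s * t) <= (2 * t) * (t * t))%R; [| lra].
    apply Rmult_le_compat; [lra | | lra |]; [apply Rmult_le_pos; lra |].
    apply Rmult_le_compat; lra.
Qed.

(** The bound is chosen to telescope by [sqrt_telescope]. *)
Lemma rsum_weight N : (rsum weight (zrange N) <= 5 - 4 / sqrt (INR N + 1))%R.
Proof.
  induction N as [| N IH].
  - assert (E : weight 0 = 1%R)
      by (unfold weight; now rewrite Rabs_R0, Rplus_0_r, sqrt_1, pow1, Rinv_1).
    simpl. rewrite E, !Rplus_0_l, sqrt_1. lra.
  - change (zrange (S N)) with ((- Z.of_nat (S N))%Z :: Z.of_nat (S N) :: zrange N).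
    unfold rsum in *. cbn [fold_right].
    assert (P : (0 < INR N + 1)%R) by (pose proof (pos_INR N); lra).
    assert (G1 : weight (Z.of_nat (S N)) = (/ (sqrt (INR N + 1 + 1) ^ 3))%R).
    { unfold weight. rewrite <- INR_IZR_INZ, S_INR, Rabs_pos_eq by lra. do 3 f_equal. ring. }
    assert (G2 : weight (- Z.of_nat (S N)) = weight (Z.of_nat (S N))).
    { unfold weight. now rewrite opp_IZR, Rabs_Ropp. }
    change (- Z.of_nat (S N))%Z with (- Z.of_nat (S N))%Z in *.
    rewrite S_INR. pose proof (sqrt_telescope (INR N + 1) P) as H.
    rewrite G2, G1. unfold Rdiv in *. lra.
Qed.

Lemma rsum_weight_5 N : (rsum weight (zrange N) <= 5)%R.
Proof.
  pose proof (rsum_weight N). assert (0 < 4 / sqrt (INR N + 1))%R; [| lra].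
  apply Rdiv_lt_0_compat; [lra |]. apply sqrt_lt_R0. pose proof (pos_INR N). lra.
Qed.

(** * Unconditional sums *)

(** The filter of finite subsets of A; convergence along it is unconditional
    summability. *)
Definition net {X} (A : X -> Prop) (P : list X -> Prop) : Prop :=
  exists L0, NoDup L0 /\ List.Forall A L0 /\
    forall L, NoDup L -> List.Forall A L -> incl L0 L -> P L.

Lemma net_proper (A : C -> Prop) : ProperFilter (net A).
Proof.
  constructor; [| constructor].
  - intros P [L0 [H1 [H2 H3]]]. exists L0. apply H3; auto. intros x Hx; exact Hx.
  - exists nil. repeat constructor.
  - intros P Q [L0 [H1 [H2 H3]]] [L1 [K1 [K2 K3]]].
    exists (nodup Ceq_dec (L0 ++ L1)). split; [apply NoDup_nodup |]. split.
    + apply List.Forall_forall. intros x Hx. apply nodup_In, in_app_or in Hx.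
      rewrite List.Forall_forall in H2, K2. destruct Hx; auto.
    + intros L HL HA Hi. split; [apply H3 | apply K3]; auto; intros x Hx; apply Hi, nodup_In,
        in_or_app; auto.
  - intros P Q HPQ [L0 [H1 [H2 H3]]]. exists L0. split; [exact H1 |]. split; [exact H2 |]. auto.
Qed.

Lemma is_sum_over_tends A u s : is_sum_over A u s <-> tends (net A) (lsum u) s.
Proof.
  assert (E : forall L, fold_right Cplus (RtoC 0) (map u L) = lsum u L).
  { induction L as [| x L IH]; simpl; congruence. }
  split.
  - intros H eps He. destruct (H (mkposreal eps He)) as [L0 [H1 [H2 H3]]].
    exists L0. split; [exact H1 |]. split; [exact H2 |]. intros L HL HA Hi.
    rewrite <- E. now apply H3.
  - intros H eps. destruct (H eps (cond_pos eps)) as [L0 [H1 [H2 H3]]].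
    exists L0. split; [exact H1 |]. split; [exact H2 |]. intros L HL HA Hi.
    rewrite E. now apply H3.
Qed.

(** A list whose sum of norms is within eps / 2 of the supremum leaves at
    most eps / 2 for any list disjoint from it. *)
Lemma is_sum_over_ex A u (M : R) :
  (forall L, NoDup L -> List.Forall A L -> (rsum (fun w => Cmod (u w)) L <= M)%R) ->
  exists s, is_sum_over A u s.
Proof.
  intros HM. pose proof (net_proper A) as PF.
  destruct (tends_cauchy (net A) (lsum u)) as [s Hs].
  - intros eps He.
    destruct (completeness (fun r => exists L, NoDup L /\ List.Forall A L /\
       r = rsum (fun w => Cmod (u w)) L)) as [T [HT1 HT2]].
    { exists M. intros r [L [H1 [H2 ->]]]. now apply HM. }
    { exists 0%R, nil. split; [constructor |]. split; [constructor | reflexivity]. }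
    assert (HL : exists L, NoDup L /\ List.Forall A L /\ (T - eps / 2 < rsum (fun w => Cmod (u w)) L)%R).
    { apply Classical_Prop.NNPP. intros Hn. assert (T <= T - eps / 2)%R; [| lra].
      apply HT2. intros r [L [H1 [H2 ->]]]. apply Rnot_lt_le. intros Hlt. apply Hn. now exists L. }
    destruct HL as [L0 [H1 [H2 H3]]].
    exists (fun L => (Cmod (lsum u L - lsum u L0) < eps / 2)%R). split.
    + exists L0. split; [exact H1 |]. split; [exact H2 |]. intros L HL HA Hi.
      destruct (lsum_split u L0 L H1 HL Hi) as [r [R1 [R2 [R3 [R4 R5]]]]].
      rewrite R4. replace (lsum u L0 + lsum u r - lsum u L0) with (lsum u r) by ring.
      eapply Rle_lt_trans; [apply Cmod_lsum |].
      assert (B : (rsum (fun w => Cmod (u w)) L <= T)%R) by (apply HT1; now exists L).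
      rewrite R5 in B. lra.
    + intros L L' B1 B2. pose proof (Cmod_le_triangle (lsum u L) (lsum u L0) (lsum u L')) as H.
      rewrite (Cmod_minus_sym (lsum u L0)) in H. lra.
  - exists s. now apply is_sum_over_tends.
Qed.

Lemma sum_over_unique A u s : is_sum_over A u s -> sum_over A u = s.
Proof.
  intros H. apply (iota_unique (V := C_R_CompleteNormedModule) (is_sum_over A u) s); [| exact H].
  intros t Ht. apply is_sum_over_tends in H. apply is_sum_over_tends in Ht.
  pose proof (net_proper A) as PF. assert (FF : Filter (net A)) by apply PF.
  assert (PF' : ProperFilter' (net A)) by apply (Proper_StrongProper _ PF).
  exact (tends_unique (net A) _ t s Ht H).
Qed.

(** * The Weierstrass zeta function *)

Definition ZZ_eq_dec (p p' : Z * Z) : {p = p'} + {p <> p'}.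
Proof. decide equality; apply Z.eq_dec. Defined.

Section Zeta.
Variable tau : C.
Hypothesis Htau : (0 < Im tau)%R.

Definition lattice_pt (p : Z * Z) : C := RtoC (IZR (fst p)) + RtoC (IZR (snd p)) * tau.

Definition nzlattice (w : C) : Prop := Lambda tau w /\ w <> 0.

(** For w = a + b tau both |a| and |b| are at most this multiple of |w|,
    since |b| Im tau <= |w| and |a| <= |w| + |b| |tau|. *)
Definition lattice_const : R := (1 + Cmod tau / Im tau + / Im tau)%R.

Lemma lattice_const_ge_1 : (1 <= lattice_const)%R.
Proof.
  unfold lattice_const. assert (0 < / Im tau)%R by now apply Rinv_0_lt_compat.
  assert (0 <= Cmod tau / Im tau)%R by (apply Rdiv_le_0_compat; [apply Cmod_ge_0 | exact Htau]).
  lra.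
Qed.

Lemma lattice_pt_Im p : (Rabs (IZR (snd p)) * Im tau <= Cmod (lattice_pt p))%R.
Proof.
  assert (E : Im (lattice_pt p) = (IZR (snd p) * Im tau)%R) by (unfold lattice_pt, Im; simpl; ring).
  assert (B : (Rabs (Im (lattice_pt p)) <= Cmod (lattice_pt p))%R).
  { eapply Rle_trans; [apply Rmax_r | apply (Rmax_Cmod (lattice_pt p))]. }
  rewrite E, Rabs_mult, (Rabs_pos_eq (Im tau)) in B by lra. exact B.
Qed.

Lemma lattice_pt_b p : (Rabs (IZR (snd p)) <= lattice_const * Cmod (lattice_pt p))%R.
Proof.
  assert (H : (Rabs (IZR (snd p)) <= / Im tau * Cmod (lattice_pt p))%R).
  { apply Rmult_le_reg_r with (Im tau); [exact Htau |].
    replace (/ Im tau * Cmod (lattice_pt p) * Im tau)%R with (Cmod (lattice_pt p)) by (field; lra).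
    apply lattice_pt_Im. }
  eapply Rle_trans; [exact H |]. apply Rmult_le_compat_r; [apply Cmod_ge_0 |].
  unfold lattice_const. assert (0 <= Cmod tau / Im tau)%R
    by (apply Rdiv_le_0_compat; [apply Cmod_ge_0 | exact Htau]). lra.
Qed.

Lemma lattice_pt_a p : (Rabs (IZR (fst p)) <= lattice_const * Cmod (lattice_pt p))%R.
Proof.
  pose proof (lattice_pt_Im p) as HI.
  assert (H : (Rabs (IZR (fst p)) <= Cmod (lattice_pt p) + Rabs (IZR (snd p)) * Cmod tau)%R).
  { rewrite <- (Cmod_R (IZR (fst p))).
    replace (RtoC (IZR (fst p))) with (lattice_pt p - RtoC (IZR (snd p)) * tau) by (unfold lattice_pt; ring).
    eapply Rle_trans; [apply Cmod_triangle_minus |]. rewrite Cmod_mult, Cmod_R. lra. }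
  assert (H2 : (Rabs (IZR (snd p)) * Cmod tau <= Cmod tau / Im tau * Cmod (lattice_pt p))%R).
  { apply Rmult_le_reg_r with (Im tau); [exact Htau |].
    replace (Cmod tau / Im tau * Cmod (lattice_pt p) * Im tau)%R with (Cmod tau * Cmod (lattice_pt p))%R by (field; lra).
    pose proof (Cmod_ge_0 tau). nra. }
  unfold lattice_const. assert (0 < / Im tau)%R by now apply Rinv_0_lt_compat.
  pose proof (Cmod_ge_0 (lattice_pt p)). assert (0 <= / Im tau * Cmod (lattice_pt p))%R by (apply Rmult_le_pos; lra).
  lra.
Qed.

Lemma lattice_pt_0 : lattice_pt (0%Z, 0%Z) = 0.
Proof. unfold lattice_pt; simpl. ring. Qed.

Lemma IZR_abs_lt_1 k : (Rabs (IZR k) < 1)%R -> k = 0%Z.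
Proof. intros H. rewrite <- abs_IZR in H. apply lt_IZR in H. lia. Qed.

Lemma lattice_pt_inj p p' : lattice_pt p = lattice_pt p' -> p = p'.
Proof.
  intros E. destruct p as [a b], p' as [a' b'].
  assert (H : lattice_pt ((a - a')%Z, (b - b')%Z) = 0).
  { transitivity (lattice_pt (a, b) - lattice_pt (a', b')); [| rewrite E; ring].
    unfold lattice_pt; simpl. rewrite !minus_IZR, !RtoC_minus. ring. }
  pose proof (lattice_pt_a ((a - a')%Z, (b - b')%Z)) as HA. pose proof (lattice_pt_b ((a - a')%Z, (b - b')%Z)) as HB.
  rewrite H, Cmod_0, Rmult_0_r in HA, HB. simpl in HA, HB.
  assert ((a - a')%Z = 0%Z) by (apply IZR_abs_lt_1; lra).
  assert ((b - b')%Z = 0%Z) by (apply IZR_abs_lt_1; lra).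
  f_equal; lia.
Qed.

Lemma Lambda_lattice_pt w : Lambda tau w <-> exists p, w = lattice_pt p.
Proof.
  split.
  - intros [a [b E]]. now exists (a, b).
  - intros [[a b] E]. now exists a, b.
Qed.

Lemma nzlattice_lower w : nzlattice w -> (1 <= lattice_const * Cmod w)%R.
Proof.
  intros [HL Hne]. apply Lambda_lattice_pt in HL. destruct HL as [[a b] ->].
  pose proof (lattice_pt_a (a, b)) as HA. pose proof (lattice_pt_b (a, b)) as HB. simpl in HA, HB.
  apply Rnot_lt_le. intros Hlt. apply Hne.
  assert (a = 0%Z) as -> by (apply IZR_abs_lt_1; lra).
  assert (b = 0%Z) as -> by (apply IZR_abs_lt_1; lra). apply lattice_pt_0.
Qed.

Lemma nzlattice_pos w : nzlattice w -> (0 < Cmod w)%R.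
Proof. intros [_ H]. now apply Cmod_pos. Qed.

(** As |w| is at least 1 / C, both 1 + |a| and 1 + |b| are at most 2 C |w|. *)
Lemma nzlattice_weight p : nzlattice (lattice_pt p) ->
  (/ Cmod (lattice_pt p) ^ 3 <= (2 * lattice_const) ^ 3 * (weight (fst p) * weight (snd p)))%R.
Proof.
  intros HA. pose proof (nzlattice_lower _ HA) as H1. pose proof (nzlattice_pos _ HA) as H0.
  pose proof (lattice_pt_a p) as Ha. pose proof (lattice_pt_b p) as Hb. pose proof lattice_const_ge_1 as HC.
  set (L := Cmod (lattice_pt p)) in *. unfold weight.
  set (s := sqrt (1 + Rabs (IZR (fst p)))). set (t := sqrt (1 + Rabs (IZR (snd p)))).
  assert (Hs : (0 < s)%R) by apply sqrt_1_pos. assert (Ht : (0 < t)%R) by apply sqrt_1_pos.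
  assert (Hs2 : (s * s <= 2 * lattice_const * L)%R).
  { unfold s. rewrite sqrt_sqrt by (pose proof (Rabs_pos (IZR (fst p))); lra). lra. }
  assert (Ht2 : (t * t <= 2 * lattice_const * L)%R).
  { unfold t. rewrite sqrt_sqrt by (pose proof (Rabs_pos (IZR (snd p))); lra). lra. }
  assert (Hst : (s * t <= 2 * lattice_const * L)%R).
  { assert (0 <= (s - t) * (s - t))%R by apply Rle_0_sqr. nra. }
  assert (Hst0 : (0 < s * t)%R) by now apply Rmult_lt_0_compat.
  assert (Hst3 : ((s * t) ^ 3 <= (2 * lattice_const * L) ^ 3)%R) by (apply pow_incr; lra).
  assert (HL3 : (0 < L ^ 3)%R) by now apply pow_lt.
  assert (Hst3' : (0 < (s * t) ^ 3)%R) by now apply pow_lt.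
  apply Rmult_le_reg_r with (L ^ 3 * (s * t) ^ 3)%R; [now apply Rmult_lt_0_compat |].
  replace (/ L ^ 3 * (L ^ 3 * (s * t) ^ 3))%R with ((s * t) ^ 3)%R by (field; lra).
  replace ((2 * lattice_const) ^ 3 * (/ s ^ 3 * / t ^ 3) * (L ^ 3 * (s * t) ^ 3))%R
    with ((2 * lattice_const * L) ^ 3)%R by (field; lra).
  exact Hst3.
Qed.

Definition lattice_coord (w : C) : Z * Z := epsilon (inhabits (0%Z, 0%Z)) (fun p => w = lattice_pt p).

Lemma lattice_pt_coord w : Lambda tau w -> lattice_pt (lattice_coord w) = w.
Proof.
  intros H. apply Lambda_lattice_pt in H. symmetry. unfold lattice_coord.
  exact (epsilon_spec (inhabits (0%Z, 0%Z)) (fun p => w = lattice_pt p) H).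
Qed.

Definition weight_total : R := ((2 * lattice_const) ^ 3 * 25)%R.

Definition box (N : nat) : list (Z * Z) := list_prod (zrange N) (zrange N).

Lemma In_box N p : In p (box N) <-> (Z.abs (fst p) <= Z.of_nat N /\ Z.abs (snd p) <= Z.of_nat N)%Z.
Proof.
  destruct p as [a b]. unfold box. rewrite in_prod_iff, !In_zrange. reflexivity.
Qed.

Lemma NoDup_box N : NoDup (box N).
Proof. apply NoDup_list_prod; apply NoDup_zrange. Qed.

Lemma list_in_box (l : list (Z * Z)) : exists N0, forall N, (N0 <= N)%nat -> incl l (box N).
Proof.
  induction l as [| [a b] l [N0 IH]].
  - exists 0%nat. intros N _ x [].
  - exists (N0 + Z.to_nat (Z.abs a) + Z.to_nat (Z.abs b))%nat. intros N HN x [<- | Hx].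
    + apply In_box. simpl. lia.
    + apply (IH N); [lia | exact Hx].
Qed.

(** Finitely many lattice points lie in a square, over which the product
    weight sums to a product. *)
Lemma lattice_weight_bound L : NoDup L -> List.Forall nzlattice L ->
  (rsum (fun w => / Cmod w ^ 3)%R L <= weight_total)%R.
Proof.
  intros HL HA. rewrite List.Forall_forall in HA.
  assert (E : rsum (fun w => / Cmod w ^ 3)%R L = rsum (fun p => / Cmod (lattice_pt p) ^ 3)%R (map lattice_coord L)).
  { clear HL. induction L as [| w L IH]; simpl in *; [reflexivity |].
    rewrite IH by auto. rewrite lattice_pt_coord; [reflexivity |]. apply HA. auto. }
  rewrite E.
  assert (HN : NoDup (map lattice_coord L)).
  { clear E. induction HL as [| w L Hw HL IH]; simpl; [constructor |].
    constructor; [| apply IH; intros; apply HA; simpl; auto].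
    intros Hi. apply in_map_iff in Hi. destruct Hi as [v [Ev Hv]].
    assert (v = w); [| subst; contradiction].
    rewrite <- (lattice_pt_coord v), <- (lattice_pt_coord w); [now rewrite Ev | apply HA; simpl; auto | apply HA; simpl; auto]. }
  destruct (list_in_box (map lattice_coord L)) as [N HB]. specialize (HB N (le_n _)).
  eapply Rle_trans.
  - apply (rsum_le _ (fun p => (2 * lattice_const) ^ 3 * (weight (fst p) * weight (snd p)))%R).
    intros p Hp. apply nzlattice_weight. apply in_map_iff in Hp. destruct Hp as [w [<- Hw]].
    rewrite lattice_pt_coord; apply HA; exact Hw.
  - rewrite rsum_scal. unfold weight_total. pose proof lattice_const_ge_1.
    apply Rmult_le_compat_l; [apply pow_le; lra |].
    eapply Rle_trans.
    + apply (rsum_incl _ _ (box N)); [| exact HN | exact HB].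
      intros p. apply Rmult_le_pos; left; apply weight_gt_0.
    + unfold box. rewrite rsum_list_prod. pose proof (rsum_weight_5 N).
      assert (0 <= rsum weight (zrange N))%R by (apply rsum_nonneg; intros; left; apply weight_gt_0).
      replace 25%R with (5 * 5)%R by ring. apply Rmult_le_compat; lra.
Qed.

Definition zterm (x w : C) : C := 1 / (x - w) + 1 / w + x / w ^ 2.

(** The three fractions add up to x^2 / (w^2 (x - w)). *)
Lemma zterm_bound x w d : (0 < d)%R -> nzlattice w -> (d * Cmod w <= Cmod (x - w))%R ->
  (Cmod (zterm x w) <= Cmod x ^ 2 / d * / Cmod w ^ 3)%R.
Proof.
  intros Hd HA Hx. pose proof (nzlattice_pos _ HA) as Hw.
  assert (Hw0 : w <> 0) by (apply HA).
  assert (Hdw : (0 < d * Cmod w)%R) by now apply Rmult_lt_0_compat.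
  assert (Hxw : x - w <> 0) by (apply Cmod_gt_0; lra).
  replace (zterm x w) with (x ^ 2 / (w ^ 2 * (x - w))).
  2: { unfold zterm. simpl. field. split; assumption. }
  assert (Hne : w ^ 2 * (x - w) <> 0) by (apply Cmult_neq_0; [now apply Cpow_nz | exact Hxw]).
  rewrite Cmod_div, Cmod_mult, !Cmod_pow by exact Hne.
  replace (Cmod x ^ 2 / d * / Cmod w ^ 3)%R with (Cmod x ^ 2 * / (Cmod w ^ 2 * (d * Cmod w)))%R
    by (field; lra).
  unfold Rdiv. apply Rmult_le_compat_l; [apply pow_le, Cmod_ge_0 |].
  apply Rinv_le_contravar.
  - apply Rmult_lt_0_compat; [now apply pow_lt | exact Hdw].
  - apply Rmult_le_compat_l; [apply pow_le; lra | exact Hx].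
Qed.

Lemma list_dist (z : C) (L : list C) : (forall w, In w L -> w <> z) ->
  exists d, (0 < d)%R /\ forall w, In w L -> (d <= Cmod (z - w))%R.
Proof.
  induction L as [| w L IH]; intros H.
  - exists 1%R. split; [lra | intros w []].
  - destruct IH as [d [Hd HL]]; [intros; apply H; simpl; auto |].
    assert (Hw : (0 < Cmod (z - w))%R).
    { apply Cmod_pos, Cminus_neq_0. intros E. apply (H w); simpl; auto. }
    exists (Rmin d (Cmod (z - w))). split; [now apply Rmin_glb_lt |].
    intros v [<- | Hv]; [apply Rmin_r |]. eapply Rle_trans; [apply Rmin_l | now apply HL].
Qed.

(** Lattice points with |w| > 2 |z0| + 1 are at distance at least |w| / 2,
    and there are only finitely many others. *)
Lemma nzlattice_dist_at z0 : ~ nzlattice z0 ->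
  exists d, (0 < d)%R /\ forall w, nzlattice w -> (d * Cmod w <= Cmod (z0 - w))%R.
Proof.
  intros Hz. pose proof (Cmod_ge_0 z0) as Hz0. pose proof lattice_const_ge_1 as HC.
  set (B := (2 * Cmod z0 + 1)%R).
  destruct (archimed (lattice_const * B)) as [HN _]. set (N := Z.to_nat (up (lattice_const * B))).
  assert (HB0 : (0 < lattice_const * B)%R) by (apply Rmult_lt_0_compat; unfold B; lra).
  assert (HNN : (lattice_const * B <= INR N)%R).
  { unfold N. rewrite INR_IZR_INZ, Z2Nat.id; [lra |]. apply le_IZR. lra. }
  destruct (list_dist z0 (map lattice_pt (remove ZZ_eq_dec (0%Z, 0%Z) (box N))))
    as [d [Hd HL]].
  { intros w Hw ->. apply in_map_iff in Hw. destruct Hw as [p [E Hp]]. apply in_remove in Hp.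
    apply Hz. split; [apply Lambda_lattice_pt; now exists p |]. intros E0. destruct Hp as [_ Hp]. apply Hp.
    apply lattice_pt_inj. now rewrite lattice_pt_0, E. }
  exists (Rmin (/ 2) (d / B)). split.
  { apply Rmin_glb_lt; [lra |]. apply Rdiv_lt_0_compat; unfold B; lra. }
  intros w HA. pose proof (nzlattice_pos _ HA) as Hw.
  destruct (Rle_dec (Cmod w) B) as [Hle | Hgt].
  - apply Rle_trans with (d / B * B)%R.
    + apply Rmult_le_compat; [| lra | apply Rmin_r | exact Hle].
      left. apply Rmin_glb_lt; [lra |]. apply Rdiv_lt_0_compat; unfold B; lra.
    + replace (d / B * B)%R with d by (field; unfold B; lra). apply HL.
      destruct HA as [HLam Hne]. apply Lambda_lattice_pt in HLam. destruct HLam as [p ->].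
      apply in_map. apply in_in_remove.
      * intros ->. apply Hne, lattice_pt_0.
      * assert (Hab : forall k : Z, (Rabs (IZR k) <= lattice_const * Cmod (lattice_pt p))%R -> (Z.abs k <= Z.of_nat N)%Z).
        { intros k Hk. apply le_IZR. rewrite abs_IZR, <- INR_IZR_INZ.
          assert (lattice_const * Cmod (lattice_pt p) <= lattice_const * B)%R by (apply Rmult_le_compat_l; lra). lra. }
        apply In_box. split; apply Hab; [apply lattice_pt_a | apply lattice_pt_b].
  - apply Rle_trans with (/ 2 * Cmod w)%R; [apply Rmult_le_compat_r; [lra | apply Rmin_l] |].
    pose proof (Cmod_rev_triangle w z0) as H. rewrite Cmod_minus_sym in H. unfold B in Hgt. lra.
Qed.

Lemma nzlattice_dist z0 : ~ nzlattice z0 ->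
  exists d r, (0 < d)%R /\ (0 < r)%R /\ forall x, (Cmod (x - z0) < r)%R ->
    forall w, nzlattice w -> (d * Cmod w <= Cmod (x - w))%R.
Proof.
  intros Hz. destruct (nzlattice_dist_at z0 Hz) as [d [Hd H]]. pose proof lattice_const_ge_1 as HC.
  exists (d / 2)%R, (d / (2 * lattice_const))%R. split; [lra |]. split; [apply Rdiv_lt_0_compat; lra |].
  intros x Hx w HA. specialize (H w HA). pose proof (nzlattice_lower w HA) as Hw.
  assert (d / (2 * lattice_const) <= d / 2 * Cmod w)%R.
  { apply Rmult_le_reg_r with lattice_const; [lra |].
    replace (d / (2 * lattice_const) * lattice_const)%R with (d / 2)%R by (field; lra). nra. }
  pose proof (Cmod_le_triangle z0 x w) as H1. rewrite (Cmod_minus_sym z0 x) in H1. lra.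
Qed.

Definition zeta_series (x : C) : C := sum_over nzlattice (zterm x).

Lemma zeta_unfold x : zeta tau x = 1 / x + zeta_series x.
Proof. reflexivity. Qed.

Lemma zterm_list_bound x d L : (0 < d)%R -> (forall w, nzlattice w -> (d * Cmod w <= Cmod (x - w))%R) ->
  NoDup L -> List.Forall nzlattice L ->
  (rsum (fun w => Cmod (zterm x w)) L <= Cmod x ^ 2 / d * weight_total)%R.
Proof.
  intros Hd H HN HA. eapply Rle_trans.
  - apply (rsum_le _ (fun w => Cmod x ^ 2 / d * / Cmod w ^ 3)%R). intros w Hw.
    rewrite List.Forall_forall in HA. apply zterm_bound; auto.
  - rewrite rsum_scal. apply Rmult_le_compat_l.
    + apply Rdiv_le_0_compat; [apply pow_le, Cmod_ge_0 | exact Hd].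
    + now apply lattice_weight_bound.
Qed.

Lemma zeta_series_is_sum x : ~ nzlattice x -> is_sum_over nzlattice (zterm x) (zeta_series x).
Proof.
  intros Hx. destruct (nzlattice_dist_at x Hx) as [d [Hd H]].
  destruct (is_sum_over_ex nzlattice (zterm x) (Cmod x ^ 2 / d * weight_total)) as [s Hs].
  { intros L HN HA. now apply zterm_list_bound. }
  unfold zeta_series. now rewrite (sum_over_unique _ _ _ Hs).
Qed.

Definition box' (N : nat) : list (Z * Z) := remove ZZ_eq_dec (0%Z, 0%Z) (box N).

Lemma NoDup_remove_dec {X} (dec : forall x y : X, {x = y} + {x <> y}) p l :
  NoDup l -> NoDup (remove dec p l).
Proof.
  intros H. induction H as [| x l Hx Hl IH]; simpl; [constructor |].
  destruct (dec p x); [exact IH |]. constructor; [| exact IH].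
  intros Hi. apply in_remove in Hi. tauto.
Qed.

Lemma box'_nzlattice N : List.Forall nzlattice (map lattice_pt (box' N)).
Proof.
  apply List.Forall_forall. intros w Hw. apply in_map_iff in Hw. destruct Hw as [p [<- Hp]].
  apply in_remove in Hp. split; [apply Lambda_lattice_pt; now exists p |].
  intros E. apply Hp. apply lattice_pt_inj. now rewrite lattice_pt_0.
Qed.

Lemma box'_NoDup N : NoDup (map lattice_pt (box' N)).
Proof.
  apply FinFun.Injective_map_NoDup; [exact lattice_pt_inj |]. apply NoDup_remove_dec, NoDup_box.
Qed.

Lemma lsum_map {X Y} (f : Y -> C) (g : X -> Y) l : lsum f (map g l) = lsum (fun x => f (g x)) l.
Proof. induction l as [| x l IH]; simpl; congruence. Qed.

Lemma box_cofinal L0 : List.Forall nzlattice L0 ->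
  exists N0, forall N, (N0 <= N)%nat -> incl L0 (map lattice_pt (box' N)).
Proof.
  intros HA. rewrite List.Forall_forall in HA.
  destruct (list_in_box (map lattice_coord L0)) as [N0 H]. exists N0. intros N HN w Hw.
  specialize (H N HN (lattice_coord w) (in_map lattice_coord _ _ Hw)). destruct (HA w Hw) as [HL Hne].
  apply in_map_iff. exists (lattice_coord w). split; [now apply lattice_pt_coord |].
  apply in_in_remove; [| exact H]. intros E. apply Hne. rewrite <- (lattice_pt_coord w HL), E. apply lattice_pt_0.
Qed.

Lemma zeta_series_box x : ~ nzlattice x ->
  tends eventually (fun N => lsum (fun p => zterm x (lattice_pt p)) (box' N)) (zeta_series x).
Proof.
  intros Hx eps He. pose proof (proj1 (is_sum_over_tends _ _ _) (zeta_series_is_sum x Hx) eps He) as H.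
  destruct H as [L0 [H1 [H2 H3]]]. destruct (box_cofinal L0 H2) as [N0 HN].
  exists N0. intros N Hle. specialize (H3 (map lattice_pt (box' N)) (box'_NoDup N) (box'_nzlattice N) (HN N Hle)).
  now rewrite lsum_map in H3.
Qed.

Lemma diff_lsum {X} (f : X -> C -> C) l z : (forall p, In p l -> diff_at (f p) z) ->
  diff_at (fun x => lsum (fun p => f p x) l) z.
Proof.
  induction l as [| p l IH]; simpl; intros H; [apply diff_const |].
  apply diff_plus; [apply H; auto | apply IH; auto].
Qed.

(** The sums over squares are bounded near [z0] uniformly in N, so
    [limit_holomorphic] applies. *)
Lemma zeta_series_diff z0 : ~ nzlattice z0 -> diff_at zeta_series z0.
Proof.
  intros Hz. destruct (nzlattice_dist z0 Hz) as [d [r [Hd [Hr H]]]].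
  apply (limit_holomorphic eventually (fun N x => lsum (fun p => zterm x (lattice_pt p)) (box' N))
           zeta_series z0 r ((Cmod z0 + r) ^ 2 / d * weight_total) Hr).
  - intros N z Hzz. pose proof (box'_nzlattice N) as HA. split.
    + apply (diff_lsum (fun p x => zterm x (lattice_pt p))). intros p Hp.
      rewrite List.Forall_forall in HA. specialize (HA (lattice_pt p) (in_map lattice_pt _ _ Hp)).
      unfold zterm, Cdiv. apply diff_plus; [apply diff_plus |].
      * apply diff_mult; [apply diff_const |]. apply diff_inv; [diff_tac |].
        apply Cmod_gt_0. specialize (H z Hzz (lattice_pt p) HA). pose proof (nzlattice_pos _ HA). nra.
      * apply diff_const.
      * apply diff_mult; [apply diff_id | apply diff_const].
    + rewrite <- (lsum_map (zterm z) lattice_pt).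
      eapply Rle_trans; [apply Cmod_lsum |].
      eapply Rle_trans; [apply (zterm_list_bound z d); auto; apply box'_NoDup |].
      assert (HW : (0 <= weight_total)%R).
      { unfold weight_total. pose proof lattice_const_ge_1. apply Rmult_le_pos; [apply pow_le; lra | lra]. }
      apply Rmult_le_compat_r; [exact HW |]. unfold Rdiv.
      apply Rmult_le_compat_r; [left; now apply Rinv_0_lt_compat |].
      apply pow_incr. split; [apply Cmod_ge_0 |].
      replace z with (z - z0 + z0) by ring. eapply Rle_trans; [apply Cmod_triangle |]. lra.
  - intros z Hzz. apply zeta_series_box. intros HA. specialize (H z Hzz z HA).
    replace (z - z) with (RtoC 0) in H by ring. rewrite Cmod_0 in H.
    pose proof (nzlattice_pos _ HA). nra.
Qed.

Definition square_sum (N : nat) (x : C) : C := lsum (fun p => 1 / (x - lattice_pt p)) (box N).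
Definition inv_sum (N : nat) : C := lsum (fun p => 1 / lattice_pt p) (box' N).
Definition inv_sq_sum (N : nat) : C := lsum (fun p => 1 / lattice_pt p ^ 2) (box' N).

Lemma zeta_partial N x :
  1 / x + lsum (fun p => zterm x (lattice_pt p)) (box' N) = square_sum N x + inv_sum N + x * inv_sq_sum N.
Proof.
  unfold square_sum, inv_sum, inv_sq_sum.
  rewrite (lsum_remove ZZ_eq_dec _ (0%Z, 0%Z) (box N) (NoDup_box N)).
  2: { apply In_box. simpl. lia. }
  fold (box' N). rewrite lattice_pt_0.
  rewrite (lsum_ext (fun p => zterm x (lattice_pt p))
    (fun p => (1 / (x - lattice_pt p) + 1 / lattice_pt p) + x * (1 / lattice_pt p ^ 2)) (box' N)).
  - rewrite lsum_plus, lsum_plus, lsum_scal. replace (x - 0) with x by ring. ring.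
  - intros p _. unfold zterm, Cdiv. ring.
Qed.

Lemma Lambda_0 : Lambda tau 0.
Proof. exists 0%Z, 0%Z. simpl. ring. Qed.

Lemma not_Lambda x : ~ Lambda tau x -> ~ nzlattice x /\ x <> 0.
Proof. intros H. split; [intros [H1 _]; auto |]. intros ->. apply H, Lambda_0. Qed.

Lemma zeta_lim x : ~ Lambda tau x ->
  tends eventually (fun N => square_sum N x + inv_sum N + x * inv_sq_sum N) (zeta tau x).
Proof.
  intros Hx. destruct (not_Lambda x Hx) as [HA H0].
  apply (tends_ext eventually (fun N => 1 / x + lsum (fun p => zterm x (lattice_pt p)) (box' N))).
  - intros N. apply zeta_partial.
  - rewrite zeta_unfold. apply tends_plus; [typeclasses eauto | apply tends_const; typeclasses eauto |].
    now apply zeta_series_box.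
Qed.

(** What telescoping in one direction leaves of a sum over a square: its two
    boundary rows. *)
Definition edge (w w' : Z -> C) (N : nat) (x : C) : C :=
  lsum (fun b => 1 / (x - w b) - 1 / (x - w' b)) (zrange N).

Lemma square_sum_shift_1 N x : square_sum N (x + 1) - square_sum N x =
  edge (fun b => lattice_pt ((- Z.of_nat N - 1)%Z, b)) (fun b => lattice_pt (Z.of_nat N, b)) N x.
Proof.
  unfold square_sum, box, edge. rewrite !lsum_list_prod.
  rewrite (lsum_exchange (fun a b => 1 / (x + 1 - lattice_pt (a, b)))),
    (lsum_exchange (fun a b => 1 / (x - lattice_pt (a, b)))).
  transitivity (lsum (fun b => lsum (fun a => 1 / (x + 1 - lattice_pt (a, b))) (zrange N)
                     + - (1) * lsum (fun a => 1 / (x - lattice_pt (a, b))) (zrange N)) (zrange N)).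
  { rewrite lsum_plus, lsum_scal. ring. }
  apply lsum_ext. intros b _. rewrite <- lsum_scal, <- lsum_plus.
  rewrite <- (lsum_zrange_telescope (fun a => 1 / (x - lattice_pt (a, b)))).
  apply lsum_ext. intros a _. unfold lattice_pt; simpl. rewrite minus_IZR, RtoC_minus.
  replace (x - (RtoC (IZR a) - 1 + RtoC (IZR b) * tau))
    with (x + 1 - (RtoC (IZR a) + RtoC (IZR b) * tau)) by ring. ring.
Qed.

Lemma square_sum_shift_tau N x : square_sum N (x + tau) - square_sum N x =
  edge (fun a => lattice_pt (a, (- Z.of_nat N - 1)%Z)) (fun a => lattice_pt (a, Z.of_nat N)) N x.
Proof.
  unfold square_sum, box, edge. rewrite !lsum_list_prod.
  transitivity (lsum (fun a => lsum (fun b => 1 / (x + tau - lattice_pt (a, b))) (zrange N)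
                     + - (1) * lsum (fun b => 1 / (x - lattice_pt (a, b))) (zrange N)) (zrange N)).
  { rewrite lsum_plus, lsum_scal. ring. }
  apply lsum_ext. intros a _. rewrite <- lsum_scal, <- lsum_plus.
  rewrite <- (lsum_zrange_telescope (fun b => 1 / (x - lattice_pt (a, b)))).
  apply lsum_ext. intros b _. unfold lattice_pt; simpl. rewrite minus_IZR, RtoC_minus.
  replace (x - (RtoC (IZR a) + (RtoC (IZR b) - 1) * tau))
    with (x + tau - (RtoC (IZR a) + RtoC (IZR b) * tau)) by ring. ring.
Qed.

(** Replacing x by y changes each of the 2 (2 N + 1) terms by O(1 / N^2). *)
Lemma edge_diff_bound w w' N x y : (0 < INR N)%R ->
  (2 * lattice_const * (Cmod x + Cmod y) <= INR N)%R ->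
  (forall b, INR N <= lattice_const * Cmod (w b))%R -> (forall b, INR N <= lattice_const * Cmod (w' b))%R ->
  (Cmod (edge w w' N x - edge w w' N y)
   <= INR (2 * N + 1) * (8 * Cmod (y - x) * (lattice_const * lattice_const) / (INR N * INR N)))%R.
Proof.
  intros HN Hxy Hw Hw'. pose proof lattice_const_ge_1 as HC.
  pose proof (Cmod_ge_0 x) as Hx0. pose proof (Cmod_ge_0 y) as Hy0.
  assert (Far : forall v z, (INR N <= lattice_const * Cmod v)%R -> (Cmod z <= Cmod x + Cmod y)%R ->
            (INR N / (2 * lattice_const) <= Cmod (z - v))%R).
  { intros v z Hv Hz. pose proof (Cmod_rev_triangle v z) as H. rewrite Cmod_minus_sym in H.
    apply Rmult_le_reg_r with (2 * lattice_const)%R; [lra |].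
    replace (INR N / (2 * lattice_const) * (2 * lattice_const))%R with (INR N) by (field; lra). nra. }
  assert (HN2 : (0 < INR N / (2 * lattice_const))%R) by (apply Rdiv_lt_0_compat; lra).
  assert (One : forall v, (INR N <= lattice_const * Cmod v)%R ->
     (Cmod (1 / (x - v) - 1 / (y - v)) <= 4 * Cmod (y - x) * (lattice_const * lattice_const) / (INR N * INR N))%R).
  { intros v Hv. pose proof (Far v x Hv ltac:(lra)) as F1. pose proof (Far v y Hv ltac:(lra)) as F2.
    assert (X0 : x - v <> 0) by (apply Cmod_gt_0; lra).
    assert (Y0 : y - v <> 0) by (apply Cmod_gt_0; lra).
    replace (1 / (x - v) - 1 / (y - v)) with ((y - x) / ((x - v) * (y - v)))
      by (field; split; assumption).
    rewrite Cmod_div, Cmod_mult by now apply Cmult_neq_0.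
    replace (4 * Cmod (y - x) * (lattice_const * lattice_const) / (INR N * INR N))%R
      with (Cmod (y - x) * / (INR N / (2 * lattice_const) * (INR N / (2 * lattice_const))))%R by (field; lra).
    unfold Rdiv at 1. apply Rmult_le_compat_l; [apply Cmod_ge_0 |].
    apply Rinv_le_contravar; [now apply Rmult_lt_0_compat |].
    apply Rmult_le_compat; lra. }
  replace (edge w w' N x - edge w w' N y) with
    (lsum (fun b => (1 / (x - w b) - 1 / (y - w b)) + - (1) * (1 / (x - w' b) - 1 / (y - w' b))) (zrange N)).
  - eapply Rle_trans; [apply Cmod_lsum |].
    rewrite <- (length_zrange N), <- rsum_const. apply rsum_le. intros b _.
    eapply Rle_trans; [apply Cmod_triangle |]. rewrite Cmod_mult, Cmod_m1, Rmult_1_l.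
    pose proof (One _ (Hw b)). pose proof (One _ (Hw' b)). unfold Rdiv in *. lra.
  - unfold edge. transitivity (lsum (fun b => 1 / (x - w b) - 1 / (x - w' b)) (zrange N)
      + - (1) * lsum (fun b => 1 / (y - w b) - 1 / (y - w' b)) (zrange N)); [| ring].
    rewrite <- lsum_scal, <- lsum_plus. apply lsum_ext. intros b _. ring.
Qed.

Lemma edge_limit (w w' : nat -> Z -> C) x y :
  (forall N b, INR N <= lattice_const * Cmod (w N b))%R -> (forall N b, INR N <= lattice_const * Cmod (w' N b))%R ->
  tends eventually (fun N => edge (w N) (w' N) N x - edge (w N) (w' N) N y) 0.
Proof.
  intros Hw Hw' eps He. pose proof lattice_const_ge_1 as HC.
  set (Q := (8 * Cmod (y - x) * (lattice_const * lattice_const))%R).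
  assert (HQ : (0 <= Q)%R).
  { unfold Q. pose proof (Cmod_ge_0 (y - x)). apply Rmult_le_pos; nra. }
  (* beyond B the bound of [edge_diff_bound] applies and is at most 3 Q / N < eps *)
  set (B := (2 * lattice_const * (Cmod x + Cmod y) + 3 * Q / eps + 1)%R).
  assert (HB1 : (0 <= 3 * Q / eps)%R) by (apply Rdiv_le_0_compat; lra).
  pose proof (Cmod_ge_0 x) as Hx0. pose proof (Cmod_ge_0 y) as Hy0.
  assert (HB2 : (0 <= 2 * lattice_const * (Cmod x + Cmod y))%R) by (apply Rmult_le_pos; lra).
  destruct (INR_unbounded B) as [N0 HN0]. exists N0. intros N HN. apply le_INR in HN.
  assert (HNB : (B < INR N)%R) by lra.
  assert (HN1 : (1 < INR N)%R) by (unfold B in HNB; lra).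
  set (e := edge (w N) (w' N) N x - edge (w N) (w' N) N y).
  replace (e - 0) with e by ring. unfold e. clear e.
  eapply Rle_lt_trans.
  - apply edge_diff_bound; [lra | unfold B in HNB; lra | apply Hw | apply Hw'].
  - fold Q. rewrite plus_INR, mult_INR. simpl (INR 2). simpl (INR 1).
    apply Rle_lt_trans with (3 * INR N * (Q / (INR N * INR N)))%R.
    + apply Rmult_le_compat_r; [| lra]. apply Rdiv_le_0_compat; nra.
    + replace (3 * INR N * (Q / (INR N * INR N)))%R with (3 * Q / INR N)%R by (field; lra).
      apply Rmult_lt_reg_r with (INR N); [lra |].
      replace (3 * Q / INR N * INR N)%R with (3 * Q)%R by (field; lra).
      assert (3 * Q / eps < INR N)%R by (unfold B in HNB; lra).
      apply Rmult_lt_compat_l with (r := eps) in H; [| exact He].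
      replace (eps * (3 * Q / eps))%R with (3 * Q)%R in H by (field; lra). exact H.
Qed.

(** Over growing squares the increment is an edge sum plus a constant, and
    the edge sums at x and y differ by o(1). *)
Lemma zeta_shift_const (s : C) (w w' : nat -> Z -> C) :
  (forall x, ~ Lambda tau x -> ~ Lambda tau (x + s)) ->
  (forall N x, square_sum N (x + s) - square_sum N x = edge (w N) (w' N) N x) ->
  (forall N b, INR N <= lattice_const * Cmod (w N b))%R -> (forall N b, INR N <= lattice_const * Cmod (w' N b))%R ->
  forall x y, ~ Lambda tau x -> ~ Lambda tau y ->
    zeta tau (x + s) - zeta tau x = zeta tau (y + s) - zeta tau y.
Proof.
  intros Hs HB Hw Hw' x y Hx Hy.
  assert (FE : Filter eventually) by typeclasses eauto.
  assert (L : forall z, ~ Lambda tau z ->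
    tends eventually (fun N => edge (w N) (w' N) N z + s * inv_sq_sum N) (zeta tau (z + s) - zeta tau z)).
  { intros z Hz.
    apply (tends_ext eventually (fun N => (square_sum N (z + s) + inv_sum N + (z + s) * inv_sq_sum N)
             - (square_sum N z + inv_sum N + z * inv_sq_sum N))).
    - intros N. rewrite <- HB. ring.
    - apply tends_minus; [exact FE | apply zeta_lim; auto | now apply zeta_lim]. }
  assert (E : tends eventually (fun N => edge (w N) (w' N) N x - edge (w N) (w' N) N y)
     ((zeta tau (x + s) - zeta tau x) - (zeta tau (y + s) - zeta tau y))).
  { apply (tends_ext eventually (fun N => (edge (w N) (w' N) N x + s * inv_sq_sum N)
              - (edge (w N) (w' N) N y + s * inv_sq_sum N))).
    - intros N. ring.
    - apply tends_minus; [exact FE | now apply L | now apply L]. }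
  pose proof (tends_unique eventually _ _ _ E (edge_limit w w' x y Hw Hw')) as H.
  transitivity ((zeta tau (x + s) - zeta tau x) - (zeta tau (y + s) - zeta tau y)
     + (zeta tau (y + s) - zeta tau y)); [ring |]. rewrite H. ring.
Qed.
End Zeta.

(** * Quasi-periodic meromorphic functions *)

Section Main.
Variable tau : C.
Hypothesis Htau : (0 < Im tau)%R.

Lemma simple_pole_quasi_period f s c r : mer_eq (fun x => f (x + s)) (fun x => f x + c) ->
  forall z, simple_pole f z r <-> simple_pole f (z + s) r.
Proof.
  intros H z. split; intros Hs.
  - assert (H1 : simple_pole (fun x => f (x + s)) z r).
    { apply (simple_pole_mer_eq (fun x => f x + c)); [now apply mer_eq_sym |].
      eapply simple_pole_eq; [apply simple_pole_plus; [exact Hs | apply simple_pole_const] | ring]. }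
    apply (simple_pole_ext_loc (fun x => (fun y => f (y + s)) (x + - s))).
    + apply filter_forall. intros x. f_equal. ring.
    + apply (simple_pole_shift (fun y => f (y + s)) _ (- s)).
      now replace (z + s + - s) with z by ring.
  - apply simple_pole_shift in Hs. apply (simple_pole_mer_eq _ _ _ _ H) in Hs.
    apply (simple_pole_ext_loc (fun x => (f x + c) + - c)).
    + apply filter_forall. intros x. ring.
    + eapply simple_pole_eq; [apply (simple_pole_plus (fun x => f x + c)); [exact Hs | apply simple_pole_const] | ring].
Qed.

Lemma simple_pole_lattice f c1 c2 r : mer_eq (fun x => f (x + 1)) (fun x => f x + c1) ->
  mer_eq (fun x => f (x + tau)) (fun x => f x + c2) -> simple_pole f 0 r ->
  forall z0, Lambda tau z0 -> simple_pole f z0 r.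
Proof.
  intros H1 H2 H0 z0 [a [b ->]].
  assert (St : forall s c, mer_eq (fun x => f (x + s)) (fun x => f x + c) ->
             forall (k : Z) z, simple_pole f z r -> simple_pole f (z + RtoC (IZR k) * s) r).
  { intros s c Hs k z Hz. induction k as [| k IH | k IH] using Z.peano_ind.
    - now replace (z + RtoC (IZR 0) * s) with z by ring.
    - rewrite succ_IZR, RtoC_plus.
      replace (z + (RtoC (IZR k) + 1) * s) with (z + RtoC (IZR k) * s + s) by ring.
      apply (proj1 (simple_pole_quasi_period f s c r Hs _)). exact IH.
    - rewrite <- Z.sub_1_r, minus_IZR, RtoC_minus.
      apply (proj2 (simple_pole_quasi_period f s c r Hs _)).
      replace (z + (RtoC (IZR k) - 1) * s + s) with (z + RtoC (IZR k) * s) by ring.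
      exact IH. }
  apply (St tau c2 H2). replace (RtoC (IZR a)) with (0 + RtoC (IZR a) * 1) by ring.
  now apply (St 1 c1 H1).
Qed.

Lemma mer_entire_affine f c1 c2 : (forall z0, simple_pole f z0 0) ->
  mer_eq (fun x => f (x + 1)) (fun x => f x + c1) ->
  mer_eq (fun x => f (x + tau)) (fun x => f x + c2) ->
  exists a b, mer_eq f (fun x => a + b * x).
Proof.
  intros Hs H1 H2. destruct (simple_pole_0_entire f Hs) as [G [HG E]].
  assert (Sh : forall s c, mer_eq (fun x => f (x + s)) (fun x => f x + c) ->
              forall x, G (x + s) = G x + c).
  { intros s c H. apply (mer_eq_entire (fun x => G (x + s)) (fun x => G x + c)).
    - intros z. apply (diff_comp (fun x => x + s) G); [diff_tac | apply HG].
    - intros z. apply diff_plus; [apply HG | apply diff_const].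
    - eapply mer_eq_trans; [apply mer_eq_shift, mer_eq_sym, E |].
      eapply mer_eq_trans; [exact H |]. apply mer_eq_plus; [exact E | apply mer_eq_refl]. }
  destruct (entire_quasi_periodic_affine tau G c1 c2 Htau HG (Sh 1 c1 H1) (Sh tau c2 H2)) as [b Hb].
  exists (G 0), b. eapply mer_eq_trans; [exact E |]. apply mer_eq_of_eq. exact Hb.
Qed.

Lemma Lambda_plus z w : Lambda tau z -> Lambda tau w -> Lambda tau (z + w).
Proof.
  intros [a [b ->]] [c [d ->]]. exists (a + c)%Z, (b + d)%Z.
  rewrite !plus_IZR, !RtoC_plus. ring.
Qed.

Lemma Lambda_opp z : Lambda tau z -> Lambda tau (- z).
Proof.
  intros [a [b ->]]. exists (- a)%Z, (- b)%Z. rewrite !opp_IZR, !RtoC_opp. ring.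
Qed.

Lemma Lambda_1 : Lambda tau 1.
Proof. exists 1%Z, 0%Z. simpl. ring. Qed.

Lemma Lambda_tau : Lambda tau tau.
Proof. exists 0%Z, 1%Z. simpl. ring. Qed.

Lemma not_Lambda_plus z s : Lambda tau s -> ~ Lambda tau z -> ~ Lambda tau (z + s).
Proof.
  intros Hs Hz H. apply Hz. replace z with (z + s + - s) by ring.
  apply Lambda_plus; [exact H | now apply Lambda_opp].
Qed.

Lemma nbhd_not_nzlattice z0 : ~ nzlattice tau z0 -> nbhd z0 (fun x => ~ nzlattice tau x).
Proof.
  intros Hz. destruct (nzlattice_dist tau Htau z0 Hz) as [d [r [Hd [Hr H]]]].
  apply nbhd_Cmod. exists r. split; [exact Hr |]. intros x Hx HA. specialize (H x Hx x HA).
  replace (x - x) with (RtoC 0) in H by ring. rewrite Cmod_0 in H.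
  pose proof (nzlattice_pos tau x HA). nra.
Qed.

Lemma nbhd_not_Lambda z0 : ~ Lambda tau z0 -> nbhd z0 (fun x => ~ Lambda tau x).
Proof.
  intros Hz. destruct (not_Lambda tau z0 Hz) as [HA H0].
  apply (filter_and2 (nbhd z0) _ _ _ (nbhd_not_nzlattice z0 HA) (nbhd_neq (fun x => x) z0 0 (tends_nbhd_id z0) H0)).
  intros x HxA Hx0 HL. apply HxA. now split.
Qed.

Lemma nbhd'_not_Lambda z0 : nbhd' z0 (fun x => ~ Lambda tau x).
Proof.
  destruct (Classical_Prop.classic (Lambda tau z0)) as [HL | HL].
  - assert (H0 : nbhd' 0 (fun x => ~ Lambda tau x)).
    { assert (HA : ~ nzlattice tau 0) by (intros [_ H]; congruence).
      apply (filter_and2 (nbhd' 0) _ _ _ (nbhd_nbhd' _ _ (nbhd_not_nzlattice 0 HA)) (nbhd'_ne 0)).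
      intros x HxA Hx0 Hx. apply HxA. now split. }
    replace (RtoC 0) with (z0 + - z0) in H0 by ring. apply nbhd'_shift in H0.
    revert H0. apply filter_imp. intros x Hx Hl. apply Hx.
    apply Lambda_plus; [exact Hl | now apply Lambda_opp].
  - now apply nbhd_nbhd', nbhd_not_Lambda.
Qed.

Lemma strip_not_Lambda x : (0 < Im x < Im tau)%R -> ~ Lambda tau x.
Proof.
  intros Hx [a [b ->]].
  replace (Im (RtoC (IZR a) + RtoC (IZR b) * tau)) with (IZR b * Im tau)%R in Hx
    by (unfold Im; simpl; ring).
  assert (0 < IZR b)%R by (apply Rnot_le_lt; intros Hb; nra).
  assert (IZR b < 1)%R by (apply Rnot_le_lt; intros Hb; nra).
  apply lt_IZR in H. apply lt_IZR in H0. lia.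
Qed.

(** * The closed form of Z *)

Let Z1 := Zconv tau 1.
Let defect (x : C) : C := zeta tau x - Z1 x.

Lemma Z1_shift_tau : mer_eq (fun x => Z1 (x + tau)) (fun x => Z1 x + - twopii).
Proof.
  eapply mer_eq_trans.
  - apply (mer_eq_of_eq _ (fun x => (twopii * Zconv tau 0 x + - (twopii * (- twopii / 2) ^ 0)) + Z1 x)).
    intros x. unfold Z1. pose proof (Zconv_Delta tau Htau 0 x) as H.
    transitivity ((Zconv tau 1 (x + tau) - Zconv tau 1 x) + Zconv tau 1 x); [ring |]. rewrite H. ring.
  - eapply mer_eq_trans.
    + apply mer_eq_plus; [| apply mer_eq_refl]. apply mer_eq_plus; [| apply mer_eq_refl].
      apply mer_eq_scal, Zconv_0. 
    + apply mer_eq_of_eq. intros x. simpl Cpow. ring.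
Qed.

Lemma zeta_diff x : ~ Lambda tau x -> diff_at (zeta tau) x.
Proof.
  intros Hx. destruct (not_Lambda tau x Hx) as [HA H0].
  apply (diff_ext (fun x => 1 * / x + zeta_series tau x)); [reflexivity |].
  apply diff_plus; [| now apply zeta_series_diff].
  apply diff_mult; [apply diff_const |]. apply diff_inv; [apply diff_id | exact H0].
Qed.

Lemma zeta_quasi s : Lambda tau s ->
  (exists w w' : nat -> Z -> C,
    (forall N x, square_sum tau N (x + s) - square_sum tau N x = edge (w N) (w' N) N x) /\
    (forall N b, INR N <= lattice_const tau * Cmod (w N b))%R /\
    (forall N b, INR N <= lattice_const tau * Cmod (w' N b))%R) ->
  exists c, mer_eq (fun x => zeta tau (x + s)) (fun x => zeta tau x + c).
Proof.
  intros Hs [w [w' [H1 [H2 H3]]]].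
  (* a base point off the lattice *)
  set (y := RtoC (/ 2) * tau).
  assert (Hy : ~ Lambda tau y).
  { apply strip_not_Lambda. unfold y.
    replace (Im (RtoC (/ 2) * tau)) with (/ 2 * Im tau)%R by (unfold Im; simpl; ring). lra. }
  exists (zeta tau (y + s) - zeta tau y). intros z0.
  generalize (nbhd'_not_Lambda z0). apply (filter_imp (F := nbhd' z0)). intros x Hx.
  rewrite <- (zeta_shift_const tau Htau s w w') with (x := x); auto.
  - ring.
  - intros z Hz. now apply not_Lambda_plus.
Qed.

Lemma zeta_quasi_1 : exists c, mer_eq (fun x => zeta tau (x + 1)) (fun x => zeta tau x + c).
Proof.
  apply zeta_quasi; [apply Lambda_1 |].
  exists (fun N b => lattice_pt tau ((- Z.of_nat N - 1)%Z, b)), (fun N b => lattice_pt tau (Z.of_nat N, b)).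
  split; [intros; apply square_sum_shift_1 | split; intros N b].
  - eapply Rle_trans; [| apply (lattice_pt_a tau Htau)]. simpl fst.
    rewrite <- abs_IZR, INR_IZR_INZ. apply IZR_le. lia.
  - eapply Rle_trans; [| apply (lattice_pt_a tau Htau)]. simpl fst.
    rewrite <- abs_IZR, INR_IZR_INZ. apply IZR_le. lia.
Qed.

Lemma zeta_quasi_tau : exists c, mer_eq (fun x => zeta tau (x + tau)) (fun x => zeta tau x + c).
Proof.
  apply zeta_quasi; [apply Lambda_tau |].
  exists (fun N b => lattice_pt tau (b, (- Z.of_nat N - 1)%Z)), (fun N b => lattice_pt tau (b, Z.of_nat N)).
  split; [intros; apply square_sum_shift_tau | split; intros N b].
  - eapply Rle_trans; [| apply (lattice_pt_b tau Htau)]. simpl snd.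
    rewrite <- abs_IZR, INR_IZR_INZ. apply IZR_le. lia.
  - eapply Rle_trans; [| apply (lattice_pt_b tau Htau)]. simpl snd.
    rewrite <- abs_IZR, INR_IZR_INZ. apply IZR_le. lia.
Qed.

Lemma defect_quasi s c d : mer_eq (fun x => zeta tau (x + s)) (fun x => zeta tau x + c) ->
  mer_eq (fun x => Z1 (x + s)) (fun x => Z1 x + d) ->
  mer_eq (fun x => defect (x + s)) (fun x => defect x + (c - d)).
Proof.
  intros H1 H2. eapply mer_eq_trans; [exact (mer_eq_minus _ _ _ _ H1 H2) |].
  apply mer_eq_of_eq. intros x. unfold defect. ring.
Qed.

Lemma Z1_shift_1 : mer_eq (fun x => Z1 (x + 1)) (fun x => Z1 x + 0).
Proof. apply mer_eq_of_eq. intros x. unfold Z1. rewrite Zconv_period. ring. Qed.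

Lemma simple_pole_Z1_0 : simple_pole Z1 0 1.
Proof. eapply simple_pole_eq; [apply (simple_pole_Zconv_at_0 tau Htau 0) | reflexivity]. Qed.

Lemma not_nzlattice_0 : ~ nzlattice tau 0.
Proof. intros [_ H]. congruence. Qed.

Lemma simple_pole_zeta_0 : simple_pole (zeta tau) 0 1.
Proof.
  exists (zeta_series tau). split.
  - generalize (nbhd_not_nzlattice 0 not_nzlattice_0). apply filter_imp. intros x Hx. now apply zeta_series_diff.
  - apply filter_forall. intros x. rewrite zeta_unfold. now replace (x - 0) with x by ring.
Qed.

(** At 0 both residues are 1, and quasi-periodicity carries this to all
    lattice points. *)
Lemma defect_simple_pole z0 : simple_pole defect z0 0.
Proof.
  destruct zeta_quasi_1 as [c1 H1]. destruct zeta_quasi_tau as [c2 H2].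
  destruct (Classical_Prop.classic (Lambda tau z0)) as [HL | HL].
  - apply (simple_pole_lattice defect (c1 - 0) (c2 - - twopii)); [| | | exact HL].
    + apply defect_quasi; [exact H1 | apply Z1_shift_1].
    + apply defect_quasi; [exact H2 | apply Z1_shift_tau].
    + eapply simple_pole_eq; [apply simple_pole_minus; [apply simple_pole_zeta_0 | apply simple_pole_Z1_0] | ring].
  - destruct (simple_pole_Zconv tau Htau 1 z0) as [r [Hr Lr]].
    assert (r = 0) as ->.
    { destruct (Ceq_dec r 0) as [E | Hne]; [exact E |]. exfalso. auto. }
    eapply simple_pole_eq; [apply simple_pole_minus; [| exact Hr] |].
    + apply simple_pole_hol. generalize (nbhd_not_Lambda z0 HL). apply filter_imp. intros x Hx.
      now apply zeta_diff.
    + ring.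
Qed.

Lemma zeta_series_at_0 : zeta_series tau 0 = 0.
Proof.
  pose proof (zeta_series_box tau Htau 0 not_nzlattice_0) as H. refine (tends_unique eventually _ _ _ H _).
  apply (tends_ext eventually (fun _ => 0)); [| apply tends_const; typeclasses eauto].
  intros N. symmetry. rewrite (lsum_ext _ (fun _ => 0)).
  - generalize (box' N). intros l. induction l as [| p l IH]; simpl; [reflexivity |].
    rewrite IH. ring.
  - intros p Hp. pose proof (box'_nzlattice tau Htau N) as HA. rewrite List.Forall_forall in HA.
    destruct (HA (lattice_pt tau p) (in_map _ _ _ Hp)) as [_ Hne]. unfold zterm. simpl. field.
    exact Hne.
Qed.

(** [defect] is affine. Its constant term is 0, because at 0 the lattice sum
    vanishes and [Z1] is odd. *)
Lemma zeta_Z1 : exists b, mer_eq (zeta tau) (fun x => Z1 x + b * x).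
Proof.
  destruct zeta_quasi_1 as [c1 H1]. destruct zeta_quasi_tau as [c2 H2].
  destruct (mer_entire_affine defect (c1 - 0) (c2 - - twopii) defect_simple_pole) as [a [b Hab]].
  { apply defect_quasi; [exact H1 | apply Z1_shift_1]. }
  { apply defect_quasi; [exact H2 | apply Z1_shift_tau]. }
  assert (Ea : a = 0).
  (* 1 / x - Z1 x is odd and tends to a, so a = - a *)
  { assert (L1 : tends (nbhd' 0) (fun x => 1 / x - Z1 x) a).
    { assert (L : tends (nbhd' 0) (fun x => (a + b * x) - zeta_series tau x) ((a + b * 0) - zeta_series tau 0)).
      { apply tends_nbhd'. apply (diff_cont (fun x => (a + b * x) - zeta_series tau x)).
        apply diff_minus; [diff_tac | apply zeta_series_diff; [exact Htau | apply not_nzlattice_0]]. }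
      rewrite zeta_series_at_0 in L. apply (tends_ext_loc (nbhd' 0) (fun x => (a + b * x) - zeta_series tau x)).
      - generalize (Hab 0 : nbhd' 0 _). apply filter_imp. intros x Hx. rewrite <- Hx.
        unfold defect. rewrite zeta_unfold. ring.
      - eapply tends_eq; [exact L | ring]. }
    assert (L2 : tends (nbhd' 0) (fun x => 1 / (0 - x) - Z1 (0 - x)) a).
    { intros eps He. specialize (L1 eps He). replace (RtoC 0) with (0 - 0) in L1 by ring.
      exact (nbhd'_reflect 0 0 _ L1). }
    assert (L3 : tends (nbhd' 0) (fun x => 1 / (0 - x) - Z1 (0 - x)) (- a)).
    { apply tends_opp in L1; [| typeclasses eauto]. revert L1. apply tends_ext_loc; [typeclasses eauto |].
      apply (filter_and2 (nbhd' 0) _ _ _ (e2pi_near_neq_1 0) (nbhd'_ne 0)). intros x Hx Hx0.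
      replace (0 - x) with (- x) by ring. unfold Z1. rewrite (Zconv_1_odd tau Htau x Hx).
      field. exact Hx0. }
    pose proof (tends_unique (nbhd' 0) _ _ _ L2 L3) as E.
    assert (E2 : 2 * a = 0) by (transitivity (a + a); [ring | rewrite E at 1; ring]).
    replace a with (/ 2 * (2 * a)) by field. rewrite E2. ring. }
  exists b. eapply mer_eq_trans.
  - apply (mer_eq_of_eq _ (fun x => defect x + Z1 x)). intros x. unfold defect. ring.
  - eapply mer_eq_trans; [apply mer_eq_plus; [exact Hab | apply mer_eq_refl] |].
    apply mer_eq_of_eq. intros x. rewrite Ea. ring.
Qed.

Lemma e2_value b : mer_eq (zeta tau) (fun x => Z1 x + b * x) -> e2 tau = b.
Proof.
  intros H. apply const_value_mer_eq.
  eapply mer_eq_trans; [apply mer_eq_minus; [apply (mer_eq_shift 1 _ _ H) | exact H] |].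
  apply mer_eq_of_eq. intros x. unfold Z1. rewrite Zconv_period. ring.
Qed.

Lemma Zfun_Z1 : mer_eq (Zfun tau) Z1.
Proof.
  destruct zeta_Z1 as [b Hb]. pose proof (e2_value b Hb) as E.
  eapply mer_eq_trans.
  - exact (mer_eq_minus _ _ _ _ Hb (mer_eq_refl (fun x => e2 tau * x))).
  - apply mer_eq_of_eq. intros x. rewrite E. ring.
Qed.

Lemma Zfun_strip x : (0 < Im x < Im tau)%R -> Zfun tau x = Z1 x.
Proof.
  intros Hx. refine (tends_unique (nbhd' x) (Zfun tau) _ _ _ _).
  - apply tends_nbhd', diff_cont. unfold Zfun. apply diff_minus; [| diff_tac].
    now apply zeta_diff, strip_not_Lambda.
  - apply (tends_ext_loc (nbhd' x) Z1); [exact (mer_eq_sym _ _ Zfun_Z1 x) |].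
    apply tends_nbhd', diff_cont. apply Zconv_diff_strip; [exact Htau | simpl; lra].
Qed.

(** Legendre's relation, here a case of [Zconv_Delta]. *)
Lemma DeltaZ_value : DeltaZ tau = - twopii.
Proof.
  apply const_value_mer_eq. eapply mer_eq_trans; [apply mer_eq_Delta, Zfun_Z1 |].
  unfold Delta. eapply mer_eq_trans; [apply mer_eq_minus; [apply Z1_shift_tau | apply mer_eq_refl] |].
  apply mer_eq_of_eq. intros x. ring.
Qed.

(** * The convolution powers of Z *)

Lemma meromorphic_merom_at f : meromorphic f -> forall z0, merom_at f z0.
Proof.
  intros H z0. destruct (H z0) as [N [h [H1 [_ H3]]]]. exists N, h.
  split; [now apply hol_diff | exact H3].
Qed.

Lemma meromorphic_Zconv n : meromorphic (Zconv tau n).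
Proof.
  intros z0. destruct (simple_pole_Zconv tau Htau n z0) as [r [Hr _]]. destruct (Ceq_dec r 0) as [-> | Hne].
  - exists 0%nat. now apply simple_pole_order_0.
  - exists 1%nat. now apply simple_pole_order_1 with r.
Qed.

(** The contour and its reflection stay in the strip, where f and g are known
    pointwise. *)
Lemma is_conv_Zconv n f g : (1 <= n)%nat ->
  (forall x, (0 < Im x < Im tau)%R -> f x = Zconv tau n x) ->
  (forall x, (0 < Im x < Im tau)%R -> g x = Zconv tau 1 x) ->
  is_conv tau f g (Zconv tau (S n)).
Proof.
  intros Hn Hf Hg. split; [apply meromorphic_Zconv |]. split.
  - apply mer_eq_of_eq. intros x. apply Zconv_period.
  - intros x Hx. rewrite <- (conv_int_Zconv tau Htau n x Hn Hx).
    apply (CInt_ext (fun t => Zconv tau n (x - (t, Im x / 2)%R) * Zconv tau 1 (t, Im x / 2)%R)); [lra |].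
    intros t _. cbv zeta beta. rewrite Hf, Hg; [reflexivity | unfold Im; simpl; unfold Im in Hx; lra |].
    unfold Im in *; simpl. lra.
Qed.

Lemma is_conv_unique f g h h' : is_conv tau f g h -> is_conv tau f g h' -> mer_eq h h'.
Proof.
  intros [M1 [_ H1]] [M2 [_ H2]] z0.
  assert (Hp : nbhd' tau (fun z => h z - h' z = 0)).
  { apply nbhd_nbhd'. apply nbhd_Cmod. exists (Im tau). split; [exact Htau |]. intros w Hw.
    assert (B : (Rabs (Im w - Im tau) <= Cmod (w - tau))%R).
    { eapply Rle_trans; [| apply Rmax_Cmod]. eapply Rle_trans; [| apply Rmax_r].
      right. reflexivity. }
    pose proof (Rle_abs (Im w - Im tau)). pose proof (Rle_abs (- (Im w - Im tau))).
    rewrite Rabs_Ropp in *. rewrite H1, H2 by lra. ring. }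
  assert (HF : nbhd' z0 (fun z => h z - h' z = 0)).
  { apply (merom_at_identity (fun z => h z - h' z) tau z0); [| exact Hp].
    intros z. apply (merom_at_minus h h'); now apply meromorphic_merom_at. }
  revert HF. apply (filter_imp (F := nbhd' z0)). intros z Hz.
  replace (h z) with (h z - h' z + h' z) by ring. rewrite Hz. ring.
Qed.

(** The equality of values in the strip is carried along because the next
    integral sees values, which equality of meromorphic functions does not
    control. *)
Lemma conv_pow_Zconv k :
  mer_eq (conv_pow tau (Zfun tau) (S k)) (Zconv tau (S k)) /\
  forall x, (0 < Im x < Im tau)%R -> conv_pow tau (Zfun tau) (S k) x = Zconv tau (S k) x.
Proof.
  unfold conv_pow. simpl. rewrite Nat.sub_0_r.
  induction k as [| k [IH1 IH2]]; simpl.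
  - split; [apply Zfun_Z1 | apply Zfun_strip].
  - set (h := Nat.iter k (fun h => conv tau h (Zfun tau)) (Zfun tau)) in *.
    assert (HE : is_conv tau h (Zfun tau) (Zconv tau (S (S k)))).
    { apply is_conv_Zconv; [lia | exact IH2 | apply Zfun_strip]. }
    assert (HC : is_conv tau h (Zfun tau) (conv tau h (Zfun tau))).
    { unfold conv. apply epsilon_spec. now exists (Zconv tau (S (S k))). }
    split; [exact (is_conv_unique _ _ _ _ HC HE) |].
    intros x Hx. destruct HC as [_ [_ HC]]. destruct HE as [_ [_ HE]].
    rewrite HC, HE by lra. reflexivity.
Qed.

(** * The span of the convolution powers *)

(** Built one summand at a time, like [span], so that inductions on the two
    match. *)
Inductive Zspan : (C -> C) -> Prop :=
| Zspan_const f c : mer_eq f (fun _ => c) -> Zspan f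
| Zspan_step f g a n : Zspan g -> mer_eq f (fun x => a * Zconv tau (S n) x + g x) -> Zspan f.

Lemma Zspan_mer_eq f f' : mer_eq f' f -> Zspan f -> Zspan f'.
Proof.
  intros E H. destruct H as [f c H | f g a n Hg H].
  - apply (Zspan_const f' c). now apply mer_eq_trans with f.
  - apply (Zspan_step f' g a n Hg). now apply mer_eq_trans with f.
Qed.

Lemma Zspan_add_const f c : Zspan f -> Zspan (fun x => f x + c).
Proof.
  intros H. induction H as [f d H | f g a n Hg IH H].
  - apply (Zspan_const _ (d + c)). exact (mer_eq_plus _ _ _ _ H (mer_eq_refl (fun _ => c))).
  - apply (Zspan_step _ (fun x => g x + c) a n IH).
    eapply mer_eq_trans; [apply (mer_eq_plus _ _ _ _ H (mer_eq_refl (fun _ => c))) |].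
    apply mer_eq_of_eq. intros x. ring.
Qed.

Lemma Zspan_plus f g : Zspan f -> Zspan g -> Zspan (fun x => f x + g x).
Proof.
  intros Hf Hg. induction Hf as [f d H | f g' a n Hg' IH H].
  - apply (Zspan_mer_eq (fun x => g x + d)); [| now apply Zspan_add_const].
    eapply mer_eq_trans; [apply (mer_eq_plus _ _ _ _ H (mer_eq_refl g)) |].
    apply mer_eq_of_eq. intros x. ring.
  - apply (Zspan_step _ (fun x => g' x + g x) a n IH).
    eapply mer_eq_trans; [apply (mer_eq_plus _ _ _ _ H (mer_eq_refl g)) |].
    apply mer_eq_of_eq. intros x. ring.
Qed.

Lemma Zspan_Vsimple f : Zspan f -> Vsimple tau f.
Proof.
  intros H. induction H as [f d H | f g a n Hg IH H].
  - apply (Vsimple_mer_eq tau (fun _ => d)); [now apply mer_eq_sym | apply Vsimple_const].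
  - eapply Vsimple_mer_eq; [apply mer_eq_sym, H |].
    apply Vsimple_plus; [apply Vsimple_scal, Vsimple_Zconv, Htau | exact IH].
Qed.

(** By [Zconv_Delta], the function Zconv (n + 2) / (2 pi i) has Delta equal
    to Zconv (n + 1) up to a constant. *)
Lemma Zspan_antidifference f : Zspan f -> exists F c, Zspan F /\ mer_eq (Delta tau F) (fun x => f x + c).
Proof.
  intros H. induction H as [f d H | f g a n Hg [G [c [HG E]]] H].
  - exists (fun _ => 0), (- d). split; [apply (Zspan_const _ 0), mer_eq_refl |].
    apply mer_eq_sym. eapply mer_eq_trans; [apply (mer_eq_plus _ _ _ _ H (mer_eq_refl (fun _ => - d))) |].
    apply mer_eq_of_eq. intros x. unfold Delta. ring.
  - set (k := - (twopii * (- twopii / 2) ^ S n)).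
    exists (fun x => a / twopii * Zconv tau (S (S n)) x + G x), (c + a / twopii * k).
    split; [apply (Zspan_step _ G (a / twopii) (S n) HG), mer_eq_refl |].
    eapply mer_eq_trans.
    + apply (mer_eq_of_eq _ (fun x => a / twopii * Delta tau (Zconv tau (S (S n))) x + Delta tau G x)).
      intros x. unfold Delta. ring.
    + eapply mer_eq_trans; [apply mer_eq_plus; [apply mer_eq_scal, (Zconv_Delta_mer tau Htau) | exact E] |].
      eapply mer_eq_trans.
      * apply (mer_eq_of_eq _ (fun x => (a * Zconv tau (S n) x + g x) + (c + a / twopii * k))).
        intros x. fold k. pose proof twopii_neq_0. field. assumption.
      * apply mer_eq_plus; [now apply mer_eq_sym | apply mer_eq_refl].
Qed.

(** All residues of g equal the one at 0, say r, so g - r Z1 is entire with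
    constant increments, hence affine; its slope is 0 because it has period
    1. *)
Lemma Vsimple_Delta_const g c : Vsimple tau g -> mer_eq (Delta tau g) (fun _ => c) -> Zspan g.
Proof.
  intros [Hs [Hp _]] Hc. destruct (Hs 0) as [r [Hr _]].
  assert (Q1 : mer_eq (fun x => g (x + 1)) (fun x => g x + 0)).
  { eapply mer_eq_trans; [exact Hp |]. apply mer_eq_of_eq. intros x. ring. }
  assert (Q2 : mer_eq (fun x => g (x + tau)) (fun x => g x + c)).
  { eapply mer_eq_trans; [| apply (mer_eq_plus _ _ _ _ (mer_eq_refl g) Hc)].
    apply mer_eq_of_eq. intros x. unfold Delta. ring. }
  set (h := fun x => g x - r * Z1 x).
  assert (H1 : mer_eq (fun x => h (x + 1)) (fun x => h x + 0)).
  { unfold h. eapply mer_eq_trans; [apply mer_eq_minus; [exact Q1 | apply mer_eq_scal, Z1_shift_1] |].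
    apply mer_eq_of_eq. intros x. ring. }
  assert (H2 : mer_eq (fun x => h (x + tau)) (fun x => h x + (c + r * twopii))).
  { unfold h. eapply mer_eq_trans; [apply mer_eq_minus; [exact Q2 | apply mer_eq_scal, Z1_shift_tau] |].
    apply mer_eq_of_eq. intros x. ring. }
  assert (Hh : forall z0, simple_pole h z0 0).
  { intros z0. destruct (Classical_Prop.classic (Lambda tau z0)) as [HL | HL].
    - apply (simple_pole_lattice h 0 (c + r * twopii) 0 H1 H2); [| exact HL].
      eapply simple_pole_eq; [apply simple_pole_minus; [exact Hr | apply simple_pole_scal, simple_pole_Z1_0] | ring].
    - destruct (Hs z0) as [s [Hss Ls]]. destruct (simple_pole_Zconv tau Htau 1 z0) as [u [Hu Lu]].
      assert (s = 0) as ->.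
      { destruct (Ceq_dec s 0) as [E | Hne]; [exact E |]. exfalso. auto. }
      assert (u = 0) as ->.
      { destruct (Ceq_dec u 0) as [E | Hne]; [exact E |]. exfalso. auto. }
      eapply simple_pole_eq; [apply simple_pole_minus; [exact Hss | apply simple_pole_scal, Hu] | ring]. }
  destruct (mer_entire_affine h 0 (c + r * twopii) Hh H1 H2) as [a [b Hab]].
  assert (Eb : b = 0).
  { apply mer_eq_const_inj.
    eapply mer_eq_trans; [| apply (mer_eq_of_eq (fun x => h x + 0 - h x))].
    - eapply mer_eq_trans; [| apply mer_eq_minus; [exact H1 | apply mer_eq_refl]].
      apply mer_eq_sym.
      eapply mer_eq_trans; [apply mer_eq_minus; [apply (mer_eq_shift 1 _ _ Hab) | exact Hab] |].
      apply mer_eq_of_eq. intros x. ring.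
    - intros x. ring. }
  apply (Zspan_step g (fun _ => a) r 0); [apply (Zspan_const _ a), mer_eq_refl |].
  eapply mer_eq_trans; [apply (mer_eq_of_eq g (fun x => r * Z1 x + h x)); intros x; unfold h; ring |].
  apply mer_eq_plus; [apply mer_eq_refl |].
  eapply mer_eq_trans; [exact Hab |]. apply mer_eq_of_eq. intros x. rewrite Eb. ring.
Qed.

(** Induction on k with Delta^k f = 0: subtracting from f an antidifference
    of [Delta f] in the span leaves a function with constant [Delta]. *)
Lemma Vsimple_Zspan f : Vsimple tau f -> Zspan f.
Proof.
  intros HV. pose proof HV as [_ [_ [k Hk]]]. revert f HV Hk.
  induction k as [| k IH]; intros f HV Hk.
  - now apply (Zspan_const f 0).
  - rewrite Nat.iter_succ_r in Hk.
    destruct (Zspan_antidifference _ (IH _ (Vsimple_Delta tau f HV) Hk)) as [F [c [HF E]]].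
    set (g := fun x => f x + - (1) * F x).
    assert (Hg : Vsimple tau g) by (apply Vsimple_plus; [exact HV | now apply Vsimple_scal, Zspan_Vsimple]).
    assert (Hc : mer_eq (Delta tau g) (fun _ => - c)).
    { eapply mer_eq_trans.
      - apply (mer_eq_of_eq _ (fun x => Delta tau f x - Delta tau F x)). intros x.
        unfold g, Delta. ring.
      - eapply mer_eq_trans; [apply mer_eq_minus; [apply mer_eq_refl | exact E] |].
        apply mer_eq_of_eq. intros x. ring. }
    apply (Zspan_mer_eq (fun x => g x + F x)); [apply mer_eq_of_eq; intros x; unfold g; ring |].
    apply Zspan_plus; [now apply (Vsimple_Delta_const g (- c)) | exact HF].
Qed.

(** Classes modulo constants are predicates, so their equality is
    extensional. *)
Lemma pred_ext {X} (P Q : X -> Prop) : (forall x, P x <-> Q x) -> P = Q.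
Proof. intros H. apply functional_extensionality. intros x. now apply propositional_extensionality. Qed.

Lemma cls_eq f g c : mer_eq f (fun x => g x + c) -> cls f = cls g.
Proof.
  intros H. apply pred_ext. intros u. split; intros [d Hd].
  - exists (c + d). eapply mer_eq_trans; [exact Hd |].
    eapply mer_eq_trans; [apply (mer_eq_plus _ _ _ _ H (mer_eq_refl (fun _ => d))) |].
    apply mer_eq_of_eq. intros x. ring.
  - exists (d - c). eapply mer_eq_trans; [exact Hd |].
    eapply mer_eq_trans; [| apply (mer_eq_plus _ _ _ _ (mer_eq_sym _ _ H) (mer_eq_refl (fun _ => d - c)))].
    apply mer_eq_of_eq. intros x. ring.
Qed.

Lemma cls_lin a f g : cls_add (cls_scal a (cls f)) (cls g) = cls (fun x => a * f x + g x).
Proof.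
  apply pred_ext. intros u. split.
  - intros [v [w [[v' [[c Hc] [d Hd]]] [[e He] [k Hk]]]]].
    exists (a * c + d + e + k). eapply mer_eq_trans; [exact Hk |].
    eapply mer_eq_trans.
    + apply mer_eq_plus; [apply mer_eq_plus; [| exact He] | apply mer_eq_refl].
      eapply mer_eq_trans; [exact Hd |]. apply mer_eq_plus; [| apply mer_eq_refl].
      apply mer_eq_scal. exact Hc.
    + apply mer_eq_of_eq. intros x. ring.
  - intros [k Hk]. exists (fun x => a * f x), g. split; [| split].
    + exists f. split; [exists 0 | exists 0]; apply mer_eq_of_eq; intros x; ring.
    + exists 0. apply mer_eq_of_eq; intros x; ring.
    + exists k. exact Hk.
Qed.

Let B (Y : (C -> C) -> Prop) : Prop :=
  exists n : nat, (1 <= n)%nat /\ Y = cls (conv_pow tau (Zfun tau) n).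

Lemma span_Zspan X : span B X <-> exists f, Zspan f /\ X = cls f.
Proof.
  split.
  - intros H. induction H as [| a X Y [n [Hn ->]] _ [g [Hg ->]]].
    + exists (fun _ => 0). split; [apply (Zspan_const _ 0), mer_eq_refl | reflexivity].
    + exists (fun x => a * conv_pow tau (Zfun tau) n x + g x). split; [| apply cls_lin].
      destruct n as [| n]; [lia |]. apply (Zspan_step _ g a n Hg).
      apply mer_eq_plus; [| apply mer_eq_refl]. apply mer_eq_scal, conv_pow_Zconv.
  - intros [f [Hf ->]]. induction Hf as [f c H | f g a n Hg IH H].
    + replace (cls f) with (cls (fun _ => 0)); [constructor |].
      symmetry. apply (cls_eq f _ c). eapply mer_eq_trans; [exact H |].
      apply mer_eq_of_eq. intros x. ring.
    + replace (cls f) with (cls_add (cls_scal a (cls (conv_pow tau (Zfun tau) (S n)))) (cls g)).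
      * apply span_add; [| exact IH]. exists (S n). split; [lia | reflexivity].
      * rewrite cls_lin. symmetry. apply (cls_eq _ _ 0).
        eapply mer_eq_trans; [exact H |].
        eapply mer_eq_trans.
        -- apply mer_eq_plus; [| apply mer_eq_refl]. apply mer_eq_scal.
           apply mer_eq_sym, (proj1 (conv_pow_Zconv n)).
        -- apply mer_eq_of_eq. intros x. ring.
Qed.

Lemma simple_pole_residue f z0 r : simple_pole f z0 r -> is_residue f z0 r.
Proof.
  intros [h [Hh Hf]]. exists 0%nat, (fun _ => r), h. split; [now apply hol_diff |].
  split; [| reflexivity]. revert Hf. apply (filter_imp (F := nbhd' z0)). intros z ->.
  rewrite sum_O. simpl. now rewrite Cmult_1_r.
Qed.
End Main.

Theorem theorem5 (tau : C) (Htau : (0 < Im tau)%R) :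
  (is_subspace (V tau) /\
   (forall X : (C -> C) -> Prop,
      mod_const (V tau) X <->
      span (fun Y => exists n : nat,
              (1 <= n)%nat /\ Y = cls (conv_pow tau (Zfun tau) n)) X)) /\
  (forall n m : nat, (1 <= n)%nat ->
     is_residue (conv_pow tau (Zfun tau) n) (RtoC (INR m) * tau)
       ((- DeltaZ tau) ^ (n - 1) * RtoC (gbinom (INR m - 1) (n - 1)))).
Proof.
  split; [split |].
  - split; [| split].
    + apply V_Vsimple, Vsimple_const.
    + intros f g Hf Hg. apply V_Vsimple. apply V_Vsimple in Hf. apply V_Vsimple in Hg. now apply Vsimple_plus.
    + intros a f Hf. apply V_Vsimple. apply V_Vsimple in Hf. now apply Vsimple_scal.
  - intros X. rewrite (span_Zspan tau Htau X). split; intros [f [Hf ->]]; exists f; (split; [| reflexivity]).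
    + now apply Vsimple_Zspan, V_Vsimple.
    + now apply V_Vsimple, Zspan_Vsimple.
  - intros n m Hn. destruct n as [| n]; [lia |]. apply simple_pole_residue.
    apply (simple_pole_mer_eq (Zconv tau (S n))); [apply mer_eq_sym, conv_pow_Zconv, Htau |].
    eapply simple_pole_eq; [apply (simple_pole_Zconv_at tau Htau n m) |].
    rewrite (DeltaZ_value tau Htau). simpl (S n - 1)%nat. rewrite Nat.sub_0_r.
    now replace (- - twopii) with twopii by ring.
Qed.
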